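(* Let $(M\times\bar M,K,h,\Omega)$ be a Kim--McCann manifold endowed with a para-holomorphic $n$-form $\Omega=\tau\rho(x)\,dx+\bar\tau\bar\rho(\bar x)\,d\bar x$ as in the context, and let $L(t)=F(L_0,t)$, $t\in[0,t_0]$, be a family of spacelike $n$-dimensional submanifolds, given by a smooth family of immersions $F(\cdot,t):L_0\to (M\times\bar M)\setminus\mathscr C$ of a closed manifold $L_0$, flowing by the generalized mean curvature flow $$\left(\frac{\partial F}{\partial t}\right)^{\perp}=\vec H-n(\hat\nabla\psi)^{\perp}.$$ If $L(0)$ is Lagrangian, then $L(t)$ is Lagrangian for all $t>0$ (for which the flow is defined).
   Context: Kim--McCann manifold: a product $M^n\times\bar M^n$ of $n$-manifolds ($n\ge 2$, $M\times \bar M$ compact) with a set $\mathscr C$ (the cut locus, where the metric is not defined) and, on the complement of $\mathscr C$, a pseudo-Riemannian metric $h$ of signature $(n,n)$ such that near every point of the complement there is a locally defined function $c$ (at least $C^4$) with $h(V,\bar W)=-\tfrac12 V\bar W c$ for $V\in T_xM$, $\bar W\in T_{\bar x}\bar M$, while $h$ vanishes on pairs of vectors tangent to the same factor. With $c_{i\bar s}=\partial^2c/\partial x^i\partial\bar x^s$, $h=\frac12\begin{pmatrix}0&-c_{i\bar s}\\-c_{\bar s i}&0\end{pmatrix}$. $K=I_{TM}\oplus(-I)_{T\bar M}$ is the para-complex structure and $\omega(\cdot,\cdot)=h(K\cdot,\cdot)=-\tfrac12c_{i\bar s}dx^i\wedge d\bar x^s$ is the (para-)Kähler form. Para-complex numbers: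 $\mathbf k^2=1$, $\tau=\tfrac12(1+\mathbf k)$, $\bar\tau=\tfrac12(1-\mathbf k)$. The para-holomorphic $n$-form is $\Omega=\tau\rho(x)dx+\bar\tau\bar\rho(\bar x)d\bar x$ with $dx=dx^1\wedge\dots\wedge dx^n$, $d\bar x=d\bar x^1\wedge\dots\wedge d\bar x^n$, $\rho,\bar\rho>0$ (coordinates oriented so that $\det(-c_{i\bar s})>0$). Set $\psi=\frac1{2n}\left(\ln\rho+\ln\bar\rho-\ln\det(-c_{i\bar s})\right)$; this is a coordinate-independent function. An immersed $n$-dimensional submanifold $L$ is spacelike if the induced metric $g$ is positive definite, and Lagrangian if $\omega|_L=0$. $\hat\nabla$ is the Levi-Civita connection (and $\hat\nabla\psi$ the gradient) of $h$; $\perp$ is the $h$-orthogonal projection to the normal bundle; $A(X,Y)=(\hat\nabla_XY)^\perp$ and $\vec H=g^{ij}A(F_i,F_j)$, where $F_i=\partial_iF$. *)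

(* Defs.v *)
From HB Require Import structures.
From mathcomp Require Import all_boot all_order all_algebra.
From mathcomp Require Import all_classical all_reals all_analysis.
From mathcomp Require Import ring.
Set Implicit Arguments.
Unset Strict Implicit.
Unset Printing Implicit Defensive.
Import Order.TTheory GRing.Theory Num.Theory.
Import numFieldNormedType.Exports.
Local Open Scope classical_set_scope.
Local Open Scope ring_scope.

(* Tangent vectors in a chart are row vectors, so a Jacobian has the partial
   derivatives of the map as its rows and acts on the right, and a bilinear
   form with Gram matrix G is (u, v) |-> u *m G *m v^T. *)

Section Calculus.
Variable R : realType.

Definition partial n (i : 'I_n) (f : 'rV[R]_n -> R) (x : 'rV[R]_n) : R :=
  'D_(delta_mx 0 i) f x.

Fixpoint Ck n (k : nat) (U : set 'rV[R]_n) (f : 'rV[R]_n -> R) : Prop :=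
  (forall x, U x -> {for x, continuous f}) /\
  (if k is k'.+1 then
     forall i : 'I_n, (forall x, U x -> derivable f x (delta_mx 0 i)) /\
                      Ck k' U (partial i f)
   else True).

(* A need not be open: f is smooth on A when it extends locally to smooth
   functions on open sets. This covers time intervals with their endpoints. *)
Definition smooth_on n (A : set 'rV[R]_n) (f : 'rV[R]_n -> R) : Prop :=
  forall x, A x -> exists (U : set 'rV[R]_n) (g : 'rV[R]_n -> R),
    [/\ open U, U x, (forall k, Ck k U g)
      & forall y, A y -> U y -> f y = g y].

Definition smooth_map_on n m (A : set 'rV[R]_n)
    (f : 'rV[R]_n -> 'rV[R]_m) : Prop :=
  forall j : 'I_m, smooth_on A (fun x => f x 0 j).

Definition jac n m (f : 'rV[R]_n -> 'rV[R]_m) (x : 'rV[R]_n) : 'M[R]_(n, m) :=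
  \matrix_(i < n, j < m) partial i (fun y => f y 0 j) x.

(* v is the derivative of y at t relative to I (one-sided at an endpoint). *)
Definition velocity_within n (I : set R) (y : R -> 'rV[R]_n) (t : R)
    (v : 'rV[R]_n) : Prop :=
  (fun s : R => (s - t)^-1 *: (y s - y t)) @ within I t^' --> v.

End Calculus.

Section Manifolds.
Variable R : realType.

(* cinv c is only meaningful on the image of dom c. *)
Record chart (T : Type) (n : nat) := Chart {
  dom : set T;
  cmap :> T -> 'rV[R]_n;
  cinv : 'rV[R]_n -> T }.

Definition img T n (c : chart T n) : set 'rV[R]_n := cmap c @` dom c.

Definition is_chart (T : topologicalType) n (c : chart T n) : Prop :=
  [/\ open (dom c), open (img c),
      (forall p, dom c p -> {for p, continuous (cmap c)}),
      (forall x, img c x -> {for x, continuous (cinv c)})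
    & forall p, dom c p -> cinv c (c p) = p].

Definition transition T n (c d : chart T n) (x : 'rV[R]_n) : 'rV[R]_n :=
  d (cinv c x).

Record manifold (n : nat) := Manifold {
  carrier :> topologicalType;
  atlas : set (chart carrier n);
  manifold_hausdorff : hausdorff_space carrier;
  manifold_countable : @second_countable carrier;
  atlas_chart : forall c, atlas c -> is_chart c;
  atlas_cover : forall p : carrier, exists2 c, atlas c & dom c p;
  atlas_smooth : forall c d, atlas c -> atlas d ->
    smooth_map_on (cmap c @` (dom c `&` dom d)) (transition c d) }.

Definition prod_chart S T n m (a : chart S n) (b : chart T m) :
    chart (S * T) (n + m) :=
  Chart (dom a `*` dom b)
        (fun p => row_mx (a p.1) (b p.2))
        (fun z => (cinv a (lsubmx z), cinv b (rsubmx z))).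

End Manifolds.
Arguments chart R T n : clear implicits.

Section KimMcCann.
Variables (R : realType) (n : nat).

Definition neutral_signature (G : 'M[R]_(n + n)) : Prop :=
  exists2 P : 'M[R]_(n + n), P \in unitmx &
    P *m G *m P^T = block_mx 1%:M 0 0 (- 1%:M).

(* hmet (prod_chart a b) p is the Gram matrix of h at p in the coordinates
   (x, xbar) given by a and b; it is meaningless on the cut locus. *)
Record KimMcCann (M Mb : manifold R n) := MkKimMcCann {
  cut_locus : set (M * Mb);
  hmet : chart R (M * Mb) (n + n) -> M * Mb -> 'M[R]_(n + n);
  cut_locus_closed : closed cut_locus;
  hmet_sym : forall a b p, atlas a -> atlas b ->
    dom (prod_chart a b) p -> ~ cut_locus p ->
    (hmet (prod_chart a b) p)^T = hmet (prod_chart a b) p;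
  hmet_signature : forall a b p, atlas a -> atlas b ->
    dom (prod_chart a b) p -> ~ cut_locus p ->
    neutral_signature (hmet (prod_chart a b) p);
  hmet_tensor : forall a b a' b' p,
    atlas a -> atlas b -> atlas a' -> atlas b' ->
    dom (prod_chart a b) p -> dom (prod_chart a' b') p -> ~ cut_locus p ->
    let J := jac (transition (prod_chart a b) (prod_chart a' b'))
                 (prod_chart a b p) in
    hmet (prod_chart a b) p = J *m hmet (prod_chart a' b') p *m J^T;
  hmet_isotropic : forall a b p, atlas a -> atlas b ->
    dom (prod_chart a b) p -> ~ cut_locus p ->
    ulsubmx (hmet (prod_chart a b) p) = 0 /\
    drsubmx (hmet (prod_chart a b) p) = 0;
  hmet_cost : forall p, ~ cut_locus p ->
    exists (U : set (M * Mb)) (c : M * Mb -> R),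
      [/\ open U, U p, U `<=` ~` cut_locus &
        forall a b, atlas a -> atlas b ->
          let W := prod_chart a b in
          Ck 4 (cmap W @` (dom W `&` U)) (c \o cinv W) /\
          forall q, dom W q -> U q ->
            forall i s : 'I_n,
              hmet W q (lshift n i) (rshift n s) =
              - 2^-1 * partial (lshift n i)
                         (partial (rshift n s) (c \o cinv W)) (W q)] }.

(* K acts on row vectors from the right. *)
Definition Kmx : 'M[R]_(n + n) := block_mx 1%:M 0 0 (- 1%:M).

Definition bilin N (G : 'M[R]_N) (u v : 'rV[R]_N) : R := (u *m G *m v^T) 0 0.

Definition kahler_form (G : 'M[R]_(n + n)) (u v : 'rV[R]_(n + n)) : R :=
  bilin G (u *m Kmx) v.

(* The para-complex number x + k y is the pair (x, y). *)
Definition para : lmodType R := (R^o * R^o)%type.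
Definition para_mul (z w : para) : para :=
  (z.1 * w.1 + z.2 * w.2, z.1 * w.2 + z.2 * w.1).
Definition para_one : para := (1, 0).
Definition para_k : para := (0, 1).
Definition tau : para := 2^-1 *: (para_one + para_k).
Definition taub : para := 2^-1 *: (para_one - para_k).

Lemma para_k2 : para_mul para_k para_k = para_one.
Proof. by rewrite /para_mul /= !mul0r mulr0 mul1r add0r addr0. Qed.

(* A positive n-form rho dx on a manifold, by its coefficients in the charts.
   Positivity forces every coordinate change to be orientation preserving, so
   an atlas carrying such a form is an oriented one. *)
Record positive_nform (M : manifold R n) := MkPositiveForm {
  rho :> chart R M n -> M -> R;
  rho_gt0 : forall a p, atlas a -> dom a p -> 0 < rho a p;
  rho_smooth : forall a, atlas a -> smooth_on (img a) (rho a \o cinv a);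
  rho_nform : forall a a' p, atlas a -> atlas a' -> dom a p -> dom a' p ->
    rho a p = \det (jac (transition a a') (a p)) * rho a' p }.

(* Om (prod_chart a b) p V is the value of the n-form on the n tangent vectors
   at p whose coordinates are the rows of V, so that dx takes the value
   \det (lsubmx V) and dxbar the value \det (rsubmx V). *)
Record para_nform (M Mb : manifold R n) := MkParaForm {
  Om :> chart R (M * Mb) (n + n) -> M * Mb -> 'M[R]_(n, n + n) -> para;
  form_l : positive_nform M;
  form_r : positive_nform Mb;
  OmE : forall a b p V, atlas a -> atlas b -> dom (prod_chart a b) p ->
    Om (prod_chart a b) p V =
      (form_l a p.1 * \det (lsubmx V)) *: tau
      + (form_r b p.2 * \det (rsubmx V)) *: taub }.

Variables (M Mb : manifold R n) (X : KimMcCann M Mb) (Omega : para_nform M Mb).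

(* The matrix - c_{i sbar}, which is 2 h_{i sbar}. *)
Definition neg_mixed_hessian (a : chart R M n) (b : chart R Mb n)
    (p : M * Mb) : 'M[R]_n :=
  2 *: ursubmx (hmet X (prod_chart a b) p).

(* The positive form rho dx orients M, and rhobar dxbar orients Mb. *)
Definition compatible_orientation : Prop :=
  forall a b p, atlas a -> atlas b -> dom (prod_chart a b) p -> ~ cut_locus X p ->
    0 < \det (neg_mixed_hessian a b p).

Definition psi (a : chart R M n) (b : chart R Mb n) (p : M * Mb) : R :=
  (n.*2)%:R^-1 * (ln (form_l Omega a p.1) + ln (form_r Omega b p.2)
                  - ln (\det (neg_mixed_hessian a b p))).

End KimMcCann.

(* G is the Gram matrix of the ambient metric and f an immersion, both read in
   charts. *)
Section Submanifold.
Variables (R : realType) (m N : nat).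
Variables (G : 'rV[R]_N -> 'M[R]_N) (f : 'rV[R]_m -> 'rV[R]_N).

(* Gamma^c_{ab} *)
Definition christoffel (z : 'rV[R]_N) (a b c : 'I_N) : R :=
  2^-1 * \sum_(d < N) invmx (G z) c d *
    (partial a (fun y => G y b d) z + partial b (fun y => G y a d) z
     - partial d (fun y => G y a b) z).

Definition gradient (h : 'rV[R]_N -> R) (z : 'rV[R]_N) : 'rV[R]_N :=
  (\row_a partial a h z) *m invmx (G z).

Definition induced_metric (u : 'rV[R]_m) : 'M[R]_m :=
  jac f u *m G (f u) *m (jac f u)^T.

(* v - g^{kl} h(v, F_k) F_l *)
Definition normal_part (u : 'rV[R]_m) (v : 'rV[R]_N) : 'rV[R]_N :=
  v - v *m G (f u) *m (jac f u)^T *m invmx (induced_metric u) *m jac f u.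

(* The covariant derivative of F_j in the direction F_i. *)
Definition cov_deriv (u : 'rV[R]_m) (i j : 'I_m) : 'rV[R]_N :=
  \row_c (partial i (partial j (fun y => f y 0 c)) u
          + \sum_a \sum_b christoffel (f u) a b c * jac f u i a * jac f u j b).

Definition second_fundamental (u : 'rV[R]_m) (i j : 'I_m) : 'rV[R]_N :=
  normal_part u (cov_deriv u i j).

Definition mean_curvature (u : 'rV[R]_m) : 'rV[R]_N :=
  \sum_i \sum_j invmx (induced_metric u) i j *: second_fundamental u i j.

(* christoffel_torsion_free and christoffel_metric are the properties that
   characterize the Levi-Civita connection. *)

Lemma partial_metric_sym z a b c :
  (\forall y \near z, (G y)^T = G y) ->
  partial a (fun y => G y b c) z = partial a (fun y => G y c b) z.
Proof.
move=> Gsym; rewrite /partial; apply: near_eq_derive.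
by near=> y; rewrite -[in LHS](near Gsym y) ?mxE.
Unshelve. all: by end_near.
Qed.

Lemma christoffel_torsion_free z a b c :
  (\forall y \near z, (G y)^T = G y) ->
  christoffel z a b c = christoffel z b a c.
Proof.
move=> Gsym; congr (_ * _); apply: eq_bigr => d _.
rewrite [partial d (fun y => G y a b) z]partial_metric_sym //.
by rewrite (addrC (partial a _ _)).
Qed.

Lemma christoffel_lower z a b c : G z \in unitmx ->
  \sum_d G z c d * christoffel z a b d =
  2^-1 * (partial a (fun y => G y b c) z + partial b (fun y => G y a c) z
          - partial c (fun y => G y a b) z).
Proof.
move=> Gu; set S := fun d => partial a (fun y => G y b d) z
  + partial b (fun y => G y a d) z - partial d (fun y => G y a b) z.
have -> : \sum_d G z c d * christoffel z a b d
    = 2^-1 * (G z *m (invmx (G z) *m \col_d S d)) c 0.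
  rewrite mxE mulr_sumr; apply: eq_bigr => d _; rewrite mulrCA.
  by congr (_ * (_ * _)); rewrite mxE; apply: eq_bigr => e _; rewrite mxE.
by rewrite mulKVmx // mxE.
Qed.

Lemma christoffel_metric z a b c :
  (\forall y \near z, (G y)^T = G y) -> G z \in unitmx ->
  partial a (fun y => G y b c) z =
  \sum_d (christoffel z a b d * G z d c + christoffel z a c d * G z b d).
Proof.
move=> Gsym Gu; have Gz := nbhs_singleton Gsym.
rewrite big_split /=.
under eq_bigr => d _ do rewrite mulrC -Gz mxE.
under [X in _ + X]eq_bigr => d _ do rewrite mulrC.
rewrite !christoffel_lower // (partial_metric_sym a c b Gsym).
by field.
Qed.

Lemma normal_part_orthogonal u v (i : 'I_m) :
  induced_metric u \in unitmx ->
  bilin (G (f u)) (normal_part u v) (row i (jac f u)) = 0.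
Proof.
move=> gu; rewrite /bilin.
have -> : (row i (jac f u))^T = (jac f u)^T *m delta_mx i 0.
  by rewrite rowE trmx_mul trmx_delta.
rewrite mulmxA; suff -> : normal_part u v *m G (f u) *m (jac f u)^T = 0.
  by rewrite mul0mx mxE.
rewrite /normal_part !mulmxBl -(mulmxA _ (jac f u)) -(mulmxA _ (jac f u *m _)).
by rewrite -/(induced_metric u) mulmxKV // subrr.
Qed.

End Submanifold.

Section Flow.
Variables (R : realType) (n : nat) (M Mb L : manifold R n).
Variables (X : KimMcCann M Mb) (Omega : para_nform M Mb).
Variables (t0 : R) (F : R -> L -> M * Mb).

Definition local_map (l : chart R L n) (a : chart R M n) (b : chart R Mb n)
    (t : R) (u : 'rV[R]_n) : 'rV[R]_(n + n) :=
  prod_chart a b (F t (cinv l u)).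

Definition local_metric (a : chart R M n) (b : chart R Mb n)
    (z : 'rV[R]_(n + n)) : 'M[R]_(n + n) :=
  hmet X (prod_chart a b) (cinv (prod_chart a b) z).

Definition local_psi (a : chart R M n) (b : chart R Mb n)
    (z : 'rV[R]_(n + n)) : R :=
  psi X Omega a b (cinv (prod_chart a b) z).

Definition charts_at (t : R) (p : L)
    (l : chart R L n) (a : chart R M n) (b : chart R Mb n) : Prop :=
  [/\ atlas l, atlas a, atlas b, dom l p & dom (prod_chart a b) (F t p)].

(* Joint smoothness on L x [0, t0]. *)
Definition smooth_family : Prop :=
  {within [set q : R * L | 0 <= q.1 <= t0],
     continuous (fun q : R * L => F q.1 q.2)} /\
  forall l a b, atlas l -> atlas a -> atlas b ->
    smooth_map_on
      [set w : 'rV[R]_(n + 1) |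
        [/\ img l (lsubmx w), 0 <= rsubmx w 0 0 <= t0
          & dom (prod_chart a b) (F (rsubmx w 0 0) (cinv l (lsubmx w)))]]
      (fun w => local_map l a b (rsubmx w 0 0) (lsubmx w)).

Definition immersion_at_time (t : R) : Prop :=
  forall p l a b, charts_at t p l a b ->
    row_free (jac (local_map l a b t) (l p)).

Definition spacelike_at_time (t : R) : Prop :=
  forall p l a b, charts_at t p l a b ->
    forall v : 'rV[R]_n, v != 0 ->
      0 < bilin (induced_metric (local_metric a b) (local_map l a b t) (l p)) v v.

Definition lagrangian_at_time (t : R) : Prop :=
  forall p l a b, charts_at t p l a b ->
    let J := jac (local_map l a b t) (l p) in
    forall i j : 'I_n,
      kahler_form (hmet X (prod_chart a b) (F t p)) (row i J) (row j J) = 0.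

Definition generalized_mcf : Prop :=
  forall t, 0 <= t <= t0 -> forall p l a b, charts_at t p l a b ->
    let G := local_metric a b in
    let f := local_map l a b t in
    let u := l p in
    exists2 v : 'rV[R]_(n + n),
      velocity_within [set s : R | 0 <= s <= t0]
        (fun s => prod_chart a b (F s p)) t v &
      normal_part G f u v =
      mean_curvature G f u
      - n%:R *: normal_part G f u (gradient G (local_psi a b) (f u)).

End Flow.

(* Main.v *)
From HB Require Import structures.
Require Import Defs.
From mathcomp Require Import all_boot all_order all_algebra.
From mathcomp Require Import all_classical all_reals all_analysis.
From mathcomp Require Import perm ring lra.
Import Order.TTheory GRing.Theory Num.Theory.
Import numFieldNormedType.Exports.
Local Open Scope classical_set_scope.
Local Open Scope ring_scope.


(** Why Lagrangian is preserved.

    Read F in a product chart of M x Mbar and let (A | B) be its Jacobian. With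
    the mixed block C = (h_{i sbar}) = - c_{i sbar} / 2 of h and E = A C B^T,
    the induced metric is g = E + E^T and the restricted Kaehler form is
    al = E - E^T. The function Q = |al|^2_g = tr (g^-1 al g^-1 al^T) does not
    depend on charts and vanishes exactly when L(t) is Lagrangian, so it is
    enough to prove that Q, which is 0 at time 0, stays 0.

    The form omega is closed, being locally d q_s /\ d xbar^s with
    q_s = - 1/2 d_{sbar} c; so is its pullback to space-time, whose space part
    is al and whose time-space part is mu_k = omega (d_t F, F_k). Closedness
    (Lam_closed) contains Cartan's formula d_t al = d mu. The flow says that
    d_t F - g^ij D_i F_j + n grad psi is tangent to L(t), so that, up to a term
    linear in al, mu_k is the contraction of g^ij D_i F_j - n grad psi with
    omega (., F_k) (flow_identity). Splitting D_i F_j into its two isotropic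
    components and using 2 E = g + al, this becomes (mu_formula)
      mu_k = g^ij d_i al_jk + kap_k / 2 + terms linear in al,
      kap = d ln (rho det A) - d ln (rhobar det B).
    The logarithmic derivatives of det C cancel, and this is what psi is for.
    As kap is closed it disappears from d mu, and closedness of al turns the
    exterior derivative of its divergence into a Laplacian (omx_evolution):
      d_t al = g^pq d_p d_q al + terms linear in al and d al.
    Hence d_t Q <= g^pq d_p d_q Q + const Q locally (evolution_inequality,
    local_evolution): the gradient terms are absorbed by the nonnegative
    g^pq <d_p al, d_q al> in the Hessian of Q.

    As [0, t0] x L0 is compact, finitely many of the local constants suffice,
    so for a large lam the function e^(- lam t) Q has no positive maximum at a
    positive time (no_interior_max). Its maximum over [0, t0] x L0 is therefore
    0 (omega_vanishes). The flow is only assumed on a closed interval of times,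
    so F is extended locally past it, and the flow equation is differentiated
    in space directions only. *)

Set Implicit Arguments.
Unset Strict Implicit.
Unset Printing Implicit Defensive.

(** * Functions of class C^k of several variables *)

Section LineCalculus.
Variable R : realType.
Variable m : nat.
Implicit Types (f g : 'rV[R]_m -> R) (x v : 'rV[R]_m).

Lemma derive_line (V V' : normedModType R) (F : V -> V') (x v : V) :
  'D_v F x = 'D_1 (fun h : R => F (h *: v + x)) 0.
Proof.
rewrite /derive; set g1 := fun h => _; set g2 := fun h => _; suff -> : g1 = g2 by [].
by apply/funext => h; rewrite /g1 /g2 /= addr0 scale0r add0r [_%:A]mulr1.
Qed.

Lemma derive1_line f x v (s : R) :
  derivable f (s *: v + x) v ->
  is_derive s 1 (fun s : R => f (s *: v + x)) ('D_v f (s *: v + x)).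
Proof.
have E : (fun h : R => h^-1 *: (((fun s : R => f (s *: v + x)) \o shift s) (h *: 1)
      - f (s *: v + x)))
   = (fun h : R => h^-1 *: ((f \o shift (s *: v + x)) (h *: v) - f (s *: v + x))).
  apply/funext => h /=; congr (_ *: (f _ - _)).
  by rewrite scalerDl addrA [h *: 1]mulr1.
move=> df; apply: DeriveDef; last by rewrite /derive E.
by move: df; rewrite /derivable E.
Qed.

Lemma MVT_line f x v (c : R) :
  (forall s : R, `|s| <= `|c| -> derivable f (s *: v + x) v) ->
  exists2 s : R, `|s| <= `|c| & f (c *: v + x) - f x = c * 'D_v f (s *: v + x).
Proof.
move=> df.
have D (s : R) : `|s| <= `|c| ->
    is_derive s 1 (fun s : R => f (s *: v + x)) ('D_v f (s *: v + x)).
  by move=> /df; exact: derive1_line.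
have cont (a b : R) : (forall s : R, s \in `[a, b] -> `|s| <= `|c|) ->
    {within `[a, b], continuous (fun s : R => f (s *: v + x))}.
  move=> ab; apply: derivable_within_continuous => s /ab sc.
  by have dd := D _ sc; exact: ex_derive.
have [c0|c0] := leP 0 c.
- have sub (s : R) : s \in `[0, c] -> `|s| <= `|c|.
    by rewrite in_itv /= => /andP[s0 sc]; rewrite !ger0_norm.
  have [|s sc] := @MVT_segment R _ (fun s => 'D_v f (s *: v + x)) _ _ c0 _ (cont _ _ sub).
    by move=> s sc; apply: D; apply: sub; apply: subset_itv_oo_cc sc.
  rewrite scale0r add0r subr0 => E; exists s; first exact: sub.
  by rewrite E mulrC.
- have sub (s : R) : s \in `[c, 0] -> `|s| <= `|c|.
    by rewrite in_itv /= => /andP[sc s0]; rewrite !ler0_norm ?lerN2 // ltW.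
  have [|s sc] := @MVT_segment R _ (fun s => 'D_v f (s *: v + x)) _ _ (ltW c0) _ (cont _ _ sub).
    by move=> s sc; apply: D; apply: sub; apply: subset_itv_oo_cc sc.
  rewrite scale0r add0r sub0r => E; exists s; first exact: sub.
  by rewrite -opprB E mulrN opprK mulrC.
Qed.

End LineCalculus.

Section CkBasics.
Variable R : realType.

Lemma near_partial m (i : 'I_m) (f g : 'rV[R]_m -> R) x :
  (\forall y \near x, f y = g y) -> partial i f x = partial i g x.
Proof. by move=> fg; apply: near_eq_derive. Qed.

Lemma eq_partial m (U : set 'rV[R]_m) (i : 'I_m) (f g : 'rV[R]_m -> R) x :
  open U -> U x -> (forall y, U y -> f y = g y) ->
  partial i f x = partial i g x.
Proof.
move=> oU Ux fg; apply: near_partial.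
by apply: filterS (open_nbhs_nbhs (conj oU Ux)) => y /fg.
Qed.

Lemma Ck_continuous m k U (f : 'rV[R]_m -> R) x :
  Ck k U f -> U x -> {for x, continuous f}.
Proof. by case: k => [|k] [cf _] /cf. Qed.

Lemma Ck_derivable m k U (f : 'rV[R]_m -> R) x i :
  Ck k.+1 U f -> U x -> derivable f x (delta_mx 0 i).
Proof. by move=> [_ /(_ i)[df _]] /df. Qed.

Lemma Ck_partial m k U (f : 'rV[R]_m -> R) i : Ck k.+1 U f -> Ck k U (partial i f).
Proof. by move=> [_ /(_ i)[_]]. Qed.

Lemma Ck_pred m k U (f : 'rV[R]_m -> R) : Ck k.+1 U f -> Ck k U f.
Proof.
elim: k f => [|k IH] f; first by case.
move=> [cf df]; split=> // i; have [d1 d2] := df i; split=> //.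
exact: IH.
Qed.

Lemma Ck_leq m k l U (f : 'rV[R]_m -> R) : (k <= l)%N -> Ck l U f -> Ck k U f.
Proof.
by move=> /subnK<-; elim: (l - k)%N => // d IH /Ck_pred.
Qed.

Lemma Ck_sub m k (U V : set 'rV[R]_m) f : V `<=` U -> Ck k U f -> Ck k V f.
Proof.
move=> VU; elim: k f => [|k IH] f [cf df]; split=> //; try by move=> x /VU/cf.
move=> i; have [d1 d2] := df i; split; last exact: IH.
by move=> x /VU /d1.
Qed.

Lemma Ck_ext m k (U : set 'rV[R]_m) f g :
  open U -> (forall y, U y -> f y = g y) -> Ck k U f -> Ck k U g.
Proof.
move=> oU; have near_fg f' g' x : (forall y, U y -> f' y = g' y) -> U x ->
    \forall y \near x, f' y = g' y.
  by move=> fg Ux; apply: filterS (open_nbhs_nbhs (conj oU Ux)) => y /fg.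
have cont f' g' x : (forall y, U y -> f' y = g' y) -> U x ->
    {for x, continuous f'} -> {for x, continuous (g' : 'rV[R]_m -> R)}.
  move=> fg Ux; rewrite /prop_for /continuous_at -fg // => cf.
  exact: cvg_trans (near_eq_cvg (near_fg _ _ _ _ fg Ux)) cf.
elim: k f g => [|k IH] f g fg [cf df]; split=> //.
- by move=> x Ux; apply: cont fg Ux (cf _ Ux).
- by move=> x Ux; apply: cont fg Ux (cf _ Ux).
- move=> i; have [d1 d2] := df i; split.
    by move=> x Ux; apply: near_eq_derivable (d1 _ Ux); exact: near_fg.
  by apply: IH d2 => y Uy; exact: eq_partial fg.
Qed.

(** The path from 0 to h along the coordinate axes, used in C1_expansion. *)
Definition init_rV m (h : 'rV[R]_m) (k : nat) : 'rV[R]_m :=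
  \row_i (if (i < k)%N then h 0 i else 0).

Lemma coord_le_norm m (h : 'rV[R]_m) i : `|h 0 i| <= `|h|.
Proof.
rewrite [leRHS]/Num.Def.normr /= mx_normrE.
by apply: le_trans (le_bigmax _ _ (0, i)).
Qed.

Lemma norm_rV_le m (h : 'rV[R]_m) (e : R) : 0 <= e ->
  (forall i, `|h 0 i| <= e) -> `|h| <= e.
Proof.
move=> e0 H; rewrite [leLHS]/Num.Def.normr /= mx_normrE.
by apply: bigmax_le => // -[i j] _ /=; rewrite ord1.
Qed.

Lemma init_rVS m (h : 'rV[R]_m) (i : 'I_m) :
  init_rV h i.+1 = h 0 i *: delta_mx 0 i + init_rV h i.
Proof.
apply/rowP => j; rewrite !mxE eqxx /= ltnS leq_eqVlt.
case: (eqVneq j i) => [->|ji].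
  by rewrite eqxx /= ltnn addr0 mulr1.
by rewrite mulr0 add0r -[_ == _]/(j == i) (negbTE ji).
Qed.

Lemma norm_init_rV_line m (h : 'rV[R]_m) (i : 'I_m) (s : R) :
  `|s| <= `|h 0 i| -> `|s *: delta_mx 0 i + init_rV h i| <= `|h|.
Proof.
move=> sh; apply: norm_rV_le => // j; rewrite !mxE eqxx /=.
case: (eqVneq j i) => [->|ji].
  by rewrite ltnn addr0 mulr1; apply: le_trans sh (coord_le_norm _ _).
by rewrite mulr0 add0r; case: ifP => _; rewrite ?normr0 ?coord_le_norm.
Qed.

(** The candidate for the differential of f at x. *)
Definition lin_partial m (f : 'rV[R]_m -> R) (x h : 'rV[R]_m) : R :=
  \sum_i h 0 i * partial i f x.

Lemma lin_partial_linear m (f : 'rV[R]_m -> R) x : linear (lin_partial f x).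
Proof.
move=> a u v; rewrite /lin_partial scaler_sumr -big_split /=.
by apply: eq_bigr => i _; rewrite !mxE mulrDl [_ *: _]mulrA.
Qed.

HB.instance Definition _ m (f : 'rV[R]_m -> R) x :=
  GRing.isLinear.Build R 'rV[R]_m R _ (lin_partial f x) (lin_partial_linear f x).

Lemma continuous_sum_at (T : topologicalType) (I : Type) (r : seq I)
    (F : I -> T -> R) (x : T) :
  (forall i, {for x, continuous (F i)}) ->
  {for x, continuous (fun y => \sum_(i <- r) F i y)}.
Proof.
move=> cF; rewrite /prop_for /continuous_at.
elim: r => [|i r IH]; first by rewrite big_nil; under eq_cvg do rewrite big_nil; exact: cvg_cst.
rewrite big_cons; under eq_cvg do rewrite big_cons.
by apply: cvgD IH; exact: cF.
Qed.

Lemma lin_partial_continuous m (f : 'rV[R]_m -> R) x : continuous (lin_partial f x).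
Proof.
move=> y; apply: continuous_sum_at => i.
apply: continuousM; last exact: cst_continuous.
exact: coord_continuous.
Qed.

(** The increment of f is a telescoping sum of increments along the axes. The
    mean value theorem turns each into a partial derivative at a nearby point,
    and continuity of the partial derivatives gives the little-o. *)
Lemma C1_expansion m (U : set 'rV[R]_m) (f : 'rV[R]_m -> R) x :
  open U -> U x -> Ck 1 U f ->
  f \o shift x = cst (f x) + lin_partial f x +o_ (0 : 'rV[R]_m) (@id 'rV[R]_m).
Proof.
move=> oU Ux Cf; apply/eqaddoP => _/posnumP[e].
pose e' := e%:num / m.+1%:R.
have e'0 : 0 < e' by rewrite divr_gt0.
have : \forall y \near x, U y /\ forall i, `|partial i f x - partial i f y| <= e'.
  apply: filterI; first exact: open_nbhs_nbhs.
  apply: (@filter_forall _ _ _ (nbhs x)) => i.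
  have [ci _] : Ck 0 U (partial i f) by exact: Ck_partial.
  by have /cvgrPdist_le := ci _ Ux; apply.
move=> /nbhs_ballP[d /= d0 H].
apply/nbhs_ballP; exists d => //= h; rewrite -ball_normE /= sub0r normrN => hd.
rewrite !fctE /= addrC.
have inU z : `|z| <= `|h| ->
    U (z + x) /\ forall i, `|partial i f x - partial i f (z + x)| <= e'.
  move=> zh; apply: H; rewrite -ball_normE /=.
  by rewrite opprD addrCA subrr addr0 normrN; apply: le_lt_trans hd.
have telesc : f (h + x) - f x
   = \sum_(i < m) (f (init_rV h i.+1 + x) - f (init_rV h i + x)).
  have -> : f x = f (init_rV h 0 + x).
    by congr f; rewrite -[LHS]add0r; congr (_ + _); apply/rowP => j; rewrite !mxE.
  have -> : f (h + x) = f (init_rV h m + x).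
    by congr (f (_ + _)); apply/rowP => j; rewrite !mxE ltn_ord.
  rewrite -[RHS](big_mkord predT (fun i => f (init_rV h i.+1 + x) - f (init_rV h i + x))).
  by rewrite telescope_sumr.
have -> : - (f x + lin_partial f x h) + f (h + x) = \sum_(i < m)
    (f (init_rV h i.+1 + x) - f (init_rV h i + x) - h 0 i * partial i f x).
  rewrite sumrB -telesc /lin_partial; ring.
apply: le_trans (ler_norm_sum _ _ _) _.
have bnd (i : 'I_m) : `|f (init_rV h i.+1 + x) - f (init_rV h i + x)
    - h 0 i * partial i f x| <= `|h| * e'.
  rewrite init_rVS -(addrA (h 0 i *: _)).
  have [s|s sh ->] := @MVT_line R m f (init_rV h i + x) (delta_mx 0 i) (h 0 i).
    move=> sh; rewrite addrA; apply: Ck_derivable Cf _.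
    by have [] := inU _ (norm_init_rV_line sh).
  rewrite -mulrBr normrM; apply: ler_pM => //; first exact: coord_le_norm.
  rewrite distrC addrA; have [_] := inU _ (norm_init_rV_line sh); exact.
apply: le_trans (ler_sum _ (fun i _ => bnd i)) _.
rewrite sumr_const card_ord -mulr_natr -mulrA [leRHS]mulrC ler_wpM2l //.
rewrite /e' -mulrA ler_piMr //.
by rewrite mulrC ler_pdivrMr // mul1r ler_nat.
Qed.

(** Ck speaks of partial derivatives only, while the chain rule needs the total
    differential. *)
Lemma C1_differentiable m (U : set 'rV[R]_m) (f : 'rV[R]_m -> R) x :
  open U -> U x -> Ck 1 U f -> differentiable f x.
Proof.
move=> oU Ux Cf; have E := C1_expansion oU Ux Cf.
apply/diff_locallyP.
have dE := diff_unique (@lin_partial_continuous m f x) E.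
by rewrite dE; split => //; exact: lin_partial_continuous.
Qed.

Lemma C1_diff m (U : set 'rV[R]_m) (f : 'rV[R]_m -> R) x v :
  open U -> U x -> Ck 1 U f -> 'd f x v = lin_partial f x v.
Proof.
move=> oU Ux Cf; have E := C1_expansion oU Ux Cf.
by rewrite (diff_unique (@lin_partial_continuous m f x) E).
Qed.

Lemma C1_derive m (U : set 'rV[R]_m) (f : 'rV[R]_m -> R) x v :
  open U -> U x -> Ck 1 U f -> 'D_v f x = \sum_i v 0 i * partial i f x.
Proof.
move=> oU Ux Cf.
by rewrite deriveE ?(C1_diff _ oU Ux Cf) //; apply: C1_differentiable Cf.
Qed.

Lemma chain_rule (V : normedModType R) m (O : set 'rV[R]_m) (g : 'rV[R]_m -> R)
    (f : V -> 'rV[R]_m) x v :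
  open O -> O (f x) -> Ck 1 O g -> (forall j, derivable (fun y => f y 0 j) x v) ->
  derivable (g \o f) x v /\
  'D_v (g \o f) x = \sum_j 'D_v (fun y => f y 0 j) x * partial j g (f x).
Proof.
move=> oO Ox Cg df.
have dfv : derivable f x v.
  by apply/derivable_mxP => i j; rewrite ord1.
have dg : differentiable g (f x) by apply: C1_differentiable Cg.
pose F := fun h : R => f (h *: v + x).
have dF : differentiable F 0.
  by apply/derivable1_diffP; exact: (derivable1P f x v).1 dfv.
have F0 : F 0 = f x by rewrite /F scale0r add0r.
have dgF : differentiable (g \o F) 0 by apply: differentiable_comp => //; rewrite F0.
split; first by apply: (derivable1P (g \o f) x v).2; apply/derivable1_diffP; exact: dgF.
rewrite derive_line -[fun h => _]/(g \o F) deriveE // diff_comp ?F0 //=.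
rewrite (C1_diff _ oO Ox Cg) /lin_partial; apply: eq_bigr => j _; congr (_ * _).
by rewrite -[LHS]/(('d F 0 1) 0 j) -deriveE // /F -derive_line derive_mx // mxE.
Qed.

End CkBasics.

Section PartialRules.
Variables (R : realType) (m : nat).
Implicit Types (f g : 'rV[R]_m -> R) (U : set 'rV[R]_m) (i : 'I_m).

Lemma partial_cst i (c : R) x : partial i (fun _ : 'rV[R]_m => c) x = 0.
Proof. exact: derive_cst. Qed.

Lemma partialD U i f g x : Ck 1 U f -> Ck 1 U g -> U x ->
  partial i (fun y => f y + g y) x = partial i f x + partial i g x.
Proof. by move=> Cf Cg Ux; apply: deriveD; [exact: Ck_derivable Cf _|exact: Ck_derivable Cg _]. Qed.

Lemma partialN U i f x : Ck 1 U f -> U x ->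
  partial i (fun y => - f y) x = - partial i f x.
Proof. by move=> Cf Ux; apply: deriveN; exact: Ck_derivable Cf _. Qed.

Lemma partialB U i f g x : Ck 1 U f -> Ck 1 U g -> U x ->
  partial i (fun y => f y - g y) x = partial i f x - partial i g x.
Proof. by move=> Cf Cg Ux; apply: deriveB; [exact: Ck_derivable Cf _|exact: Ck_derivable Cg _]. Qed.

Lemma partialM U i f g x : Ck 1 U f -> Ck 1 U g -> U x ->
  partial i (fun y => f y * g y) x = partial i f x * g x + f x * partial i g x.
Proof.
move=> Cf Cg Ux; rewrite addrC [partial i f x * _]mulrC.
by apply: deriveM; [exact: Ck_derivable Cf _|exact: Ck_derivable Cg _].
Qed.

Lemma partialV U i f x : Ck 1 U f -> U x -> f x != 0 ->
  partial i (fun y => (f y)^-1) x = - (partial i f x * (f x)^-1 * (f x)^-1).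
Proof.
move=> Cf Ux fx; rewrite /partial deriveV //; last exact: Ck_derivable Cf _.
by rewrite scaleNr [_ *: _]mulrC -mulrA expr2 invfM.
Qed.

Lemma derivable_ln_line f x v : derivable f x v -> 0 < f x ->
  derivable (fun y => ln (f y)) x v /\ 'D_v (fun y => ln (f y)) x = 'D_v f x * (f x)^-1.
Proof.
move=> df fx.
pose F := fun h : R => f (h *: v + x).
have F0 : F 0 = f x by rewrite /F scale0r add0r.
have dF : is_derive (0 : R) 1 F ('D_v f x).
  by apply: DeriveDef; [exact: (derivable1P f x v).1|rewrite [RHS]derive_line].
have dl : is_derive (F 0) 1 (@ln R) (F 0)^-1 by apply: is_derive1_ln; rewrite F0.
have dlF : is_derive (0 : R) 1 (@ln R \o F) ((F 0)^-1 * 'D_v f x) by apply: is_derive1_comp.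
split.
  by apply: (derivable1P (fun y => ln (f y)) x v).2; exact: ex_derive.
by rewrite [LHS]derive_line -[fun h => _]/(@ln R \o F) derive_val F0 mulrC.
Qed.

Lemma partial_ln U i f x : Ck 1 U f -> U x -> 0 < f x ->
  partial i (fun y => ln (f y)) x = partial i f x * (f x)^-1.
Proof.
by move=> Cf Ux fx; have [] := derivable_ln_line (Ck_derivable (i:=i) Cf Ux) fx.
Qed.

Lemma partial_sum U i (I : Type) (r : seq I) (P : pred I) (F : I -> 'rV[R]_m -> R) x :
  (forall k, P k -> Ck 1 U (F k)) -> U x ->
  partial i (fun y => \sum_(k <- r | P k) F k y) x = \sum_(k <- r | P k) partial i (F k) x.
Proof.
move=> CF Ux.
suff H : derivable (fun y => \sum_(k <- r | P k) F k y) x (delta_mx 0 i) /\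
    partial i (fun y => \sum_(k <- r | P k) F k y) x = \sum_(k <- r | P k) partial i (F k) x.
  by case: H.
elim: r => [|k r [IH1 IH2]].
  have -> : (fun y => \sum_(k <- [::] | P k) F k y) = (fun _ : 'rV[R]_m => 0 : R).
    by apply/funext => y; rewrite big_nil.
  by rewrite big_nil partial_cst; split => //; exact: derivable_cst.
have E : (fun y => \sum_(k <- k :: r | P k) F k y) =
    (if P k then (fun y => F k y + \sum_(k <- r | P k) F k y)
     else (fun y => \sum_(k <- r | P k) F k y)).
  by apply/funext => y; rewrite big_cons; case: ifP.
rewrite E big_cons; case: ifP => [Pk|_]; last by split; [exact: IH1|exact: IH2].
have dk := Ck_derivable (i:=i) (CF k Pk) Ux.
by split; [exact: derivableD|rewrite -IH2; exact: deriveD].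
Qed.

End PartialRules.

Section CkClosure.
Variables (R : realType) (m : nat) (U : set 'rV[R]_m).
Hypothesis oU : open U.
Implicit Types (f g : 'rV[R]_m -> R) (i : 'I_m) (k : nat).

(** The induction step shared by the closure properties below. The formula g for
    the partial derivative is allowed to be valid on U only. *)
Lemma Ck_step k f : (forall x, U x -> {for x, continuous f}) ->
  (forall i, (forall x, U x -> derivable f x (delta_mx 0 i)) /\
     exists2 g, (forall x, U x -> partial i f x = g x) & Ck k U g) ->
  Ck k.+1 U f.
Proof.
move=> cf df; split=> // i; have [d1 [g fg Cg]] := df i; split=> //.
by apply: Ck_ext Cg => // y /fg.
Qed.

Lemma Ck_cst k (c : R) : Ck k U (fun _ => c).
Proof.
elim: k c => [|k IH] c; first by split=> // x _; exact: cst_continuous.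
apply: Ck_step => [x _|i]; first exact: cst_continuous.
split=> [x _|]; first exact: derivable_cst.
by exists (fun _ => 0) => [x _|]; [exact: partial_cst|exact: IH].
Qed.

Lemma CkD k f g : Ck k U f -> Ck k U g -> Ck k U (fun x => f x + g x).
Proof.
elim: k f g => [|k IH] f g Cf Cg.
  by split=> // x Ux; apply: continuousD; [exact: Ck_continuous Cf _|exact: Ck_continuous Cg _].
apply: Ck_step => [x Ux|i].
  by apply: continuousD; [exact: Ck_continuous Cf _|exact: Ck_continuous Cg _].
split=> [x Ux|].
  by apply: derivableD; [exact: Ck_derivable Cf _|exact: Ck_derivable Cg _].
exists (fun x => partial i f x + partial i g x).
  by move=> x Ux; apply: (@partialD R m U) => //; [exact: Ck_leq Cf|exact: Ck_leq Cg].
by apply: IH; exact: Ck_partial.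
Qed.

Lemma CkM k f g : Ck k U f -> Ck k U g -> Ck k U (fun x => f x * g x).
Proof.
elim: k f g => [|k IH] f g Cf Cg.
  by split=> // x Ux; apply: continuousM; [exact: Ck_continuous Cf _|exact: Ck_continuous Cg _].
apply: Ck_step => [x Ux|i].
  by apply: continuousM; [exact: Ck_continuous Cf _|exact: Ck_continuous Cg _].
split=> [x Ux|].
  by apply: derivableM; [exact: Ck_derivable Cf _|exact: Ck_derivable Cg _].
exists (fun x => partial i f x * g x + f x * partial i g x).
  by move=> x Ux; apply: (@partialM R m U) => //; [exact: Ck_leq Cf|exact: Ck_leq Cg].
by apply: CkD; apply: IH => //; try exact: Ck_partial; exact: Ck_pred.
Qed.

Lemma CkN k f : Ck k U f -> Ck k U (fun x => - f x).
Proof. by move=> Cf; apply: Ck_ext (CkM (Ck_cst k (-1)) Cf) => // x _; rewrite mulN1r. Qed.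

Lemma CkB k f g : Ck k U f -> Ck k U g -> Ck k U (fun x => f x - g x).
Proof. by move=> Cf Cg; apply: CkD => //; exact: CkN. Qed.

Lemma CkV k f : (forall x, U x -> f x != 0) -> Ck k U f -> Ck k U (fun x => (f x)^-1).
Proof.
move=> f0; elim: k => [|k IH] Cf.
  split=> // x Ux.
  by apply: continuousV; [exact: f0|exact: Ck_continuous Cf _].
apply: Ck_step => [x Ux|i].
  by apply: continuousV; [exact: f0|exact: Ck_continuous Cf _].
split=> [x Ux|].
  by apply: derivableV; [exact: f0|exact: Ck_derivable Cf _].
exists (fun x => - (partial i f x * (f x)^-1 * (f x)^-1)).
  by move=> x Ux; apply: (@partialV R m U) => //; [exact: Ck_leq Cf|exact: f0].
apply: CkN; apply: CkM; last by apply: IH; exact: Ck_pred.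
by apply: CkM; [exact: Ck_partial|apply: IH; exact: Ck_pred].
Qed.

Lemma Ck_ln k f : (forall x, U x -> 0 < f x) -> Ck k U f -> Ck k U (fun x => ln (f x)).
Proof.
move=> f0.
have cont l : Ck l U f -> forall x, U x -> {for x, continuous (fun x => ln (f x))}.
  move=> Cf x Ux; apply: (@continuous_comp _ _ _ f (@ln R)).
    exact: Ck_continuous Cf _.
  by apply: continuous_ln; exact: f0.
case: k => [|k] Cf; first by split=> // x Ux; exact: cont Cf _ _.
apply: Ck_step => [x Ux|i]; first exact: cont Cf _ _.
split=> [x Ux|].
  by have [] := derivable_ln_line (Ck_derivable (i:=i) Cf Ux) (f0 _ Ux).
exists (fun x => partial i f x * (f x)^-1).
  by move=> x Ux; apply: (@partial_ln R m U) => //; [exact: Ck_leq Cf|exact: f0].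
apply: CkM; first exact: Ck_partial.
apply: CkV; last exact: Ck_pred.
by move=> x /f0; rewrite lt0r => /andP[].
Qed.

Lemma Ck_sum k (I : Type) (r : seq I) (P : pred I) (F : I -> 'rV[R]_m -> R) :
  (forall j, P j -> Ck k U (F j)) -> Ck k U (fun x => \sum_(j <- r | P j) F j x).
Proof.
move=> CF; elim: r => [|j r IH].
  by apply: Ck_ext (Ck_cst k 0) => // y _; rewrite big_nil.
have [Pj|nPj] := boolP (P j).
  apply: Ck_ext (CkD (CF j Pj) IH) => // y _; by rewrite big_cons Pj.
by apply: Ck_ext IH => // y _; rewrite big_cons (negbTE nPj).
Qed.

Lemma Ck_prod k (I : Type) (r : seq I) (P : pred I) (F : I -> 'rV[R]_m -> R) :
  (forall j, P j -> Ck k U (F j)) -> Ck k U (fun x => \prod_(j <- r | P j) F j x).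
Proof.
move=> CF; elim: r => [|j r IH].
  by apply: Ck_ext (Ck_cst k 1) => // y _; rewrite big_nil.
have [Pj|nPj] := boolP (P j).
  apply: Ck_ext (CkM (CF j Pj) IH) => // y _; by rewrite big_cons Pj.
by apply: Ck_ext IH => // y _; rewrite big_cons (negbTE nPj).
Qed.

Lemma partial_coord i j x :
  partial i (fun y : 'rV[R]_m => y 0 j) x = (i == j)%:R.
Proof.
rewrite /partial /derive.
have -> : (fun h : R => h^-1 *: (((fun y : 'rV[R]_m => y 0 j) \o shift x) (h *: delta_mx 0 i)
     - x 0 j)) = (fun h : R => h^-1 * h * (i == j)%:R).
  by apply/funext => h /=; rewrite !mxE eqxx /= addrK eq_sym -mulrA.
apply: cvg_lim => //; apply: cvg_near_cst.
near=> h; rewrite mulVf ?mul1r //.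
by near: h; exact: nbhs_dnbhs_neq.
Unshelve. all: by end_near. Qed.

Lemma Ck_coord k j : Ck k U (fun y : 'rV[R]_m => y 0 j).
Proof.
have cont x : {for x, continuous (fun y : 'rV[R]_m => y 0 j)} by exact: coord_continuous.
case: k => [|k]; first by split=> // x _; exact: cont.
apply: Ck_step => [x _|i]; first exact: cont.
split=> [x _|].
  by apply: diff_derivable; exact: differentiable_coord.
exists (fun _ => (i == j)%:R); last exact: Ck_cst.
by move=> x _; exact: partial_coord.
Qed.

End CkClosure.

Section CkComp.
Variables (R : realType) (p m : nat) (U : set 'rV[R]_p) (O : set 'rV[R]_m).
Hypotheses (oU : open U) (oO : open O).
Variable f : 'rV[R]_p -> 'rV[R]_m.
Hypothesis fUO : forall x, U x -> O (f x).

Lemma continuous_coords (T : topologicalType) (h : T -> 'rV[R]_m) (x : T) :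
  (forall j, {for x, continuous (fun y => h y 0 j)}) -> {for x, continuous h}.
Proof.
move=> ch; apply/cvgrPdist_le => e e0.
have H : \forall y \near x, forall j, `|h x 0 j - h y 0 j| <= e.
  apply: filter_forall => j.
  by have /cvgrPdist_le := ch j; apply.
apply: filterS H => y H; apply: norm_rV_le; first exact: ltW.
by move=> j; rewrite !mxE; exact: H.
Qed.

Lemma partial_comp i (g : 'rV[R]_m -> R) x :
  (forall j, Ck 1 U (fun y => f y 0 j)) -> Ck 1 O g -> U x ->
  partial i (fun y => g (f y)) x =
  \sum_j partial i (fun y => f y 0 j) x * partial j g (f x).
Proof.
move=> Cf Cg Ux.
have [] // := @chain_rule R _ m O g f x (delta_mx 0 i) oO (fUO Ux) Cg.
by move=> j; exact: Ck_derivable (Cf j) Ux.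
Qed.

Lemma Ck_comp k (g : 'rV[R]_m -> R) :
  (forall j, Ck k U (fun y => f y 0 j)) -> Ck k O g -> Ck k U (fun y => g (f y)).
Proof.
have cont l g' x : (forall j, Ck l U (fun y => f y 0 j)) -> Ck l O g' -> U x ->
    {for x, continuous (fun y => g' (f y) : R)}.
  move=> Cf Cg Ux; apply: (@continuous_comp _ _ _ f g').
    by apply: continuous_coords => j; exact: Ck_continuous (Cf j) Ux.
  by apply: Ck_continuous Cg _; exact: fUO.
elim: k g => [|k IH] g Cf Cg; first by split=> // x Ux; exact: cont Cf Cg Ux.
apply: Ck_step => [//|x Ux|i]; first exact: cont Cf Cg Ux.
have Cf1 j : Ck 1 U (fun y => f y 0 j) by exact: Ck_leq (Cf j).
have Cg1 : Ck 1 O g by exact: Ck_leq Cg.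
split=> [x Ux|].
  have [] // := @chain_rule R _ m O g f x (delta_mx 0 i) oO (fUO Ux) Cg1.
  by move=> j; exact: Ck_derivable (Cf j) Ux.
exists (fun x => \sum_j partial i (fun y => f y 0 j) x * partial j g (f x)).
  by move=> x Ux; exact: partial_comp.
apply: Ck_sum => // j _; apply: CkM => //; first exact: Ck_partial (Cf j).
by apply: IH; [move=> l; exact: Ck_pred|exact: Ck_partial].
Qed.

End CkComp.

Section Schwarz.
Variables (R : realType) (m : nat) (U : set 'rV[R]_m).
Hypothesis oU : open U.

(** The mean value theorem in each of the two directions. The left-hand side is
    symmetric in i and j, hence Schwarz's theorem. *)
Lemma second_difference (f : 'rV[R]_m -> R) x (i j : 'I_m) (s : R) :
  Ck 2 U f -> (forall a b : R, `|a| <= `|s| -> `|b| <= `|s| ->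
    U (a *: delta_mx 0 i + (b *: delta_mx 0 j + x))) ->
  exists a b : R, [/\ `|a| <= `|s|, `|b| <= `|s| &
    f (s *: delta_mx 0 i + (s *: delta_mx 0 j + x)) - f (s *: delta_mx 0 i + x)
    - f (s *: delta_mx 0 j + x) + f x =
    s * s * partial j (partial i f) (a *: delta_mx 0 i + (b *: delta_mx 0 j + x))].
Proof.
move=> Cf inU.
pose F y := f (s *: delta_mx 0 j + y) - f y.
have s0 : `|0 : R| <= `|s| by rewrite normr0.
have inU0 (a : R) : `|a| <= `|s| -> U (a *: delta_mx 0 i + x).
  by move=> /inU/(_ s0); rewrite scale0r add0r.
have Cf1 : Ck 1 U f by exact: Ck_pred.
have shiftD (a : R) y : `|a| <= `|s| -> y = a *: delta_mx 0 i + x ->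
    is_derive y (delta_mx 0 i) F (partial i f (s *: delta_mx 0 j + y) - partial i f y).
  move=> sa ->; set z := a *: delta_mx 0 i + x.
  have zs : s *: delta_mx 0 j + z = a *: delta_mx 0 i + (s *: delta_mx 0 j + x).
    by rewrite /z addrCA.
  have d1 : derivable (fun y => f (s *: delta_mx 0 j + y)) z (delta_mx 0 i) /\
     'D_(delta_mx 0 i) (fun y => f (s *: delta_mx 0 j + y)) z =
     partial i f (s *: delta_mx 0 j + z).
    have E : (fun h : R => h^-1 *: (((fun y => f (s *: delta_mx 0 j + y)) \o shift z) (h *: delta_mx 0 i)
        - f (s *: delta_mx 0 j + z))) =
        (fun h : R => h^-1 *: ((f \o shift (s *: delta_mx 0 j + z)) (h *: delta_mx 0 i)
        - f (s *: delta_mx 0 j + z))).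
      by apply/funext => h /=; rewrite addrCA.
    split; last by rewrite /partial /derive E.
    rewrite /derivable E.
    by apply: Ck_derivable Cf1 _; rewrite zs; exact: inU.
  have d2 : derivable f z (delta_mx 0 i).
    by apply: Ck_derivable Cf1 _; exact: inU0.
  case: d1 => d1 E1; apply: DeriveDef; first exact: derivableB.
  by rewrite (deriveB d1 d2) E1.
have [a ha Ea] : exists2 a : R, `|a| <= `|s| & F (s *: delta_mx 0 i + x) - F x =
    s * 'D_(delta_mx 0 i) F (a *: delta_mx 0 i + x).
  apply: MVT_line => a sa.
  by have dF := shiftD a _ sa erefl; exact: ex_derive.
have dF := shiftD a _ ha erefl.
rewrite derive_val in Ea.
have Cfi : Ck 1 U (partial i f) by exact: Ck_partial.
have [b hb Eb] : exists2 b : R, `|b| <= `|s| &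
   partial i f (s *: delta_mx 0 j + (a *: delta_mx 0 i + x)) - partial i f (a *: delta_mx 0 i + x)
   = s * partial j (partial i f) (b *: delta_mx 0 j + (a *: delta_mx 0 i + x)).
  apply: MVT_line => b sb; apply: Ck_derivable Cfi _.
  by rewrite addrCA; exact: inU.
exists a, b; split; [exact: ha|exact: hb|].
rewrite [a *: _ + (b *: _ + _)]addrCA -mulrA -Eb -Ea /F.
rewrite [s *: delta_mx 0 j + (s *: delta_mx 0 i + x)]addrCA; ring.
Qed.

Local Opaque Ck partial.

(** Both mixed derivatives are approximated by the same second difference. *)
Lemma schwarz (f : 'rV[R]_m -> R) x (i j : 'I_m) : Ck 2 U f -> U x ->
  partial i (partial j f) x = partial j (partial i f) x.
Proof.
move=> Cf Ux; apply/eqP; rewrite -subr_eq0 -normr_le0; apply/ler_addgt0Pr => e e0.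
rewrite add0r.
have e2 : 0 < e / 2 by rewrite divr_gt0.
have c1 : {for x, continuous (partial i (partial j f))}.
  by apply: (@Ck_continuous R m 0 U) Ux; apply: Ck_partial; apply: Ck_partial.
have c2 : {for x, continuous (partial j (partial i f))}.
  by apply: (@Ck_continuous R m 0 U) Ux; apply: Ck_partial; apply: Ck_partial.
have : \forall y \near x, U y /\ `|partial i (partial j f) x - partial i (partial j f) y| <= e / 2 /\
   `|partial j (partial i f) x - partial j (partial i f) y| <= e / 2.
  apply: filterI; first exact: open_nbhs_nbhs.
  apply: filterI; [by have /cvgrPdist_le := c1; apply|by have /cvgrPdist_le := c2; apply].
move=> /nbhs_ballP[d /= d0 H].
pose s := d / 4.
have s0 : 0 < s by rewrite divr_gt0.
have near_x (a b : R) (k l : 'I_m) : `|a| <= `|s| -> `|b| <= `|s| ->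
    ball x d (a *: delta_mx 0 k + (b *: delta_mx 0 l + x)).
  move=> ha hb; rewrite -ball_normE /= addrA opprD addrCA subrr addr0 normrN.
  apply: (@le_lt_trans _ _ (`|s| + `|s|)).
    apply: le_trans (ler_normD _ _) _.
    have dm (c : R) (k' : 'I_m) : `|c *: delta_mx 0 k' : 'rV[R]_m| <= `|c|.
      apply: norm_rV_le => // q; rewrite !mxE eqxx /= normrM.
      by apply: ler_piMr => //; case: (q == k'); rewrite ?normr1 ?normr0.
    by apply: lerD; [apply: le_trans (dm _ _) ha|apply: le_trans (dm _ _) hb].
  by rewrite gtr0_norm // /s; lra.
have inU (k l : 'I_m) (a b : R) : `|a| <= `|s| -> `|b| <= `|s| ->
    U (a *: delta_mx 0 k + (b *: delta_mx 0 l + x)).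
  by move=> ha hb; have [] := H _ (near_x _ _ k l ha hb).
have [a [b [ha hb E1]]] := second_difference Cf (inU i j).
have [a' [b' [ha' hb' E2]]] := second_difference Cf (inU j i).
have E : partial j (partial i f) (a *: delta_mx 0 i + (b *: delta_mx 0 j + x)) =
   partial i (partial j f) (a' *: delta_mx 0 j + (b' *: delta_mx 0 i + x)).
  apply: (@mulfI _ (s * s)); first by rewrite mulf_neq0 // gt_eqF.
  apply: etrans (esym E1) _; apply: etrans _ E2.
  rewrite (addrCA (s *: delta_mx 0 i) (s *: delta_mx 0 j) x).
  move: (f _) (f _) (f _) (f _) => q1 q2 q3 q4.
  by congr (_ + _); exact: addrAC.
have [_ [_ B1]] := H _ (near_x _ _ i j ha hb).
have [_ [B2 _]] := H _ (near_x _ _ j i ha' hb').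
rewrite -(subrKA (partial j (partial i f) (a *: delta_mx 0 i + (b *: delta_mx 0 j + x)))).
apply: le_trans (ler_normD _ _) _; rewrite {1}E (splitr e).
by apply: lerD; [exact: B2|rewrite distrC; exact: B1].
Qed.

End Schwarz.

(** * Matrix-valued functions *)

Section MatrixCalculus.
Variables (R : realType) (m : nat) (U : set 'rV[R]_m).
Hypothesis oU : open U.
Implicit Types (i l : 'I_m).
Local Opaque Ck partial.

Definition CkMx k p q (M : 'rV[R]_m -> 'M[R]_(p, q)) :=
  forall a b, Ck k U (fun y => M y a b).

Definition dmx p q i (M : 'rV[R]_m -> 'M[R]_(p, q)) (x : 'rV[R]_m) : 'M[R]_(p, q) :=
  \matrix_(a, b) partial i (fun y => M y a b) x.

Lemma CkMx_leq p q j k (M : 'rV[R]_m -> 'M[R]_(p, q)) :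
  (j <= k)%N -> CkMx k M -> CkMx j M.
Proof. by move=> jk CM a b; exact: Ck_leq jk (CM a b). Qed.

Lemma CkMx_cst p q k (M : 'M[R]_(p, q)) : CkMx k (fun _ => M).
Proof. by move=> a b; exact: Ck_cst. Qed.

Lemma CkMxT p q k (M : 'rV[R]_m -> 'M[R]_(p, q)) : CkMx k M -> CkMx k (fun y => (M y)^T).
Proof.
move=> CM a b; apply: (Ck_ext oU _ (CM b a)) => y _.
by rewrite mxE.
Qed.

Lemma CkMxD p q k (M N : 'rV[R]_m -> 'M[R]_(p, q)) :
  CkMx k M -> CkMx k N -> CkMx k (fun y => M y + N y).
Proof.
move=> CM CN a b; apply: (Ck_ext oU _ (CkD oU (CM a b) (CN a b))) => y _.
by rewrite mxE.
Qed.

Lemma CkMxN p q k (M : 'rV[R]_m -> 'M[R]_(p, q)) :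
  CkMx k M -> CkMx k (fun y => - M y).
Proof.
move=> CM a b; apply: (Ck_ext oU _ (CkN oU (CM a b))) => y _.
by rewrite mxE.
Qed.

Lemma CkMxB p q k (M N : 'rV[R]_m -> 'M[R]_(p, q)) :
  CkMx k M -> CkMx k N -> CkMx k (fun y => M y - N y).
Proof. by move=> CM CN; apply: CkMxD => //; exact: CkMxN. Qed.

Lemma CkMxM p q r k (M : 'rV[R]_m -> 'M[R]_(p, q)) (N : 'rV[R]_m -> 'M[R]_(q, r)) :
  CkMx k M -> CkMx k N -> CkMx k (fun y => M y *m N y).
Proof.
move=> CM CN a b.
apply: (@Ck_ext _ _ _ _ (fun y => \sum_j M y a j * N y j b)) => //.
  by move=> y _; rewrite mxE.
by apply: Ck_sum => // j _; apply: CkM; [exact: oU|exact: CM|exact: CN].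
Qed.

Lemma CkMxZ p q k (f : 'rV[R]_m -> R) (M : 'rV[R]_m -> 'M[R]_(p, q)) :
  Ck k U f -> CkMx k M -> CkMx k (fun y => f y *: M y).
Proof.
move=> Cf CM a b; apply: (Ck_ext oU _ (CkM oU Cf (CM a b))) => y _.
by rewrite mxE.
Qed.

Lemma CkMx_sum p q k (I : Type) (r : seq I) (M : I -> 'rV[R]_m -> 'M[R]_(p, q)) :
  (forall j, CkMx k (M j)) -> CkMx k (fun y => \sum_(j <- r) M j y).
Proof.
move=> CM a b.
apply: (@Ck_ext _ _ _ _ (fun y => \sum_(j <- r) M j y a b)) => //.
  by move=> y _; rewrite summxE.
by apply: Ck_sum => // j _; exact: CM.
Qed.

Lemma Ck_tr p k (M : 'rV[R]_m -> 'M[R]_p) : CkMx k M -> Ck k U (fun y => \tr (M y)).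
Proof. by move=> CM; apply: Ck_sum => // j _; exact: CM. Qed.

Lemma Ck_det p k (M : 'rV[R]_m -> 'M[R]_p) : CkMx k M -> Ck k U (fun y => \det (M y)).
Proof.
move=> CM; apply: Ck_sum => // s _; apply: CkM => //; first exact: Ck_cst.
by apply: Ck_prod => // j _; exact: CM.
Qed.

Lemma CkMx_inv p k (M : 'rV[R]_m -> 'M[R]_p) :
  (forall y, U y -> M y \in unitmx) -> CkMx k M -> CkMx k (fun y => invmx (M y)).
Proof.
move=> Mu CM a b.
apply: (@Ck_ext _ _ _ _ (fun y => (\det (M y))^-1 * cofactor (M y) b a)) => //.
  by move=> y Uy; rewrite /invmx Mu // !mxE.
apply: CkM => //.
  apply: CkV => //; last exact: Ck_det.
  by move=> y Uy; have := Mu y Uy; rewrite unitmxE unitfE.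
apply: CkM => //; first exact: Ck_cst.
apply: Ck_det => c d.
by apply: (Ck_ext oU _ (CM (lift b c) (lift a d))) => y _; rewrite !mxE.
Qed.

Lemma CkMx_partial p q k i (M : 'rV[R]_m -> 'M[R]_(p, q)) :
  CkMx k.+1 M -> CkMx k (dmx i M).
Proof.
move=> CM a b; apply: (Ck_ext oU _ (Ck_partial i (CM a b))) => y _.
by rewrite mxE.
Qed.

Lemma eq_dmx p q i (M N : 'rV[R]_m -> 'M[R]_(p, q)) x : U x ->
  (forall y, U y -> M y = N y) -> dmx i M x = dmx i N x.
Proof.
move=> Ux MN; apply/matrixP => a b; rewrite !mxE.
by apply: (eq_partial i oU Ux) => y Uy; rewrite MN.
Qed.

Lemma dmx_cst p q i (M : 'M[R]_(p, q)) x : dmx i (fun _ => M) x = 0.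
Proof. by apply/matrixP => a b; rewrite !mxE partial_cst. Qed.

Lemma dmxT p q i (M : 'rV[R]_m -> 'M[R]_(p, q)) x :
  dmx i (fun y => (M y)^T) x = (dmx i M x)^T.
Proof.
apply/matrixP => a b; rewrite !mxE; congr (partial i _ x).
by apply/funext => y; rewrite mxE.
Qed.

Lemma dmxB p q i (M N : 'rV[R]_m -> 'M[R]_(p, q)) x :
  CkMx 1 M -> CkMx 1 N -> U x ->
  dmx i (fun y => M y - N y) x = dmx i M x - dmx i N x.
Proof.
move=> CM CN Ux; apply/matrixP => a b; rewrite !mxE.
rewrite -(partialB i (CM a b) (CN a b) Ux); congr (partial i _ x).
by apply/funext => y; rewrite !mxE.
Qed.

Lemma dmxM p q r i (M : 'rV[R]_m -> 'M[R]_(p, q)) (N : 'rV[R]_m -> 'M[R]_(q, r)) x :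
  CkMx 1 M -> CkMx 1 N -> U x ->
  dmx i (fun y => M y *m N y) x = dmx i M x *m N x + M x *m dmx i N x.
Proof.
move=> CM CN Ux; apply/matrixP => a b; rewrite !mxE.
have -> : (fun y => (M y *m N y) a b) = (fun y => \sum_j M y a j * N y j b).
  by apply/funext => y; rewrite mxE.
rewrite (@partial_sum _ _ U) //; last first.
  by move=> j _; apply: CkM; [exact: oU|exact: CM|exact: CN].
rewrite -big_split /=; apply: eq_bigr => j _.
by rewrite (partialM i (CM a j) (CN j b) Ux) !mxE.
Qed.

Lemma partial_tr p i (M : 'rV[R]_m -> 'M[R]_p) x : CkMx 1 M -> U x ->
  partial i (fun y => \tr (M y)) x = \tr (dmx i M x).
Proof.
move=> CM Ux; rewrite /mxtrace (@partial_sum _ _ U) //.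
by apply: eq_bigr => j _; rewrite mxE.
Qed.

Lemma dmx_inv p i (M : 'rV[R]_m -> 'M[R]_p) x :
  (forall y, U y -> M y \in unitmx) -> CkMx 1 M -> U x ->
  dmx i (fun y => invmx (M y)) x = - (invmx (M x) *m dmx i M x *m invmx (M x)).
Proof.
move=> Mu CM Ux.
have CV := CkMx_inv Mu CM.
have : dmx i (fun y => M y *m invmx (M y)) x = 0.
  rewrite -(dmx_cst i (1%:M : 'M[R]_p) x); apply: eq_dmx => // y Uy.
  by rewrite mulmxV // Mu.
rewrite dmxM // addrC => /eqP; rewrite addr_eq0 => /eqP H.
by rewrite -(mulKmx (Mu _ Ux) (dmx i (fun y => invmx (M y)) x)) H mulmxN mulmxA.
Qed.

Lemma dmx_schwarz p q i l (M : 'rV[R]_m -> 'M[R]_(p, q)) x : CkMx 2 M -> U x ->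
  dmx i (dmx l M) x = dmx l (dmx i M) x.
Proof.
move=> CM Ux; apply/matrixP => a b; rewrite [LHS]mxE [RHS]mxE.
have E l' : (fun y => dmx l' M y a b) = partial l' (fun y => M y a b).
  by apply/funext => y; rewrite mxE.
by rewrite !E; exact: (schwarz oU i l (CM a b) Ux).
Qed.

Lemma partial_prod i (I : eqType) (r : seq I) (F : I -> 'rV[R]_m -> R) x :
  uniq r -> (forall k, Ck 1 U (F k)) -> U x ->
  partial i (fun y => \prod_(k <- r) F k y) x =
  \sum_(k <- r) partial i (F k) x * \prod_(j <- r | j != k) F j x.
Proof.
move=> + CF Ux; elim: r => [_|k r IH /= /andP[kr ur]].
  rewrite big_nil -(partial_cst i (1 : R) x); congr (partial i _ x).
  by apply/funext => y; rewrite big_nil.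
have -> : (fun y => \prod_(j <- k :: r) F j y) = (fun y => F k y * \prod_(j <- r) F j y).
  by apply/funext => y; rewrite big_cons.
have Cp : Ck 1 U (fun y => \prod_(j <- r) F j y) by exact: Ck_prod.
rewrite (partialM i (CF k) Cp Ux) (IH ur) !big_cons eqxx /=; congr (_ * _ + _).
  rewrite [LHS]big_seq [RHS]big_seq_cond; apply: eq_bigl => j.
  by case: (boolP (j \in r)) => //= jr; case: eqP => // jk; rewrite -jk jr in kr.
rewrite mulr_sumr [LHS]big_seq [RHS]big_seq; apply: eq_bigr => j jr.
rewrite big_cons; have -> : k != j by apply: contraNneq kr => ->.
by rewrite mulrCA.
Qed.

(** Jacobi's formula. Differentiating the Leibniz expansion replaces one row of M
    by its derivative; expanding along that row gives the adjugate. *)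
Lemma partial_det p i (M : 'rV[R]_m -> 'M[R]_p) x : CkMx 1 M -> U x ->
  partial i (fun y => \det (M y)) x = \tr (dmx i M x *m \adj (M x)).
Proof.
move=> CM Ux.
rewrite /determinant (@partial_sum _ _ U) //; last first.
  move=> s _; apply: CkM => //; first exact: Ck_cst.
  by apply: Ck_prod => // j _; exact: CM.
pose N (a : 'I_p) := \matrix_(c, d) (if c == a then dmx i M x c d else M x c d).
transitivity (\sum_a \det (N a)).
  rewrite /determinant exchange_big /=; apply: eq_bigr => s _.
  have Cp : Ck 1 U (fun y => \prod_j M y j (s j)).
    by apply: Ck_prod => // j _; exact: CM.
  rewrite (partialM i (Ck_cst oU 1 _) Cp Ux) partial_cst mul0r add0r -mulr_sumr.
  congr (_ * _); rewrite (partial_prod i (index_enum_uniq _)) //.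
  apply: eq_bigr => a _; rewrite [RHS](bigD1 a) //= !mxE eqxx; congr (_ * _).
  by apply: eq_bigr => c /negbTE ca; rewrite !mxE ca.
rewrite /mxtrace; apply: eq_bigr => a _; rewrite (expand_det_row _ a) mxE.
apply: eq_bigr => c _; rewrite !mxE eqxx; congr (_ * (_ * \det _)).
by apply/matrixP => d e; rewrite !mxE eq_sym (negbTE (neq_lift _ _)).
Qed.

Lemma partial_ln_det p i (M : 'rV[R]_m -> 'M[R]_p) x :
  CkMx 1 M -> U x -> 0 < \det (M x) ->
  partial i (fun y => ln (\det (M y))) x = \tr (dmx i M x *m invmx (M x)).
Proof.
move=> CM Ux dM.
rewrite (partial_ln i (Ck_det CM) Ux dM) partial_det //.
have Mu : M x \in unitmx by rewrite unitmxE unitfE gt_eqF.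
by rewrite /invmx Mu -scalemxAr mxtraceZ mulrC.
Qed.

Local Opaque dmx.

(** tr (dM M^-1) is d ln |det M|. Directly: the second derivatives of M are
    symmetric by Schwarz, and the quadratic terms by cyclicity of the trace. *)
Lemma log_derivative_closed p i l (M : 'rV[R]_m -> 'M[R]_p) x :
  (forall y, U y -> M y \in unitmx) -> CkMx 2 M -> U x ->
  partial i (fun y => \tr (dmx l M y *m invmx (M y))) x =
  partial l (fun y => \tr (dmx i M y *m invmx (M y))) x.
Proof.
move=> Mu CM Ux.
have CM1 : CkMx 1 M by apply: CkMx_leq CM.
have CV : CkMx 1 (fun y => invmx (M y)) by apply: CkMx_inv.
have Cd l' : CkMx 1 (dmx l' M) by apply: CkMx_partial.
have T l1 l2 : partial l1 (fun y => \tr (dmx l2 M y *m invmx (M y))) x =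
    \tr (dmx l1 (dmx l2 M) x *m invmx (M x))
    - \tr (dmx l2 M x *m (invmx (M x) *m dmx l1 M x *m invmx (M x))).
  rewrite (partial_tr l1 (CkMxM (Cd l2) CV) Ux) (dmxM l1 (Cd l2) CV Ux).
  by rewrite (dmx_inv l1 Mu CM1 Ux) mxtraceD mulmxN raddfN.
apply: etrans (T i l) _; apply: etrans _ (esym (T l i)).
move: (dmx i (dmx l M) x) (dmx l (dmx i M) x) (dmx_schwarz i l CM Ux) => D _ <-.
move: (dmx l M x) (dmx i M x) (invmx (M x)) => P Q V.
congr (_ - _); transitivity (\tr ((P *m V) *m (Q *m V))); first by rewrite !mulmxA.
by rewrite mxtrace_mulC !mulmxA.
Qed.

End MatrixCalculus.

(** * Positive definite matrices *)

Section PositiveDefinite.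
Variable R : realType.

Definition posdef n (g : 'M[R]_n) := forall v : 'rV[R]_n, v != 0 -> 0 < bilin g v v.

(** The squared Frobenius norm. *)
Definition frob m n (M : 'M[R]_(m, n)) : R := \sum_i \sum_j M i j ^+ 2.

Lemma frob_ge0 m n (M : 'M[R]_(m, n)) : 0 <= frob M.
Proof. by apply: sumr_ge0 => i _; apply: sumr_ge0 => j _; exact: sqr_ge0. Qed.

Lemma frobE m n (M : 'M[R]_(m, n)) : frob M = \tr (M *m M^T).
Proof.
apply: eq_bigr => i _; rewrite mxE; apply: eq_bigr => j _.
by rewrite mxE expr2.
Qed.

Lemma frob_tr m n (M : 'M[R]_(m, n)) : frob M^T = frob M.
Proof.
rewrite /frob exchange_big /=; apply: eq_bigr => i _; apply: eq_bigr => j _.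
by rewrite mxE.
Qed.

Lemma cauchy_schwarz_sum (I : finType) (a b : I -> R) :
  (\sum_i a i * b i) ^+ 2 <= (\sum_i a i ^+ 2) * (\sum_i b i ^+ 2).
Proof.
have H : 0 <= \sum_i \sum_j (a i * b j - a j * b i) ^+ 2.
  by apply: sumr_ge0 => i _; apply: sumr_ge0 => j _; exact: sqr_ge0.
have E : \sum_i \sum_j (a i * b j - a j * b i) ^+ 2 =
    2 * ((\sum_i a i ^+ 2) * (\sum_i b i ^+ 2)) - 2 * (\sum_i a i * b i) ^+ 2.
  have E1 : (\sum_i a i ^+ 2) * (\sum_i b i ^+ 2) = \sum_i \sum_j a i ^+ 2 * b j ^+ 2.
    by rewrite mulr_suml; apply: eq_bigr => i _; rewrite mulr_sumr.
  have E2 : (\sum_i a i ^+ 2) * (\sum_i b i ^+ 2) = \sum_i \sum_j a j ^+ 2 * b i ^+ 2.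
    by rewrite E1 exchange_big.
  have E3 : (\sum_i a i * b i) ^+ 2 = \sum_i \sum_j (a i * b i) * (a j * b j).
    by rewrite expr2 mulr_suml; apply: eq_bigr => i _; rewrite mulr_sumr.
  rewrite mulr_natl mulr2n {1}E1 E2 E3 mulr_sumr -big_split -sumrB /=.
  apply: eq_bigr => i _; rewrite mulr_sumr -big_split -sumrB /=.
  by apply: eq_bigr => j _; ring.
by move: H; rewrite E subr_ge0 ler_pM2l.
Qed.

Lemma sqr_sum_norm_le (I : finType) (a : I -> R) :
  (\sum_i `|a i|) ^+ 2 <= #|I|%:R * \sum_i a i ^+ 2.
Proof.
have := cauchy_schwarz_sum (fun i => `|a i|) (fun=> 1).
have -> : \sum_i `|a i| * 1 = \sum_i `|a i| by apply: eq_bigr => i _; rewrite mulr1.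
have -> : \sum_i `|a i| ^+ 2 = \sum_i a i ^+ 2.
  by apply: eq_bigr => i _; rewrite real_normK ?num_real.
have -> : \sum_(i : I) 1 ^+ 2 = #|I|%:R :> R.
  by rewrite -sumr_const; apply: eq_bigr => i _; rewrite expr1n.
by rewrite mulrC.
Qed.

Lemma frob_mul m n p (M : 'M[R]_(m, n)) (N : 'M[R]_(n, p)) :
  frob (M *m N) <= frob M * frob N.
Proof.
rewrite -(frob_tr N) /frob mulr_suml; apply: ler_sum => i _.
rewrite mulr_sumr; apply: ler_sum => j _; rewrite mxE.
apply: le_trans (cauchy_schwarz_sum _ _) _; apply: ler_wpM2l.
  by apply: sumr_ge0 => k _; exact: sqr_ge0.
by apply: ler_sum => k _; rewrite mxE.
Qed.

Lemma posdef_unit n (g : 'M[R]_n) : posdef g -> g \in unitmx.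
Proof.
move=> pg; rewrite -row_free_unit; apply/row_freeP.
have kg : kermx g = 0.
  apply/row_matrixP => i; rewrite row0; apply/eqP; apply/negPn/negP => ri.
  have := pg _ ri; rewrite /bilin.
  have -> : row i (kermx g) *m g = 0 by apply/sub_kermxP; exact: row_sub.
  by rewrite mul0mx mxE ltxx.
have : row_free g by rewrite -kermx_eq0 kg.
by move=> /row_freeP.
Qed.

(** By induction on n, with the Schur complement of the upper left entry. *)
Lemma cholesky n (g : 'M[R]_n) : g^T = g -> posdef g ->
  exists2 P : 'M[R]_n, P \in unitmx & g = P *m P^T.
Proof.
move=> sg pg; suff [P gP] : exists P : 'M[R]_n, g = P *m P^T.
  exists P => //; have := posdef_unit pg; rewrite gP unitmx_mul.
  by case/andP.
elim: n g sg pg => [|n IH] g sg pg.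
  by exists 0; apply/matrixP => -[].
pose a := (ulsubmx (g : 'M[R]_(1 + n))) 0 0.
pose r := ursubmx (g : 'M[R]_(1 + n)).
pose D := drsubmx (g : 'M[R]_(1 + n)).
have gE : g = block_mx a%:M r r^T D :> 'M[R]_(1 + n).
  apply: etrans (esym (submxK (g : 'M[R]_(1 + n)))) _; congr (block_mx _ _ _ _).
    by apply/matrixP => i j; rewrite !ord1 /a !mxE eqxx.
  by rewrite /r trmx_ursub sg.
have pgb (v : 'rV[R]_(1 + n)) : v != 0 ->
    0 < (v *m block_mx a%:M r r^T D *m v^T) 0 0.
  by rewrite -gE; exact: pg.
have a0 : 0 < a.
  have e0 : row_mx 1%:M 0 != 0 :> 'rV[R]_(1 + n).
    apply/eqP => H; have := congr1 lsubmx H; rewrite row_mxKl raddf0.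
    by move=> /matrixP/(_ 0 0); rewrite !mxE eqxx => /eqP; rewrite oner_eq0.
  have := pgb _ e0; rewrite mul_row_block tr_row_mx mul_row_col.
  by rewrite !mul0mx trmx0 mulmx0 trmx1 mulmx1 mul1mx !addr0 mxE eqxx.
pose D' := D - a^-1 *: (r^T *m r).
have sD : D^T = D by rewrite /D trmx_drsub sg.
have sD' : D'^T = D'.
  by rewrite /D' linearB /= sD linearZ /= trmx_mul trmxK.
have pD' : posdef D'.
  move=> v v0; pose w := row_mx (- a^-1 *: (v *m r^T)) v : 'rV[R]_(1 + n).
  have w0 : w != 0.
    by apply: contraNneq v0 => w0; rewrite -(row_mxKr (- a^-1 *: (v *m r^T)) v) -/w w0 raddf0.
  have := pgb w w0; rewrite /bilin /w mul_row_block.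
  set x := - a^-1 *: _.
  have -> : x *m a%:M + v *m r^T = 0.
    by rewrite mul_mx_scalar /x scalerA mulrN divff ?gt_eqF // scaleN1r addNr.
  rewrite tr_row_mx mul_row_col mul0mx add0r.
  suff -> : x *m r + v *m D = v *m D' by [].
  by rewrite /x /D' mulmxBr -scalemxAl -scalemxAr mulmxA scaleNr addrC.
have [P' D'E] := IH _ sD' pD'.
pose s := Num.sqrt a.
have s0 : s != 0 by rewrite gt_eqF // sqrtr_gt0.
have ss : s * s = a by rewrite -expr2 sqr_sqrtr // ltW.
suff E : block_mx a%:M r r^T D = block_mx s%:M 0 (s^-1 *: r^T) P'
    *m (block_mx s%:M 0 (s^-1 *: r^T) P')^T :> 'M[R]_(1 + n).
  by exists (block_mx s%:M 0 (s^-1 *: r^T) P'); rewrite {1}gE E.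
rewrite tr_block_mx mulmx_block !trmx0 !mulmx0 !mul0mx !addr0.
congr (block_mx _ _ _ _).
- by rewrite tr_scalar_mx -scalar_mxM ss.
- by rewrite linearZ /= trmxK mul_scalar_mx scalerA divff // scale1r.
- by rewrite tr_scalar_mx mul_mx_scalar scalerA divff // scale1r.
- rewrite linearZ /= trmxK -scalemxAl -scalemxAr scalerA -D'E /D'.
  by rewrite -invfM ss addrC subrK.
Qed.

(** With g = P P^T and S = P^-1. Contractions with g^-1 become sums of squares in
    the frame of the rows of S, which is how all estimates below are proved. *)
Lemma posdef_inv_factor n (g : 'M[R]_n) : g^T = g -> posdef g ->
  exists P S : 'M[R]_n, [/\ P *m S = 1%:M, S *m P = 1%:M, frob P = \tr g & invmx g = S^T *m S].
Proof.
move=> sg pg; have [P Pu gP] := cholesky sg pg.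
exists P, (invmx P); split; [exact: mulmxV|exact: mulVmx|by rewrite frobE -gP|].
have gu := posdef_unit pg.
rewrite -[RHS](mulmxK gu) gP -!mulmxA (mulmxA (invmx P) P) mulVmx // mul1mx.
rewrite (mulmxA _ P^T) -trmx_mul mulmxV // trmx1 mul1mx.
by [].
Qed.

(** The inner product of bilinear forms, when h is the inverse of the metric. *)
Definition form2 n (h T S : 'M[R]_n) : R := \tr (h *m T *m h *m S^T).

Lemma form2C n (h T S : 'M[R]_n) : h^T = h -> form2 h T S = form2 h S T.
Proof.
by move=> hT; rewrite /form2 -mxtrace_tr !trmx_mul trmxK hT !mulmxA mxtrace_mulC !mulmxA.
Qed.

(** T = P (S T S^T) P^T, the Frobenius norm is submultiplicative, and
    frob P = tr g. *)
Lemma form2_coercive n (g T : 'M[R]_n) : g^T = g -> posdef g ->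
  frob T <= (\tr g) ^+ 2 * form2 (invmx g) T T.
Proof.
move=> sg pg; have [P [S [PS SP <- hE]]] := posdef_inv_factor sg pg.
have -> : form2 (invmx g) T T = frob (S *m T *m S^T).
  rewrite frobE /form2 hE -!mulmxA mxtrace_mulC !trmx_mul trmxK.
  by rewrite -!mulmxA.
have E : T = P *m (S *m T *m S^T) *m P^T.
  rewrite !mulmxA PS mul1mx -mulmxA -trmx_mul PS.
  by rewrite trmx1 mulmx1.
rewrite {1}E expr2 mulrAC; apply: le_trans (frob_mul _ _) _; rewrite frob_tr.
by apply: ler_wpM2r; [exact: frob_ge0|exact: frob_mul].
Qed.

Lemma form2_ge0 n (g T : 'M[R]_n) : g^T = g -> posdef g ->
  0 <= form2 (invmx g) T T.
Proof.
move=> sg pg; have [P [S [PS SP _ hE]]] := posdef_inv_factor sg pg.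
have -> : form2 (invmx g) T T = frob (S *m T *m S^T).
  rewrite frobE /form2 hE -!mulmxA mxtrace_mulC !trmx_mul trmxK.
  by rewrite -!mulmxA.
exact: frob_ge0.
Qed.

Lemma posdef_trace_ge0 n (g : 'M[R]_n) : g^T = g -> posdef g -> 0 <= \tr g.
Proof.
move=> sg pg; have [P [S [_ _ <- _]]] := posdef_inv_factor sg pg.
exact: frob_ge0.
Qed.

Lemma form3E n (h S : 'M[R]_n) (T : 'I_n -> 'M[R]_n) : h = S^T *m S ->
  \sum_p \sum_q h p q * form2 h (T p) (T q) =
  \sum_r form2 h (\sum_p S r p *: T p) (\sum_p S r p *: T p).
Proof.
move=> hE; transitivity (\sum_p \sum_q \sum_r S r p * S r q * form2 h (T p) (T q)).
  apply: eq_bigr => p _; apply: eq_bigr => q _.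
  rewrite {1}hE mxE mulr_suml; apply: eq_bigr => r _; by rewrite mxE.
under eq_bigr => p _ do rewrite exchange_big /=.
rewrite exchange_big /=; apply: eq_bigr => r _.
rewrite /form2 mulmx_sumr mulmx_suml mulmx_suml raddf_sum /=.
apply: eq_bigr => p _; rewrite (raddf_sum (@trmx R n n)) mulmx_sumr raddf_sum /=.
apply: eq_bigr => q _.
have -> : (S r q *: T q)^T = S r q *: (T q)^T by apply/matrixP => a b; rewrite !mxE.
by rewrite -!scalemxAr -!scalemxAl !mxtraceZ mulrCA mulrA.
Qed.

Lemma form3_ge0 n (g : 'M[R]_n) (T : 'I_n -> 'M[R]_n) : g^T = g -> posdef g ->
  0 <= \sum_p \sum_q invmx g p q * form2 (invmx g) (T p) (T q).
Proof.
move=> sg pg; have [P [S [_ _ _ hE]]] := posdef_inv_factor sg pg.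
rewrite (form3E T hE); apply: sumr_ge0 => r _; exact: form2_ge0.
Qed.

(** In the frame of the rows of S the double sum is a sum of squares of the
    combinations Th of the T p; going back costs a factor frob P = tr g, and
    form2_coercive the other two. *)
Lemma form3_coercive n (g : 'M[R]_n) (T : 'I_n -> 'M[R]_n) : g^T = g -> posdef g ->
  \sum_p frob (T p) <=
  (\tr g) ^+ 3 * \sum_p \sum_q invmx g p q * form2 (invmx g) (T p) (T q).
Proof.
move=> sg pg; have [P [S [PS SP frP hE]]] := posdef_inv_factor sg pg.
pose Th r := \sum_p S r p *: T p.
have E := form3E T hE.
have T_E p : T p = \sum_r P p r *: Th r.
  transitivity (\sum_q (P *m S) p q *: T q).
    rewrite PS (bigD1 p) //= mxE eqxx scale1r big1 ?addr0 // => q qp.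
    by rewrite mxE eq_sym (negbTE qp) scale0r.
  under eq_bigr => q _ do rewrite mxE scaler_suml.
  rewrite exchange_big; apply: eq_bigr => r _; rewrite /Th scaler_sumr.
  by apply: eq_bigr => q _; rewrite scalerA.
have bnd : \sum_p frob (T p) <= \tr g * \sum_r frob (Th r).
  pose M := \matrix_(r, k) mxvec (Th r) 0 k.
  have frv (X : 'M[R]_n) : frob X = \sum_k mxvec X 0 k ^+ 2.
    rewrite (reindex _ (curry_mxvec_bij _ _)) /= /frob pair_big /=.
    by apply: eq_bigr => -[i j] _ /=; rewrite mxvecE.
  have frM : \sum_r frob (Th r) = frob M.
    by apply: eq_bigr => r _; rewrite frv; apply: eq_bigr => k _; rewrite !mxE.
  rewrite frM -frP; apply: le_trans (frob_mul P M).
  rewrite le_eqVlt; apply/orP; left; apply/eqP.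
  apply: eq_bigr => p _; rewrite frv; apply: eq_bigr => k _.
  rewrite T_E raddf_sum /= summxE mxE; congr (_ ^+ 2); apply: eq_bigr => r _.
  by rewrite linearZ /= !mxE.
apply: le_trans bnd _; rewrite E exprS -mulrA; apply: ler_wpM2l.
  exact: posdef_trace_ge0.
by rewrite mulr_sumr; apply: ler_sum => r _; exact: form2_coercive.
Qed.

(** tr (g^-1 H) is the sum of the values of H on the rows of S. *)
Lemma trace_hessian_le0 n (g H : 'M[R]_n) : g^T = g -> posdef g ->
  (forall v : 'rV[R]_n, bilin H v v <= 0) ->
  \sum_p \sum_q invmx g p q * H p q <= 0.
Proof.
move=> sg pg Hn; have [P [S [PS SP frP hE]]] := posdef_inv_factor sg pg.
have -> : \sum_p \sum_q invmx g p q * H p q = \sum_r bilin H (row r S) (row r S).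
  transitivity (\sum_p \sum_q \sum_r S r p * S r q * H p q).
    apply: eq_bigr => p _; apply: eq_bigr => q _.
    rewrite hE mxE mulr_suml; apply: eq_bigr => r _; by rewrite mxE.
  under eq_bigr => p _ do rewrite exchange_big /=.
  rewrite exchange_big /=; apply: eq_bigr => r _.
  rewrite /bilin mxE exchange_big /=; apply: eq_bigr => q _.
  rewrite !mxE mulr_suml; apply: eq_bigr => p _; rewrite !mxE; ring.
by apply: sumr_le0 => r _; exact: Hn.
Qed.

End PositiveDefinite.

(** * Derivative tests at a maximum *)

Section CriticalPoints.
Variables (R : realType) (m : nat) (U : set 'rV[R]_m).
Hypothesis oU : open U.
Implicit Types (Q : 'rV[R]_m -> R) (w v : 'rV[R]_m).
Local Opaque Ck partial.

Lemma bounded_on_compact (K : set 'rV[R]_m) Q :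
  compact K -> K `<=` U -> Ck 0 U Q ->
  exists2 B : R, 0 <= B & forall x, K x -> `|Q x| <= B.
Proof.
move=> cK KU CQ.
have cQ : {within K, continuous Q}.
  apply: continuous_in_subspaceT => x /set_mem Kx.
  exact: Ck_continuous CQ (KU _ Kx).
have /compact_bounded [M [Mr HM]] := continuous_compact cQ cK.
exists (Num.max 0 (M + 1)); first by rewrite le_max lexx.
move=> x Kx; rewrite le_max; apply/orP; right.
by apply: (HM (M + 1)); [rewrite ltrDl|exists x].
Qed.

(** If the second derivative were positive at w it would be so nearby, and two
    applications of the mean value theorem would make
    Q (w + s v) + Q (w - s v) exceed its value at s = 0. *)
Lemma second_derivative_max Q w v (r : R) : 0 < r -> Ck 2 U Q ->
  (forall s : R, `|s| <= r -> U (s *: v + w) /\ Q (s *: v + w) <= Q w) ->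
  \sum_i \sum_j v 0 i * v 0 j * partial i (partial j Q) w <= 0.
Proof.
move=> r0 CQ H; rewrite leNgt; apply/negP => c0.
pose G y := \sum_j v 0 j * partial j Q y.
have CQ1 : Ck 1 U Q by exact: Ck_pred.
have CP j : Ck 1 U (partial j Q) by exact: Ck_partial.
have CG : Ck 1 U G by apply: (Ck_sum oU) => j _; apply: (CkM oU); [exact: Ck_cst|exact: CP].
pose H2 y := \sum_i v 0 i * partial i G y.
have CH2 : Ck 0 U H2.
  by apply: (Ck_sum oU) => j _; apply: (CkM oU); [exact: Ck_cst|exact: Ck_partial].
have Uw : U w by have [] := H 0; rewrite ?normr0 ?(ltW r0) // scale0r add0r.
have H2w : 0 < H2 w.
  suff -> : H2 w = \sum_i \sum_j v 0 i * v 0 j * partial i (partial j Q) w by [].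
  apply: eq_bigr => i _; rewrite /G (@partial_sum _ _ U) => [|j _|]; last exact: Uw; last first.
    by apply: (CkM oU); [exact: Ck_cst|exact: CP].
  rewrite mulr_sumr; apply: eq_bigr => j _.
  by rewrite (partialM i (Ck_cst oU 1 _) (CP j) Uw) partial_cst mul0r add0r mulrA.
have [d d0 Hd] : exists2 d : R, 0 < d & forall s : R, `|s| <= d -> `|s| <= r /\ 0 < H2 (s *: v + w).
  have cH2 : {for w, continuous H2} by exact: Ck_continuous CH2 Uw.
  have cl : {for (0 : R), continuous (fun s : R => H2 (s *: v + w))}.
    apply: (@continuous_comp _ _ _ (fun s : R => s *: v + w) H2); last by rewrite scale0r add0r.
    apply: (@continuousD _ _ _ (fun s : R => s *: v) (fun=> w)); last exact: cst_continuous.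
    exact: scalel_continuous.
  have : \forall s \near (0 : R), 0 < H2 (s *: v + w).
    by apply: (cvgr_gt _ cl); rewrite scale0r add0r.
  move=> /nbhs_ballP[e /= e0 He].
  exists (Num.min r (e / 2)); first by rewrite lt_min r0 divr_gt0.
  move=> s; rewrite le_min => /andP[sr se]; split; [exact: sr|apply: He].
  rewrite -ball_normE /= sub0r normrN; apply: le_lt_trans se _.
  by move: e0; lra.
have dQ (s : R) : `|s| <= d -> is_derive s 1 (fun s : R => Q (s *: v + w)) (G (s *: v + w)).
  move=> sd; have Us : U (s *: v + w) by have [/H[]] := Hd _ sd.
  have := @derive1_line R m Q w v s.
  rewrite (C1_derive v oU Us CQ1); apply.
  by apply: diff_derivable; exact: C1_differentiable CQ1.
have dG (s : R) : `|s| <= d -> is_derive s 1 (fun s : R => G (s *: v + w)) (H2 (s *: v + w)).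
  move=> sd; have Us : U (s *: v + w) by have [/H[]] := Hd _ sd.
  have := @derive1_line R m G w v s.
  rewrite (C1_derive v oU Us CG); apply.
  by apply: diff_derivable; exact: C1_differentiable CG.
pose psi (s : R) := Q (s *: v + w) + Q (- s *: v + w).
have dpsi (s : R) : `|s| <= d -> is_derive s 1 psi (G (s *: v + w) - G (- s *: v + w)).
  move=> sd; have D1 := dQ _ sd.
  have sd' : `|- s| <= d by rewrite normrN.
  have D2 := dQ _ sd'.
  have D3 : is_derive s 1 (fun s : R => - s) (- 1) by exact: is_deriveN.
  have D4 : is_derive s 1 (fun s : R => Q (- s *: v + w)) (G (- s *: v + w) * -1).
    exact: (@is_derive1_comp R (fun s : R => Q (s *: v + w)) (fun s : R => - s) s _ _ D2 D3).
  by rewrite -[- G _]mulrN1; exact: is_deriveD.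
have [s sI Es] : exists2 s, s \in `]0, d[%R & psi d - psi 0 =
    (G (s *: v + w) - G (- s *: v + w)) * (d - 0).
  apply: (@MVT R psi (fun s => G (s *: v + w) - G (- s *: v + w))) => //.
    move=> s; rewrite in_itv /= => /andP[s0 sd]; apply: dpsi.
    by rewrite gtr0_norm // ltW.
  apply: derivable_within_continuous => s; rewrite in_itv /= => /andP[s0 sd].
  have D : is_derive s 1 psi (G (s *: v + w) - G (- s *: v + w)).
    by apply: dpsi; rewrite ger0_norm.
  exact: ex_derive.
move: sI; rewrite in_itv /= => /andP[s0 sd].
have sN : - s < s by rewrite gtrN.
have abs_le u : u \in `[- s, s]%R -> `|u| <= d.
  rewrite in_itv /= -ler_norml => /le_trans; apply; exact: ltW.
have [u uI Eu] : exists2 u, u \in `]- s, s[%R & G (s *: v + w) - G (- s *: v + w) =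
    H2 (u *: v + w) * (s - (- s)).
  apply: (@MVT R (fun s => G (s *: v + w)) (fun u => H2 (u *: v + w))) => //.
    by move=> u uI; apply: dG; apply: abs_le; apply: subset_itv_oo_cc uI.
  apply: derivable_within_continuous => u uI.
  have D := dG _ (abs_le _ uI); exact: ex_derive.
have ud : `|u| <= d by apply: abs_le; apply: subset_itv_oo_cc uI.
have [_ H2u] := Hd _ ud.
have pd : psi d <= psi 0.
  have dd : `|d| <= d by rewrite gtr0_norm.
  have dd' : `|- d| <= d by rewrite normrN.
  rewrite /psi oppr0 scale0r add0r; apply: lerD.
    by have [/H[]] := Hd _ dd.
  by have [/H[]] := Hd _ dd'.
have : 0 < psi d - psi 0.
  rewrite Es Eu subr0 opprK; apply: mulr_gt0 => //; apply: mulr_gt0 => //.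
  exact: addr_gt0.
by rewrite subr_gt0 ltNge pd.
Qed.

(** Only s < 0 is tested: the maximum may sit at the final time. *)
Lemma time_derivative_max Q w v (lam r : R) : 0 < r -> Ck 1 U Q -> U w ->
  (forall s : R, - r < s -> s < 0 -> expR (- (lam * s)) * Q (s *: v + w) <= Q w) ->
  lam * Q w <= 'D_v Q w.
Proof.
move=> r0 CQ Uw H.
pose phi (s : R) := expR (- (lam * s)) * Q (s *: v + w).
have D1 : is_derive (0 : R) 1 (fun s : R => Q (s *: v + w)) ('D_v Q w).
  have := @derive1_line R m Q w v 0; rewrite scale0r add0r; apply.
  by apply: diff_derivable; exact: C1_differentiable CQ.
have D2 : is_derive (0 : R) 1 (fun s : R => - (lam * s)) (- lam).
  have I : is_derive (0 : R) 1 (@id R) 1 by exact: is_derive_id.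
  have -> : (fun s : R => - (lam * s)) = (- lam) \*: (@id R).
    by apply/funext => s; rewrite /= [_ *: _]mulNr.
  by rewrite -[X in is_derive _ _ _ X]mulr1; exact: is_deriveZ.
have D3 : is_derive (0 : R) 1 (fun s : R => expR (- (lam * s))) (- lam).
  have D4 : is_derive (- (lam * 0)) 1 (@expR R) (expR (- (lam * 0))) by exact: is_derive_expR.
  have := @is_derive1_comp R (@expR R) (fun s : R => - (lam * s)) 0 _ _ D4 D2.
  by rewrite mulr0 oppr0 expR0 mul1r.
have D : is_derive (0 : R) 1 phi ('D_v Q w - lam * Q w).
  apply: (is_derive_eq (is_deriveM D3 D1)).
  by rewrite mulr0 oppr0 expR0 scale0r add0r scale1r scalerN [_ *: _]mulrC.
rewrite -subr_ge0 leNgt; apply/negP => neg.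
have cv : (fun h : R => h^-1 *: (phi (h + 0) - phi 0)) @ 0^' --> 'D_v Q w - lam * Q w.
  have dphi : derivable phi 0 1 by have DD := D; exact: ex_derive.
  have DD := D; have <- : 'D_1 phi 0 = 'D_v Q w - lam * Q w by rewrite derive_val.
  have E : (fun h : R => h^-1 *: ((phi \o shift 0) (h *: 1) - phi 0)) =
      (fun h : R => h^-1 *: (phi (h + 0) - phi 0)).
    by apply/funext => h; rewrite /= [h *: 1]mulr1.
  by move: dphi; rewrite /derivable /derive E.
have /nbhs_ballP[e /= e0 He] : \forall h \near 0^', h^-1 *: (phi (h + 0) - phi 0) < 0.
  exact: (cvgr_lt _ cv).
pose s := - (Num.min r e / 2).
have m0 : 0 < Num.min r e by rewrite lt_min r0 e0.
have s0 : s < 0 by rewrite oppr_lt0 divr_gt0.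
have half : Num.min r e / 2 < Num.min r e by move: m0; lra.
have sr : - r < s by rewrite ltrN2; apply: lt_le_trans half _; rewrite ge_min lexx.
have sb : ball (0 : R) e s.
  rewrite -ball_normE /= sub0r normrN /s normrN gtr0_norm ?divr_gt0 //.
  by apply: lt_le_trans half _; rewrite ge_min lexx orbT.
have sn0 : s != 0 by rewrite lt_eqF.
have := He s sb sn0; rewrite addr0.
rewrite ltNge [_ *: _]mulrC => /negP; apply.
apply: mulr_le0; last by rewrite invr_le0 ltW.
rewrite subr_le0.
by rewrite /phi mulr0 oppr0 expR0 mul1r scale0r add0r; exact: H.
Qed.

End CriticalPoints.

(** * Evolution of the norm of a skew form *)

Lemma le_sum_entry (R : realType) p q (F : 'I_p -> 'I_q -> R) i j :
  (forall k l, 0 <= F k l) -> F i j <= \sum_k \sum_l F k l.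
Proof.
move=> F0; rewrite (bigD1 i) //= (bigD1 j) //= -addrA lerDl.
apply: addr_ge0; first by apply: sumr_ge0 => l _; exact: F0.
by apply: sumr_ge0 => k _; apply: sumr_ge0 => l _; exact: F0.
Qed.

Section Domination.
Variables (R : realType) (X : Type) (D : set X).
Implicit Types (phi psi : X -> R) (f : X -> R).

(** f = O(phi) on D. The variant domd is the entrywise one for matrices. *)
Definition domf phi f := exists2 K : R, 0 <= K & forall x, D x -> `|f x| <= K * phi x.

Definition domd p q phi (M : X -> 'M[R]_(p, q)) :=
  exists2 K : R, 0 <= K & forall x, D x -> forall i j, `|M x i j| <= K * phi x.

Lemma domf_le phi psi f : (forall x, D x -> phi x <= psi x) -> domf phi f -> domf psi f.
Proof.
move=> pp [K K0 HK]; exists K => // x Dx.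
by apply: le_trans (HK x Dx) _; apply: ler_wpM2l => //; exact: pp.
Qed.

Lemma domd_le p q phi psi (M : X -> 'M[R]_(p, q)) :
  (forall x, D x -> phi x <= psi x) -> domd phi M -> domd psi M.
Proof.
move=> pp [K K0 HK]; exists K => // x Dx i j.
by apply: le_trans (HK x Dx i j) _; apply: ler_wpM2l => //; exact: pp.
Qed.

Lemma domfD phi f g : domf phi f -> domf phi g -> domf phi (fun x => f x + g x).
Proof.
move=> [K K0 HK] [L L0 HL]; exists (K + L); first exact: addr_ge0.
move=> x Dx; rewrite mulrDl; apply: le_trans (ler_normD _ _) _.
by apply: lerD; [exact: HK|exact: HL].
Qed.

Lemma domfN phi f : domf phi f -> domf phi (fun x => - f x).
Proof. by move=> [K K0 HK]; exists K => // x Dx; rewrite normrN; exact: HK. Qed.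

Lemma domfM phi psi f g : domf phi f -> domf psi g ->
  domf (fun x => phi x * psi x) (fun x => f x * g x).
Proof.
move=> [K K0 HK] [L L0 HL]; exists (K * L); first exact: mulr_ge0.
by move=> x Dx; rewrite normrM mulrACA; apply: ler_pM => //; [exact: HK|exact: HL].
Qed.

Lemma domf0 phi : (forall x, D x -> 0 <= phi x) -> domf phi (fun _ => 0).
Proof. by move=> p0; exists 0 => // x Dx; rewrite normr0 mul0r. Qed.

Lemma domf_sum phi (I : Type) (r : seq I) (F : I -> X -> R) :
  (forall x, D x -> 0 <= phi x) -> (forall k, domf phi (F k)) ->
  domf phi (fun x => \sum_(k <- r) F k x).
Proof.
move=> p0 dF; elim: r => [|k r IH].
  rewrite (_ : (fun x => _) = fun=> 0); first exact: domf0.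
  by apply/funext => x; rewrite big_nil.
rewrite (_ : (fun x => _) = fun x => F k x + \sum_(k <- r) F k x); first exact: domfD.
by apply/funext => x; rewrite big_cons.
Qed.

Lemma domd_entry p q phi (M : X -> 'M[R]_(p, q)) i j :
  domd phi M -> domf phi (fun x => M x i j).
Proof. by move=> [K K0 HK]; exists K => // x Dx; exact: HK. Qed.

Lemma domdT p q phi (M : X -> 'M[R]_(p, q)) : domd phi M -> domd phi (fun x => (M x)^T).
Proof. by move=> [K K0 HK]; exists K => // x Dx i j; rewrite mxE; exact: HK. Qed.

Lemma domdM p q r phi psi (M : X -> 'M[R]_(p, q)) (N : X -> 'M[R]_(q, r)) :
  domd phi M -> domd psi N -> domd (fun x => phi x * psi x) (fun x => M x *m N x).
Proof.
move=> [K K0 HK] [L L0 HL]; exists (q%:R * (K * L)); first by rewrite !mulr_ge0.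
move=> x Dx i j; rewrite mxE; apply: le_trans (ler_norm_sum _ _ _) _.
apply: (@le_trans _ _ (\sum_(k < q) (K * phi x) * (L * psi x))).
  by apply: ler_sum => k _; rewrite normrM; apply: ler_pM => //; [exact: HK|exact: HL].
rewrite sumr_const card_ord -mulr_natl le_eqVlt; apply/orP; left; apply/eqP; ring.
Qed.

Lemma domf_tr p phi (M : X -> 'M[R]_p) : domd phi M -> domf phi (fun x => \tr (M x)).
Proof.
move=> [K K0 HK]; exists (p%:R * K); first exact: mulr_ge0.
move=> x Dx; apply: le_trans (ler_norm_sum _ _ _) _.
apply: (@le_trans _ _ (\sum_(k < p) K * phi x)).
  by apply: ler_sum => k _; exact: HK.
by rewrite sumr_const card_ord -(mulr_natl (K * phi x)) mulrA.
Qed.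

Lemma domf_tr4 p phi psi (a S b T : X -> 'M[R]_p) :
  domd (fun=> 1) a -> domd (fun=> 1) b -> domd phi S -> domd psi T ->
  domf (fun x => phi x * psi x) (fun x => \tr (a x *m S x *m b x *m (T x)^T)).
Proof.
move=> da db dS dT; apply: domf_tr.
have H := domdM (domdM (domdM da dS) db) (domdT dT).
by apply: domd_le H => x _; rewrite mul1r mulr1.
Qed.

End Domination.

Section JetSize.
Variables (R : realType) (n m : nat) (D : set 'rV[R]_m).
Variables (sp : 'I_n -> 'I_m) (al : 'rV[R]_m -> 'M[R]_n).
Local Opaque partial dmx.

(** |al| + |d al| for the derivatives in the directions sp, which is the size
    of all terms that count as lower order. *)
Definition jet_size w : R := (\sum_i \sum_j `|al w i j|)
  + \sum_p \sum_i \sum_j `|dmx (sp p) al w i j|.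

Let le_entry (X : 'M[R]_n) i j : `|X i j| <= \sum_i \sum_j `|X i j|.
Proof. exact: (le_sum_entry i j (fun k l => normr_ge0 (X k l))). Qed.

Let sum_norm_ge0 (X : 'M[R]_n) : 0 <= \sum_i \sum_j `|X i j|.
Proof. by apply: sumr_ge0 => i _; apply: sumr_ge0. Qed.

Lemma jet_size_ge0 w : 0 <= jet_size w.
Proof. by apply: addr_ge0; [exact: sum_norm_ge0|apply: sumr_ge0 => p _; exact: sum_norm_ge0]. Qed.

Lemma domd_jet0 : domd D jet_size al.
Proof.
exists 1 => // w _ i j; rewrite mul1r; apply: le_trans (le_entry _ _ _) _.
by rewrite lerDl; apply: sumr_ge0 => p _; exact: sum_norm_ge0.
Qed.

Lemma domd_jet1 p : domd D jet_size (dmx (sp p) al).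
Proof.
exists 1 => // w _ i j; rewrite mul1r; apply: le_trans (le_entry _ _ _) _.
apply: (@le_trans _ _ (\sum_p \sum_i \sum_j `|dmx (sp p) al w i j|)).
  by rewrite [leRHS](bigD1 p) //= lerDl; apply: sumr_ge0 => q _; exact: sum_norm_ge0.
by rewrite lerDr; exact: sum_norm_ge0.
Qed.

End JetSize.

Section Evolution.
Variables (R : realType) (n m : nat) (U : set 'rV[R]_m).
Hypothesis oU : open U.
Variables (sp : 'I_n -> 'I_m) (tm : 'I_m) (K D : set 'rV[R]_m).
Hypotheses (cK : compact K) (KU : K `<=` U) (DK : D `<=` K).
Variables g al : 'rV[R]_m -> 'M[R]_n.
Hypotheses (Cg : CkMx U 2 g) (Cal : CkMx U 2 al).
Hypothesis gu : forall w, U w -> g w \in unitmx.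
Hypothesis gT : forall w, (g w)^T = g w.
Hypothesis alT : forall w, (al w)^T = - al w.
Hypothesis gpos : forall w, D w -> posdef (g w).
Local Opaque Ck partial dmx.

Lemma CkMx_bounded p q (M : 'rV[R]_m -> 'M[R]_(p, q)) : CkMx U 0 M -> domd D (fun=> 1) M.
Proof.
move=> CM; pose f w := \sum_i \sum_j M w i j * M w i j.
have Cf : Ck 0 U f.
  apply: (Ck_sum oU) => i _; apply: (Ck_sum oU) => j _.
  by apply: (CkM oU); exact: CM.
have [B B0 HB] := bounded_on_compact cK KU Cf.
exists (1 + B); first exact: addr_ge0.
move=> w Dw i j; rewrite mulr1.
have sq (x : R) : `|x| <= 1 + x * x.
  have -> : x * x = `|x| * `|x| by rewrite -normrM ger0_norm // -expr2 sqr_ge0.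
  have := sqr_ge0 (`|x| - 1); have := normr_ge0 x.
  by move: `|x| => y; rewrite sqrrB1 expr2; lra.
apply: le_trans (sq _) _; rewrite lerD2l.
apply: le_trans (HB w (DK Dw)); apply: le_trans (ler_norm _).
have nn (k : 'I_p) (l : 'I_q) : 0 <= M w k l * M w k l by rewrite -expr2 sqr_ge0.
exact: (le_sum_entry i j nn).
Qed.

Let h w := invmx (g w).
(** |al|^2 in the metric g. *)
Definition norm_sq w : R := form2 (invmx (g w)) (al w) (al w).

Let Ch : CkMx U 2 h. Proof. exact: CkMx_inv. Qed.
Let Ch1 : CkMx U 1 h. Proof. exact: CkMx_leq Ch. Qed.
Let Cal1 : CkMx U 1 al. Proof. exact: CkMx_leq Cal. Qed.
Let Cdh I : CkMx U 1 (dmx I h). Proof. exact: CkMx_partial. Qed.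
Let Cdal I : CkMx U 1 (dmx I al). Proof. exact: CkMx_partial. Qed.

Let hT w : (h w)^T = h w.
Proof. by rewrite /h trmx_inv gT. Qed.

Let dhT I w : (dmx I h w)^T = dmx I h w.
Proof. by rewrite -dmxT; congr (dmx I _ w); apply/funext => y; rewrite hT. Qed.

Lemma partial_tr4 I (a S b T : 'rV[R]_m -> 'M[R]_n) w :
  CkMx U 1 a -> CkMx U 1 S -> CkMx U 1 b -> CkMx U 1 T -> U w ->
  partial I (fun y => \tr (a y *m S y *m b y *m (T y)^T)) w =
  \tr (dmx I a w *m S w *m b w *m (T w)^T) + \tr (a w *m dmx I S w *m b w *m (T w)^T)
  + \tr (a w *m S w *m dmx I b w *m (T w)^T) + \tr (a w *m S w *m b w *m (dmx I T w)^T).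
Proof.
move=> Ca CS Cb CT Uw.
have CaS := CkMxM oU Ca CS.
have CaSb := CkMxM oU CaS Cb.
have CTT := CkMxT oU CT.
rewrite (partial_tr I (CkMxM oU CaSb CTT) Uw) (dmxM oU I CaSb CTT Uw).
rewrite (dmxM oU I CaS Cb Uw) (dmxM oU I Ca CS Uw) dmxT.
by rewrite !mulmxDl !mxtraceD.
Qed.

Lemma partial_norm_sq I w : U w ->
  partial I norm_sq w = 2 * \tr (h w *m dmx I al w *m h w *m (al w)^T)
    + 2 * \tr (dmx I h w *m al w *m h w *m (al w)^T).
Proof.
move=> Uw; rewrite /norm_sq /form2 (partial_tr4 I Ch1 Cal1 Ch1 Cal1 Uw).
have -> : \tr (h w *m al w *m dmx I h w *m (al w)^T) = \tr (dmx I h w *m al w *m h w *m (al w)^T).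
  rewrite -mxtrace_tr !trmx_mul trmxK dhT hT alT mulNmx !mulmxN !raddfN /=.
  by congr (- _); rewrite mxtrace_mulC !mulmxA.
have -> : \tr (h w *m al w *m h w *m (dmx I al w)^T) = \tr (h w *m dmx I al w *m h w *m (al w)^T).
  by rewrite -mxtrace_tr !trmx_mul trmxK hT !mulmxA mxtrace_mulC !mulmxA.
ring.
Qed.

(** The terms of 1/2 d_p d_q |al|^2 that contain a derivative of g^-1. *)
Let err (p q : 'I_n) w : R :=
  \tr (dmx (sp p) h w *m dmx (sp q) al w *m h w *m (al w)^T)
  + \tr (h w *m dmx (sp q) al w *m dmx (sp p) h w *m (al w)^T)
  + \tr (dmx (sp p) (dmx (sp q) h) w *m al w *m h w *m (al w)^T)
  + \tr (dmx (sp q) h w *m dmx (sp p) al w *m h w *m (al w)^T)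
  + \tr (dmx (sp q) h w *m al w *m dmx (sp p) h w *m (al w)^T)
  + \tr (dmx (sp q) h w *m al w *m h w *m (dmx (sp p) al w)^T).

Lemma partial2_norm_sq p q w : U w ->
  partial (sp p) (partial (sp q) norm_sq) w =
  2 * (\tr (h w *m dmx (sp p) (dmx (sp q) al) w *m h w *m (al w)^T)
       + \tr (h w *m dmx (sp q) al w *m h w *m (dmx (sp p) al w)^T) + err p q w).
Proof.
move=> Uw.
rewrite (eq_partial (sp p) oU Uw (@partial_norm_sq (sp q))).
have C1 : Ck 1 U (fun y => \tr (h y *m dmx (sp q) al y *m h y *m (al y)^T)).
  exact: Ck_tr (CkMxM oU (CkMxM oU (CkMxM oU Ch1 (@Cdal (sp q))) Ch1) (CkMxT oU Cal1)).
have C2 : Ck 1 U (fun y => \tr (dmx (sp q) h y *m al y *m h y *m (al y)^T)).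
  exact: Ck_tr (CkMxM oU (CkMxM oU (CkMxM oU (@Cdh (sp q)) Cal1) Ch1) (CkMxT oU Cal1)).
have C0 : Ck 1 U (fun _ : 'rV[R]_m => 2 : R) by exact: Ck_cst.
rewrite (partialD (sp p) (CkM oU C0 C1) (CkM oU C0 C2) Uw).
rewrite (partialM (sp p) C0 C1 Uw) (partialM (sp p) C0 C2 Uw) !partial_cst.
rewrite (partial_tr4 (sp p) Ch1 (@Cdal (sp q)) Ch1 Cal1 Uw).
rewrite (partial_tr4 (sp p) (@Cdh (sp q)) Cal1 Ch1 Cal1 Uw) /err.
rewrite !mul0r !add0r -mulrDr; congr (2 * _).
have reorder (b1 b2 b3 b4 e1 e2 e3 e4 : R) : b1 + b2 + b3 + b4 + (e1 + e2 + e3 + e4) =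
    b2 + b4 + (b1 + b3 + e1 + e2 + e3 + e4) by ring.
exact: reorder.
Qed.

Let s0 w : R := \sum_i \sum_j `|al w i j|.
Let s1 w : R := \sum_p \sum_i \sum_j `|dmx (sp p) al w i j|.

(* al solves a heat equation up to terms of lower order. *)
Hypothesis rem_dom : domd D (jet_size sp al)
  (fun w => dmx tm al w
     - \sum_p \sum_q invmx (g w) p q *: dmx (sp p) (dmx (sp q) al) w).

Let s0_ge0 w : 0 <= s0 w.
Proof. by apply: sumr_ge0 => i _; apply: sumr_ge0. Qed.

Let s1_ge0 w : 0 <= s1 w.
Proof. by apply: sumr_ge0 => p _; apply: sumr_ge0 => i _; apply: sumr_ge0. Qed.

Let le_entry (M : 'M[R]_n) i j : `|M i j| <= \sum_i \sum_j `|M i j|.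
Proof. exact: (le_sum_entry i j (fun k l => normr_ge0 (M k l))). Qed.

Let d0 : domd D s0 al.
Proof. by exists 1 => // w _ i j; rewrite mul1r; exact: le_entry. Qed.

Let d1 p : domd D (fun w => s0 w + s1 w) (dmx (sp p) al).
Proof. exact: domd_jet1. Qed.

Let d01 : domd D (fun w => s0 w + s1 w) al.
Proof. exact: domd_jet0. Qed.

Let bh : domd D (fun=> 1) h.
Proof. by apply: CkMx_bounded; exact: CkMx_leq Ch. Qed.

Let bdh I : domd D (fun=> 1) (dmx I h).
Proof. by apply: CkMx_bounded; exact: CkMx_leq (@Cdh I). Qed.

Let bddh I J : domd D (fun=> 1) (dmx I (dmx J h)).
Proof. by apply: CkMx_bounded; exact: CkMx_partial. Qed.

Let tail w : R := s0 w * (s0 w + s1 w).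

Let tail4 (a S b : 'rV[R]_m -> 'M[R]_n) :
  domd D (fun=> 1) a -> domd D (fun=> 1) b -> domd D (fun w => s0 w + s1 w) S ->
  domf D tail (fun x => \tr (a x *m S x *m b x *m (al x)^T)).
Proof.
move=> da db dS; apply: domf_le (domf_tr4 da db dS d0) => w _.
by rewrite /tail mulrC.
Qed.

Let err_dom p q : domf D tail (err p q).
Proof.
rewrite /err; apply: domfD; first (apply: domfD; first (apply: domfD; first (apply: domfD; first apply: domfD))).
- by apply: tail4.
- by apply: tail4.
- by apply: tail4.
- by apply: tail4.
- by apply: tail4.
- exact: domf_tr4.
Qed.

(** The Hessian of |al|^2 contributes 2 g^pq <d_p al, d_q al>, which controls
    |d al|^2. Every other term is bounded by |al| (|al| + |d al|), and Young's
    inequality absorbs |al| |d al| into that term at the price of a multiple of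
    |al|^2. *)
Lemma evolution_inequality : exists C : R, forall w, D w ->
  partial tm norm_sq w <=
  \sum_p \sum_q invmx (g w) p q * partial (sp p) (partial (sp q) norm_sq) w
  + C * norm_sq w.
Proof.
pose rem w := dmx tm al w - \sum_p \sum_q h w p q *: dmx (sp p) (dmx (sp q) al) w.
pose E w := \sum_p \sum_q h w p q * err p q w
   - \tr (h w *m rem w *m h w *m (al w)^T)
   - \tr (dmx tm h w *m al w *m h w *m (al w)^T).
pose G3 w := \sum_p \sum_q h w p q * form2 (h w) (dmx (sp p) al w) (dmx (sp q) al w).
have tail_ge0 w : D w -> 0 <= tail w by move=> _; rewrite mulr_ge0 // addr_ge0.
have [A A0 HA] : domf D tail E.
  apply: domfD; first apply: domfD.
  - apply: domf_sum => // p; apply: domf_sum => // q.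
    apply: domf_le (domfM (domd_entry p q bh) (err_dom p q)) => w _.
    by rewrite mul1r.
  - by apply: domfN; apply: tail4.
  - by apply: domfN; apply: tail4.
have [B B0 HB] := domf_tr (CkMx_bounded (CkMx_leq (isT : (0 <= 2)%N) Cg)).
have key w : D w -> \sum_p \sum_q h w p q * partial (sp p) (partial (sp q) norm_sq) w
    - partial tm norm_sq w = 2 * (G3 w + E w).
  move=> Dw; have Uw := KU (DK Dw).
  rewrite (partial_norm_sq tm Uw).
  under eq_bigr => p _ do under eq_bigr => q _ do rewrite (partial2_norm_sq p q Uw).
  have -> : G3 w = \sum_p \sum_q h w p q *
      \tr (h w *m dmx (sp q) al w *m h w *m (dmx (sp p) al w)^T).
    apply: eq_bigr => p _; apply: eq_bigr => q _.
    by rewrite (form2C (dmx (sp p) al w) (dmx (sp q) al w) (hT w)).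
  rewrite /E; have -> : \tr (h w *m rem w *m h w *m (al w)^T) =
     \tr (h w *m dmx tm al w *m h w *m (al w)^T) - \sum_p \sum_q h w p q *
       \tr (h w *m dmx (sp p) (dmx (sp q) al) w *m h w *m (al w)^T).
    rewrite /rem mulmxBr !mulmxBl raddfB /=; congr (_ - _).
    rewrite mulmx_sumr !mulmx_suml raddf_sum /=; apply: eq_bigr => p _.
    rewrite mulmx_sumr !mulmx_suml raddf_sum /=; apply: eq_bigr => q _.
    by rewrite -scalemxAr -!scalemxAl mxtraceZ.
  have -> : \sum_p \sum_q h w p q *
      (2 * (\tr (h w *m dmx (sp p) (dmx (sp q) al) w *m h w *m (al w)^T) +
        \tr (h w *m dmx (sp q) al w *m h w *m (dmx (sp p) al w)^T) + err p q w)) =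
     2 * (\sum_p \sum_q h w p q * \tr (h w *m dmx (sp p) (dmx (sp q) al) w *m h w *m (al w)^T))
     + 2 * (\sum_p \sum_q h w p q *
        \tr (h w *m dmx (sp q) al w *m h w *m (dmx (sp p) al w)^T))
     + 2 * \sum_p \sum_q h w p q * err p q w.
    rewrite !mulr_sumr -!big_split /=; apply: eq_bigr => p _.
    rewrite !mulr_sumr -!big_split /=; apply: eq_bigr => q _; ring.
  ring.
have s0le w : D w -> s0 w ^+ 2 <= (n * n)%:R * (B ^+ 2 * norm_sq w).
  move=> Dw.
  have cs : s0 w ^+ 2 <= (n * n)%:R * frob (al w).
    rewrite /s0 /frob !pair_big /=.
    apply: le_trans (sqr_sum_norm_le (fun ij : 'I_n * 'I_n => al w ij.1 ij.2)) _.
    by rewrite card_prod card_ord.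
  apply: le_trans cs _; apply: ler_wpM2l => //.
  apply: le_trans (form2_coercive (al w) (gT w) (gpos Dw)) _.
  apply: ler_wpM2r; first exact: form2_ge0 (gT w) (gpos Dw).
  have t0 := posdef_trace_ge0 (gT w) (gpos Dw).
  rewrite lerXn2r ?nnegrE //.
  by have := HB w Dw; rewrite mulr1 ger0_norm.
have G3ge w : D w -> 0 <= G3 w.
  by move=> Dw; exact: (form3_ge0 _ (gT w) (gpos Dw)).
have s1le w : D w -> s1 w ^+ 2 <= (n * (n * n))%:R * (B ^+ 3 * G3 w).
  move=> Dw.
  have cs : s1 w ^+ 2 <= (n * (n * n))%:R * \sum_p frob (dmx (sp p) al w).
    have flat (F : 'M[R]_n -> 'I_n -> 'I_n -> R) :
        \sum_p \sum_i \sum_j F (dmx (sp p) al w) i j =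
        \sum_(p : 'I_n * ('I_n * 'I_n)) F (dmx (sp p.1) al w) p.2.1 p.2.2.
      by under eq_bigr => p _ do rewrite pair_big /=; rewrite pair_big.
    rewrite /s1 /frob (flat (fun M i j => `|M i j|)) (flat (fun M i j => M i j ^+ 2)).
    apply: le_trans (sqr_sum_norm_le (fun p => dmx (sp p.1) al w p.2.1 p.2.2)) _.
    by rewrite !card_prod card_ord.
  apply: le_trans cs _; apply: ler_wpM2l => //.
  apply: le_trans (form3_coercive _ (gT w) (gpos Dw)) _.
  apply: ler_wpM2r; first exact: G3ge.
  have t0 := posdef_trace_ge0 (gT w) (gpos Dw).
  rewrite lerXn2r ?nnegrE //.
  by have := HB w Dw; rewrite mulr1 ger0_norm.
pose c1 := (n * n)%:R * B ^+ 2.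
pose c2 := (n * (n * n))%:R * B ^+ 3 + 1.
have c1_ge0 : 0 <= c1 by rewrite mulr_ge0 // exprn_ge0.
have c2_gt0 : 0 < c2 by rewrite ltr_wpDl // mulr_ge0 // exprn_ge0.
(* Young: A s0 s1 <= s1^2 / c2 + A^2 c2 s0^2, where s1^2 <= c2 G3. *)
exists (2 * ((A + A ^+ 2 * c2) * c1)) => w Dw.
have Q0 : 0 <= norm_sq w by exact: form2_ge0 (gT w) (gpos Dw).
have S0 := s0le w Dw; have S1 := s1le w Dw; have G0 := G3ge w Dw.
have E0 := HA w Dw; have k := key w Dw.
have S1' : s1 w ^+ 2 <= c2 * G3 w.
  apply: le_trans S1 _; rewrite /c2 mulrDl mul1r mulrA lerDl; exact: G0.
have S0' : s0 w ^+ 2 <= c1 * norm_sq w by move: S0; rewrite /c1 mulrA.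
have E1 : - (A * tail w) <= E w by move: E0; rewrite ler_norml => /andP[].
have Y : A * (s0 w * s1 w) <= G3 w + A ^+ 2 * c2 * s0 w ^+ 2.
  have sq : 0 <= (s1 w - A * c2 * s0 w) ^+ 2 by exact: sqr_ge0.
  have mono : c2 * (A * (s0 w * s1 w)) <= c2 * (G3 w + A ^+ 2 * c2 * s0 w ^+ 2).
    have a0 : 0 <= A ^+ 2 * c2 ^+ 2 * s0 w ^+ 2.
      by rewrite !mulr_ge0 ?exprn_ge0 // ltW.
    have b0 : 0 <= s1 w ^+ 2 by exact: sqr_ge0.
    rewrite mulrDr; apply: le_trans (lerD S1' (lexx _)).
    have -> : c2 * (A ^+ 2 * c2 * s0 w ^+ 2) = A ^+ 2 * c2 ^+ 2 * s0 w ^+ 2 by ring.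
    have e : (s1 w - A * c2 * s0 w) ^+ 2 = s1 w ^+ 2 - 2 * (c2 * (A * (s0 w * s1 w)))
        + A ^+ 2 * c2 ^+ 2 * s0 w ^+ 2 by ring.
    by move: sq; rewrite e; move: a0 b0; lra.
  by move: mono; rewrite ler_pM2l.
have Z : A * s0 w ^+ 2 + A ^+ 2 * c2 * s0 w ^+ 2 <= (A + A ^+ 2 * c2) * c1 * norm_sq w.
  rewrite -mulrDl -[leRHS]mulrA; apply: ler_wpM2l => //.
  by rewrite addr_ge0 // mulr_ge0 ?exprn_ge0 // ltW.
have te : A * tail w = A * s0 w ^+ 2 + A * (s0 w * s1 w) by rewrite /tail; ring.
move: k E1 Y Z; rewrite te /h -!mulrA.
move: (\sum_p \sum_q _) (partial tm norm_sq w) => L P'.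
lra.
Qed.

End Evolution.

(** * Families of immersions in product coordinates *)

Lemma dmxE (R : realType) m p q (i : 'I_m) (M : 'rV[R]_m -> 'M[R]_(p, q)) x a b :
  dmx i M x a b = partial i (fun y => M y a b) x.
Proof. by rewrite /dmx mxE. Qed.

Lemma rows_swap (R : realType) n (P1 P2 Q1 Q2 M N : 'M[R]_n) i j k :
  (forall a, P1 j a = P2 i a) -> (forall a, Q1 j a = Q2 i a) ->
  (P1 *m M *m N + Q1 *m N) j k = (P2 *m M *m N + Q2 *m N) i k.
Proof.
move=> eP eQ.
have row_eq (X Y Z : 'M[R]_n) l : (forall a, X j a = Y i a) -> (X *m Z) j l = (Y *m Z) i l.
  by move=> e; rewrite !mxE; apply: eq_bigr => a _; rewrite e.
have := row_eq _ _ N k (fun a => row_eq _ _ M a eP); have := row_eq _ _ N k eQ.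
move: (P1 *m M *m N) (P2 *m M *m N) (Q1 *m N) (Q2 *m N) => X1 X2 Y1 Y2.
by rewrite !mxE => -> ->.
Qed.

(** Points of space-time are row vectors whose last entry is the time. *)
Definition ispace n (i : 'I_n) : 'I_(n + 1) := lshift 1 i.
Definition itime {n} : 'I_(n + 1) := rshift n ord0.

Section LocalGeometry.
Variables (R : realType) (n : nat).
Variables (O : set 'rV[R]_(n + n)) (W : set 'rV[R]_(n + 1)).
Hypotheses (oO : open O) (oW : open W).
Variables (c : 'rV[R]_(n + n) -> R) (f : 'rV[R]_(n + 1) -> 'rV[R]_(n + n)).
Hypothesis Cc : Ck 4 O c.
Hypothesis Cf : forall k j, Ck k W (fun w => f w 0 j).
Hypothesis fWO : forall w, W w -> O (f w).
Local Opaque Ck partial dmx.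

(** The mixed block h_{i sbar} of the metric. *)
Definition Cmx (z : 'rV[R]_(n + n)) : 'M[R]_n :=
  \matrix_(a, s) (- 2^-1 * partial (lshift n a) (partial (rshift n s) c) z).
(** jacl and jacr are the x-half and the xbar-half of the Jacobian of f in all
    directions of space-time; Amx and Bmx keep the space directions. *)
Definition jacl (w : 'rV[R]_(n + 1)) : 'M[R]_(n + 1, n) :=
  \matrix_(I, a) partial I (fun w => f w 0 (lshift n a)) w.
Definition jacr (w : 'rV[R]_(n + 1)) : 'M[R]_(n + 1, n) :=
  \matrix_(I, a) partial I (fun w => f w 0 (rshift n a)) w.
Definition Amx w : 'M[R]_n := \matrix_(i, a) jacl w (ispace i) a.
Definition Bmx w : 'M[R]_n := \matrix_(i, a) jacr w (ispace i) a.
Definition Cfm w : 'M[R]_n := Cmx (f w).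
(** E_ij pairs the x-part of F_i with the xbar-part of F_j. The induced metric gmx
    and the restricted Kaehler form omx are E + E^T and E - E^T because both
    factors are isotropic. *)
Definition Emx w : 'M[R]_n := Amx w *m Cfm w *m (Bmx w)^T.
Definition gmx w : 'M[R]_n := Emx w + (Emx w)^T.
Definition omx w : 'M[R]_n := Emx w - (Emx w)^T.
(** Its antisymmetrization Lam is the pullback of omega to space-time. *)
Definition Ffull w : 'M[R]_(n + 1) := jacl w *m Cfm w *m (jacr w)^T.
Definition Lam w : 'M[R]_(n + 1) := Ffull w - (Ffull w)^T.

Lemma CkMx_Cmx : CkMx O 2 Cmx.
Proof.
move=> a s.
have H : Ck 2 O (partial (lshift n a) (partial (rshift n s) c)).
  by apply: Ck_partial; apply: Ck_partial.
apply: (Ck_ext oO _ (CkM oO (Ck_cst oO 2 (- 2^-1)) H)) => z _.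
by rewrite mxE.
Qed.

Lemma dCmxE P q s z : O z -> dmx P Cmx z q s =
  - 2^-1 * partial P (partial (lshift n q) (partial (rshift n s) c)) z.
Proof.
move=> Oz; rewrite [LHS]dmxE.
have -> : (fun y => Cmx y q s) =
    (fun y => - 2^-1 * partial (lshift n q) (partial (rshift n s) c) y).
  by apply/funext => y; rewrite mxE.
have C3 : Ck 3 O (partial (rshift n s) c) by exact: Ck_partial.
have C2 : Ck 2 O (partial (lshift n q) (partial (rshift n s) c)) by exact: Ck_partial.
by rewrite (partialM _ (Ck_cst oO 1 _) (Ck_pred C2) Oz) partial_cst mul0r add0r.
Qed.

(** The first derivatives of C are third derivatives of c, hence symmetric in the
    unbarred indices, and likewise in the barred ones. *)
Lemma dCmx_syml a b s z : O z -> dmx (lshift n a) Cmx z b s = dmx (lshift n b) Cmx z a s.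
Proof.
move=> Oz; apply: etrans (dCmxE _ _ _ Oz) _; apply: etrans _ (esym (dCmxE _ _ _ Oz)).
have C3 : Ck 3 O (partial (rshift n s) c) by exact: Ck_partial.
exact: (congr1 (fun t => - 2^-1 * t) (schwarz oO _ _ (Ck_pred C3) Oz)).
Qed.

Lemma dCmx_symr r a s z : O z -> dmx (rshift n r) Cmx z a s = dmx (rshift n s) Cmx z a r.
Proof.
move=> Oz; apply: etrans (dCmxE _ _ _ Oz) _; apply: etrans _ (esym (dCmxE _ _ _ Oz)).
have C2 q : Ck 2 O (partial (rshift n q) c).
  have C3 : Ck 3 O (partial (rshift n q) c) by exact: Ck_partial.
  exact: (Ck_pred C3).
apply: (congr1 (fun t => - 2^-1 * t)).
apply: etrans (schwarz oO (rshift n r) (lshift n a) (C2 s) Oz) _.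
apply: etrans _ (esym (schwarz oO (rshift n s) (lshift n a) (C2 r) Oz)).
apply: (eq_partial _ oO Oz) => y Oy.
exact: (schwarz oO _ _ (Ck_leq (isT : (2 <= 4)%N) Cc) Oy).
Qed.

Lemma Ck_after_f k (F : 'rV[R]_(n + n) -> R) : Ck k O F -> Ck k W (fun w => F (f w)).
Proof. by move=> CF; apply: (Ck_comp oW oO fWO _ CF) => j; exact: Cf. Qed.

Lemma CkMx_Cfm : CkMx W 2 Cfm.
Proof. by move=> a s; apply: (@Ck_after_f 2 (fun z => Cmx z a s)); exact: CkMx_Cmx. Qed.

Lemma CkMx_jacl k : CkMx W k jacl.
Proof.
move=> I a; apply: (Ck_ext oW _ (Ck_partial I (Cf k.+1 (lshift n a)))) => w _.
by rewrite mxE.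
Qed.

Lemma CkMx_jacr k : CkMx W k jacr.
Proof.
move=> I a; apply: (Ck_ext oW _ (Ck_partial I (Cf k.+1 (rshift n a)))) => w _.
by rewrite mxE.
Qed.

Lemma CkMx_Amx k : CkMx W k Amx.
Proof. by move=> i a; apply: (Ck_ext oW _ (@CkMx_jacl k (ispace i) a)) => w _; rewrite [RHS]mxE. Qed.

Lemma CkMx_Bmx k : CkMx W k Bmx.
Proof. by move=> i a; apply: (Ck_ext oW _ (@CkMx_jacr k (ispace i) a)) => w _; rewrite [RHS]mxE. Qed.

Lemma CkMx_Emx : CkMx W 2 Emx.
Proof.
have H := CkMxM oW (CkMxM oW (@CkMx_Amx 2) CkMx_Cfm) (CkMxT oW (@CkMx_Bmx 2)).
exact: H.
Qed.

Lemma CkMx_gmx : CkMx W 2 gmx.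
Proof. have H := CkMxD oW CkMx_Emx (CkMxT oW CkMx_Emx); exact: H. Qed.

Lemma CkMx_omx : CkMx W 2 omx.
Proof. have H := CkMxB oW CkMx_Emx (CkMxT oW CkMx_Emx); exact: H. Qed.

Lemma CkMx_Lam : CkMx W 2 Lam.
Proof.
have CF := CkMxM oW (CkMxM oW (@CkMx_jacl 2) CkMx_Cfm) (CkMxT oW (@CkMx_jacr 2)).
have H := CkMxB oW CF (CkMxT oW CF); exact: H.
Qed.

Lemma gmxT w : (gmx w)^T = gmx w.
Proof. by rewrite /gmx linearD /= trmxK addrC. Qed.

Lemma omxT w : (omx w)^T = - omx w.
Proof. by rewrite /omx linearB /= trmxK opprB. Qed.

(** omega = d q_s /\ d xbar^s with q_s = - 1/2 d_{sbar} c; qf and yf are the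
    pullbacks of q_s and xbar^s. *)
Definition qf (s : 'I_n) (w : 'rV[R]_(n + 1)) : R := - 2^-1 * partial (rshift n s) c (f w).
Definition yf (s : 'I_n) (w : 'rV[R]_(n + 1)) : R := f w 0 (rshift n s).

Lemma Ck_qf s : Ck 3 W (qf s).
Proof.
apply: (CkM oW); first exact: Ck_cst.
by apply: Ck_after_f; exact: Ck_partial.
Qed.

Lemma partial_qf I s w : W w ->
  partial I (qf s) w = (jacl w *m Cfm w) I s
   + \sum_r jacr w I r * (- 2^-1 * partial (rshift n r) (partial (rshift n s) c) (f w)).
Proof.
move=> Ww.
have C1 : Ck 1 O (partial (rshift n s) c) by apply: (@Ck_leq _ _ 1 3) => //; exact: Ck_partial.
have C2 : Ck 1 W (fun w => partial (rshift n s) c (f w)) by exact: Ck_after_f.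
rewrite /qf (partialM I (Ck_cst oW 1 _) C2 Ww) partial_cst mul0r add0r.
rewrite (partial_comp oO fWO I (Cf 1) C1 Ww) big_split_ord /= mulrDr mxE.
congr (_ + _); rewrite mulr_sumr; apply: eq_bigr => a _.
  by rewrite [jacl w I a]mxE [Cfm w a s]mxE mulrCA.
by rewrite [jacr w I a]mxE mulrCA.
Qed.

Lemma Lam_qy w I J : W w -> Lam w I J =
  \sum_s (partial I (qf s) w * partial J (yf s) w - partial J (qf s) w * partial I (yf s) w).
Proof.
move=> Ww.
have yE K s : partial K (yf s) w = jacr w K s by rewrite mxE.
pose S r s := - 2^-1 * partial (rshift n r) (partial (rshift n s) c) (f w).
have Ssym r s : S r s = S s r.
  have C2 : Ck 2 O c := Ck_leq (isT : (2 <= 4)%N) Cc.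
  exact: (congr1 (fun t => - 2^-1 * t) (schwarz oO (rshift n r) (rshift n s) C2 (fWO Ww))).
have E K L : \sum_s partial K (qf s) w * partial L (yf s) w =
    Ffull w K L + \sum_s \sum_r jacr w K r * S r s * jacr w L s.
  rewrite /Ffull mxE -big_split /=; apply: eq_bigr => s _.
  by rewrite (partial_qf K s Ww) yE mulrDl [(jacr w)^T s L]mxE mulr_suml.
have LE : Lam w I J = Ffull w I J - Ffull w J I.
  by rewrite /Lam; move: (Ffull w) => F0; rewrite !mxE.
rewrite sumrB E (E J I) LE.
have -> : \sum_s \sum_r jacr w J r * S r s * jacr w I s
   = \sum_s \sum_r jacr w I r * S r s * jacr w J s.
  rewrite exchange_big /=; apply: eq_bigr => r _; apply: eq_bigr => s _.
  by rewrite (Ssym r s) [LHS]mulrC [jacr w J r * _]mulrC mulrA.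
by rewrite opprD addrACA subrr addr0.
Qed.

(** Lam is the exterior derivative of qf_s d yf_s: the second derivatives cancel
    in the cyclic sum. *)
Lemma Lam_closed w I J K : W w ->
  partial I (fun y => Lam y J K) w + partial J (fun y => Lam y K I) w
  + partial K (fun y => Lam y I J) w = 0.
Proof.
move=> Ww.
have Cq s : Ck 2 W (qf s) by apply: (@Ck_leq _ _ 2 3) => //; exact: Ck_qf.
have Cy s : Ck 2 W (yf s) by exact: Cf.
have C1 (F : 'rV[R]_(n + 1) -> R) P : Ck 2 W F -> Ck 1 W (partial P F) by exact: Ck_partial.
have D P A B : partial P (fun y => Lam y A B) w =
  \sum_s (partial P (partial A (qf s)) w * partial B (yf s) w
        + partial A (qf s) w * partial P (partial B (yf s)) w
        - (partial P (partial B (qf s)) w * partial A (yf s) w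
        + partial B (qf s) w * partial P (partial A (yf s)) w)).
  rewrite (eq_partial P oW Ww (fun y => @Lam_qy y A B)).
  have M s A' B' : Ck 1 W (fun y => partial A' (qf s) y * partial B' (yf s) y).
    have H := CkM oW (C1 _ A' (Cq s)) (C1 _ B' (Cy s)); exact: H.
  rewrite (partial_sum P (U := W)); [|by move=> s _; have H := CkB oW (M s A B) (M s B A); exact: H|exact: Ww].
  apply: eq_bigr => s _.
  rewrite (partialB P (M s A B) (M s B A) Ww).
  rewrite (partialM P (C1 _ A (Cq s)) (C1 _ B (Cy s)) Ww).
  by rewrite (partialM P (C1 _ B (Cq s)) (C1 _ A (Cy s)) Ww).
rewrite !D -!big_split /= big1 // => s _.
have aux (p y : 'I_(n + 1) -> 'I_(n + 1) -> R) (p1 y1 : 'I_(n + 1) -> R) :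
    (forall A B, p A B = p B A) -> (forall A B, y A B = y B A) ->
    p I J * y1 K + p1 J * y I K - (p I K * y1 J + p1 K * y I J)
    + (p J K * y1 I + p1 K * y J I - (p J I * y1 K + p1 I * y J K))
    + (p K I * y1 J + p1 I * y K J - (p K J * y1 I + p1 J * y K I)) = 0.
  move=> ps ys; rewrite (ps J I) (ps K I) (ps K J) (ys J I) (ys K I) (ys K J); ring.
exact: (aux (fun A B => partial A (partial B (qf s)) w) (fun A B => partial A (partial B (yf s)) w)
  (fun A => partial A (qf s) w) (fun A => partial A (yf s) w)
  (fun A B => schwarz oW A B (Cq s) Ww) (fun A B => schwarz oW A B (Cy s) Ww)).
Qed.

Lemma omx_Lam w i j : omx w i j = Lam w (ispace i) (ispace j).
Proof.
have E k l : Emx w k l = Ffull w (ispace k) (ispace l).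
  rewrite /Emx /Ffull !mxE; apply: eq_bigr => s _; rewrite !mxE; congr (_ * _).
  by apply: eq_bigr => a _; rewrite !mxE.
have sk p (M : 'M[R]_p) a b : (M - M^T) a b = M a b - M b a by rewrite !mxE.
by rewrite /omx /Lam !sk !E.
Qed.

Lemma Lam_skew w I J : Lam w I J = - Lam w J I.
Proof.
have sk p (M : 'M[R]_p) a b : (M - M^T) a b = M a b - M b a by rewrite !mxE.
by rewrite /Lam !sk opprB.
Qed.

(** dCl and dCr are the parts of d_k (C o f) due to the motion of x and of xbar. *)
Definition dCl k w : 'M[R]_n := \sum_a Amx w k a *: dmx (lshift n a) Cmx (f w).
Definition dCr k w : 'M[R]_n := \sum_s Bmx w k s *: dmx (rshift n s) Cmx (f w).
(** (U_k)_jl and (Ub_k)_jl are h (., F_l) of the x-part and of the xbar-part of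
    the covariant derivative D_k F_j; see cov_deriv_lowered. They are symmetric
    in k and j as the connection has no torsion, and d_k E = U_k + (Ub_k)^T. *)
Definition Umx k w : 'M[R]_n :=
  dmx (ispace k) Amx w *m Cfm w *m (Bmx w)^T + Amx w *m dCl k w *m (Bmx w)^T.
Definition Ubmx k w : 'M[R]_n :=
  dmx (ispace k) Bmx w *m (Cfm w)^T *m (Amx w)^T + Bmx w *m (dCr k w)^T *m (Amx w)^T.

Lemma dCfm k w : W w -> dmx (ispace k) Cfm w = dCl k w + dCr k w.
Proof.
move=> Ww; apply/matrixP => a s.
have C1 : Ck 1 O (fun z => Cmx z a s) by exact: (CkMx_leq (isT : (1 <= 2)%N) CkMx_Cmx).
have dE (P : 'I_(n + n)) : partial P (fun z => Cmx z a s) (f w) = dmx P Cmx (f w) a s.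
  by rewrite [RHS]dmxE.
have -> : dmx (ispace k) Cfm w a s = partial (ispace k) (fun w => Cmx (f w) a s) w.
  by rewrite [LHS]dmxE.
rewrite (partial_comp oO fWO (ispace k) (Cf 1) C1 Ww) big_split_ord /= [RHS]mxE.
congr (_ + _).
  rewrite /dCl summxE; apply: eq_bigr => b _; rewrite [RHS]mxE dE; congr (_ * _).
  by rewrite /Amx [RHS]mxE /jacl mxE.
rewrite /dCr summxE; apply: eq_bigr => b _; rewrite [RHS]mxE dE; congr (_ * _).
by rewrite /Bmx [RHS]mxE /jacr mxE.
Qed.

Lemma CkMx_dCl k : CkMx W 1 (dCl k).
Proof.
apply: (CkMx_sum oW) => a; apply: (CkMxZ oW); first exact: CkMx_Amx.
move=> b s; apply: (@Ck_after_f 1 (fun z => dmx (lshift n a) Cmx z b s)).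
by have := CkMx_partial oO (lshift n a) CkMx_Cmx; apply.
Qed.

Lemma CkMx_dCr k : CkMx W 1 (dCr k).
Proof.
apply: (CkMx_sum oW) => a; apply: (CkMxZ oW); first exact: CkMx_Bmx.
move=> b s; apply: (@Ck_after_f 1 (fun z => dmx (rshift n a) Cmx z b s)).
by have := CkMx_partial oO (rshift n a) CkMx_Cmx; apply.
Qed.

Lemma CkMx_Umx k : CkMx W 1 (Umx k).
Proof.
have CA := @CkMx_Amx 1; have CB := CkMxT oW (@CkMx_Bmx 1).
have CC := CkMx_leq (isT : (1 <= 2)%N) CkMx_Cfm.
have CdA := CkMx_partial oW (ispace k) (@CkMx_Amx 2).
have H := CkMxD oW (CkMxM oW (CkMxM oW CdA CC) CB) (CkMxM oW (CkMxM oW CA (CkMx_dCl k)) CB).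
exact: H.
Qed.

Lemma CkMx_Ubmx k : CkMx W 1 (Ubmx k).
Proof.
have CA := CkMxT oW (@CkMx_Amx 1); have CB := @CkMx_Bmx 1.
have CC := CkMxT oW (CkMx_leq (isT : (1 <= 2)%N) CkMx_Cfm).
have CdB := CkMx_partial oW (ispace k) (@CkMx_Bmx 2).
have H := CkMxD oW (CkMxM oW (CkMxM oW CdB CC) CA)
  (CkMxM oW (CkMxM oW CB (CkMxT oW (CkMx_dCr k))) CA).
exact: H.
Qed.

Lemma dEmx k w : W w -> dmx (ispace k) Emx w = Umx k w + (Ubmx k w)^T.
Proof.
move=> Ww.
have CA := @CkMx_Amx 1; have CB := CkMxT oW (@CkMx_Bmx 1).
have CC := CkMx_leq (isT : (1 <= 2)%N) CkMx_Cfm.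
rewrite [LHS](dmxM oW (ispace k) (CkMxM oW CA CC) CB Ww) (dmxM oW (ispace k) CA CC Ww) dmxT (dCfm k Ww).
rewrite /Umx /Ubmx; move: (dmx _ _ _) (dmx _ _ _) (dCl _ _) (dCr _ _) => dA dB c1 c2.
have trD (Y Z : 'M[R]_n) : (Y + Z)^T = Y^T + Z^T by apply/matrixP => a b; rewrite !mxE.
rewrite trD !trmx_mul !trmxK !mulmxDr !mulmxDl !mulmxA -!addrA; congr (_ + (_ + _)).
exact: addrC.
Qed.

Lemma Umx_sym i j k w : W w -> Umx i w j k = Umx j w i k.
Proof.
move=> Ww.
have s1 a : dmx (ispace i) Amx w j a = dmx (ispace j) Amx w i a.
  have e p q : dmx (ispace p) Amx w q a = partial (ispace p) (partial (ispace q) (fun w => f w 0 (lshift n a))) w.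
    rewrite [LHS]dmxE.
    by congr (partial _ _ _); apply/funext => y; rewrite /Amx mxE /jacl mxE.
  apply: etrans (e i j) _; apply: etrans _ (esym (e j i)).
  exact: (schwarz oW (ispace i) (ispace j) (Cf 2 _) Ww).
have s3 a b s := dCmx_syml a b s (fWO Ww).
have s2 s : (Amx w *m dCl i w) j s = (Amx w *m dCl j w) i s.
  have e p q : (Amx w *m dCl p w) q s =
      \sum_b \sum_a Amx w q b * (Amx w p a * dmx (lshift n a) Cmx (f w) b s).
    rewrite [LHS]mxE; apply: eq_bigr => b _; rewrite /dCl summxE mulr_sumr.
    by apply: eq_bigr => a _; rewrite [X in _ * X]mxE.
  rewrite (e i j) (e j i) exchange_big /=; apply: eq_bigr => b _; apply: eq_bigr => a _.
  apply: etrans (mulrCA _ _ _) _.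
  exact: (congr1 (fun t => Amx w i b * (Amx w j a * t)) (s3 b a s)).
exact: (rows_swap (Cfm w) (Bmx w)^T k s1 s2).
Qed.

Lemma Ubmx_sym i j k w : W w -> Ubmx i w j k = Ubmx j w i k.
Proof.
move=> Ww.
have s1 a : dmx (ispace i) Bmx w j a = dmx (ispace j) Bmx w i a.
  have e p q : dmx (ispace p) Bmx w q a = partial (ispace p) (partial (ispace q) (fun w => f w 0 (rshift n a))) w.
    rewrite [LHS]dmxE.
    by congr (partial _ _ _); apply/funext => y; rewrite /Bmx mxE /jacr mxE.
  apply: etrans (e i j) _; apply: etrans _ (esym (e j i)).
  exact: (schwarz oW (ispace i) (ispace j) (Cf 2 _) Ww).
have s3 r a s := dCmx_symr r a s (fWO Ww).
have s2 s : (Bmx w *m (dCr i w)^T) j s = (Bmx w *m (dCr j w)^T) i s.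
  have e p q : (Bmx w *m (dCr p w)^T) q s =
      \sum_b \sum_a Bmx w q b * (Bmx w p a * dmx (rshift n a) Cmx (f w) s b).
    rewrite [LHS]mxE; apply: eq_bigr => b _; rewrite [X in _ * X]mxE /dCr summxE mulr_sumr.
    by apply: eq_bigr => a _; rewrite [X in _ * X]mxE.
  rewrite (e i j) (e j i) exchange_big /=; apply: eq_bigr => b _; apply: eq_bigr => a _.
  apply: etrans (mulrCA _ _ _) _.
  exact: (congr1 (fun t => Bmx w i b * (Bmx w j a * t)) (s3 b s a)).
exact: (rows_swap (Cfm w)^T (Amx w)^T k s1 s2).
Qed.

End LocalGeometry.

(** * Evolution of the restricted Kaehler form *)

(** From 2 E = g + al and 2 E^T = g - al. Up to terms linear in al it replaces the
    inverse of g by half of that of E or E^T, which unlike g is a product. *)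
Lemma inv_sym_part (R : realType) n (E g al : 'M[R]_n) : g = E + E^T -> al = E - E^T ->
  E \in unitmx -> g \in unitmx ->
  invmx g = 2^-1 *: (invmx E + invmx E *m al *m invmx g) /\
  invmx g = 2^-1 *: (invmx E^T - invmx E^T *m al *m invmx g).
Proof.
move=> gE alE Eu gu.
have ETu : E^T \in unitmx by rewrite unitmx_tr.
have two (X : 'M[R]_n) : X = 2^-1 *: (X + X).
  by rewrite -mulr2n -[X *+ 2]scaler_nat scalerA mulVf ?scale1r // pnatr_eq0.
split; rewrite {1}[invmx g]two; congr (_ *: _).
  have <- : invmx E *m (g + al) *m invmx g = invmx E + invmx E *m al *m invmx g.
    by rewrite mulmxDr mulmxDl mulmxK.
  have -> : g + al = E + E by rewrite gE alE addrACA subrr addr0.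
  by rewrite mulmxDr mulVmx // mulmxDl mul1mx.
have <- : invmx E^T *m (g - al) *m invmx g = invmx E^T - invmx E^T *m al *m invmx g.
  by rewrite mulmxBr mulmxBl mulmxK.
have -> : g - al = E^T + E^T by rewrite gE alE opprB addrACA [E^T + - E]addrC addrACA subrr add0r.
by rewrite mulmxDr mulVmx // mulmxDl mul1mx.
Qed.

(** The source of the logarithmic derivatives of det A, det B and det C. *)
Lemma trace_log_part (R : realType) n (A B C dA dC : 'M[R]_n) :
  A *m C *m B^T \in unitmx ->
  \tr ((dA *m C *m B^T + A *m dC *m B^T) *m invmx (A *m C *m B^T)) =
  \tr (dA *m invmx A) + \tr (dC *m invmx C).
Proof.
move=> Eu; have := Eu; rewrite !unitmx_mul => /andP[/andP[Au Cu] Bu].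
have EE : (A *m C *m B^T) *m invmx (A *m C *m B^T) = 1%:M by rewrite mulmxV.
move: EE; set V := invmx (A *m C *m B^T) => EE.
have k1 : C *m (B^T *m V) = invmx A.
  by rewrite -[LHS](mulKmx Au) -[RHS]mulmx1 -EE !mulmxA.
have k2 : B^T *m V = invmx C *m invmx A by rewrite -k1 mulKmx.
have e1 : dA *m C *m B^T *m V = dA *m invmx A by rewrite -!mulmxA k1.
have e2 : A *m dC *m B^T *m V = A *m (dC *m invmx C) *m invmx A by rewrite -!mulmxA k2.
rewrite mulmxDl mxtraceD e1 e2; congr (_ + _).
by rewrite mxtrace_mulC mulKmx.
Qed.

Lemma cyclic_sum0 (V : zmodType) (X Y T1 T2 T3 : V) :
  X = 0 -> X = Y + T3 -> Y = T1 + T2 -> T1 - (- T3) = - T2.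
Proof.
move=> -> H1 H2; apply/eqP; rewrite -subr_eq0 opprK opprK addrAC -H2 -H1.
by [].
Qed.

Section LocalEvolution.
Variables (R : realType) (n : nat).
Variables (O : set 'rV[R]_(n + n)) (W : set 'rV[R]_(n + 1)).
Hypotheses (oO : open O) (oW : open W).
Variables (c : 'rV[R]_(n + n) -> R) (f : 'rV[R]_(n + 1) -> 'rV[R]_(n + n)).
Hypothesis Cc : Ck 4 O c.
Hypothesis Cf : forall k j, Ck k W (fun w => f w 0 j).
Hypothesis fWO : forall w, W w -> O (f w).
Local Opaque Ck partial dmx.

Local Notation A := (Amx f).
Local Notation B := (Bmx f).
Local Notation C := (Cfm c f).
Local Notation E := (Emx c f).
Local Notation g := (gmx c f).
Local Notation al := (omx c f).
Local Notation U := (Umx c f).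
Local Notation Ub := (Ubmx c f).
Local Notation L := (Lam c f).

Hypothesis Eu : forall w, W w -> E w \in unitmx.
Hypothesis gu : forall w, W w -> g w \in unitmx.
(* S consists of the points with an admissible time. It need not be open, but
   contains whole time slices. *)
Variable S : set 'rV[R]_(n + 1).
Hypothesis S_shift : forall (i : 'I_n) (s : R) w, S w -> S (s *: delta_mx 0 (ispace i) + w).
Variables (rf : 'rV[R]_(n + 1) -> R) (tau : 'rV[R]_(n + 1) -> 'rV[R]_n).
Hypothesis Crf : Ck 2 W rf.
Hypothesis Ctau : CkMx W 1 tau.
Local Notation h w := (invmx (g w)).

(* The flow equation paired with omega (., F_k); see flow_identity. *)
Hypothesis Hflow : forall w k, W w -> S w ->
  L w itime (ispace k) = \sum_i \sum_j h w i j * (U i w j k - Ub i w j k)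
    + 2^-1 * (partial (ispace k) rf w - \tr (dCl c f k w *m invmx (C w))
              + \tr (dCr c f k w *m invmx (C w)))
    + \sum_m tau w 0 m * al w m k.

(** Space derivatives only see one time slice, so that an identity known for
    admissible times may be differentiated in space. *)
Lemma eq_partial_slice (i : 'I_n) F G w : W w -> S w ->
  (forall y, W y -> S y -> F y = G y) ->
  partial (ispace i) F w = partial (ispace i) G w.
Proof.
move=> Ww Sw FG; apply: etrans (derive_line _ _ _) _; apply: etrans _ (esym (derive_line _ _ _)).
apply: near_eq_derive.
have cl : {for (0 : R), continuous (fun s : R => s *: (delta_mx 0 (ispace i) : 'rV[R]_(n + 1)) + w)}.
  apply: (@continuousD _ _ _ (fun s : R => s *: (delta_mx 0 (ispace i) : 'rV[R]_(n + 1))) (fun=> w)).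
    exact: scalel_continuous.
  exact: cst_continuous.
have : \forall s \near (0 : R), W (s *: (delta_mx 0 (ispace i) : 'rV[R]_(n + 1)) + w).
  apply: cl; rewrite scale0r add0r; exact: open_nbhs_nbhs.
by apply: filterS => s Ws; apply: FG => //; exact: S_shift.
Qed.

Let Cg : CkMx W 2 g. Proof. exact (CkMx_gmx oO oW Cc Cf fWO). Qed.
Let Cal : CkMx W 2 al. Proof. exact (CkMx_omx oO oW Cc Cf fWO). Qed.
Let CE : CkMx W 2 E. Proof. exact (CkMx_Emx oO oW Cc Cf fWO). Qed.
Let CA k : CkMx W k A. Proof. exact (CkMx_Amx oW Cf k). Qed.
Let CB k : CkMx W k B. Proof. exact (CkMx_Bmx oW Cf k). Qed.
Let Ch : CkMx W 2 (fun w => h w). Proof. exact (CkMx_inv oW gu Cg). Qed.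
Let Ch1 : CkMx W 1 (fun w => h w). Proof. exact (CkMx_leq (isT : (1 <= 2)%N) Ch). Qed.

Let Au w : W w -> A w \in unitmx.
Proof. by move=> /Eu; rewrite /Emx !unitmx_mul => /andP[/andP[]]. Qed.
Let Bu w : W w -> B w \in unitmx.
Proof. by move=> /Eu; rewrite /Emx !unitmx_mul unitmx_tr => /andP[]. Qed.

(** The coefficients of the terms of mu_k that are linear in al. *)
Definition lin_coef k w : 'M[R]_n :=
  delta_mx k 0 *m tau w + 2^-1 *: (h w *m U k w *m invmx (E w))
  + 2^-1 *: (h w *m Ub k w *m invmx (E w)^T).

Lemma CkMx_lin_coef k : CkMx W 1 (lin_coef k).
Proof.
have CE1 := CkMx_leq (isT : (1 <= 2)%N) CE.
have CEi := CkMx_inv oW Eu CE1.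
have ETu w : W w -> (E w)^T \in unitmx by rewrite unitmx_tr; exact: Eu.
have CETi := CkMx_inv oW ETu (CkMxT oW CE1).
have CU := CkMx_Umx oO oW Cc Cf fWO k.
have CUb := CkMx_Ubmx oO oW Cc Cf fWO k.
have C2 : Ck 1 W (fun _ => 2^-1 : R) by exact: Ck_cst.
have T1 := CkMxM oW (CkMx_cst oW 1 (delta_mx k 0 : 'M[R]_(n, 1))) Ctau.
have T2 := CkMxZ oW C2 (CkMxM oW (CkMxM oW Ch1 CU) CEi).
have T3 := CkMxZ oW C2 (CkMxM oW (CkMxM oW Ch1 CUb) CETi).
have H := CkMxD oW (CkMxD oW T1 T2) T3; exact: H.
Qed.

(** d ln (rho det A) - d ln (rhobar det B), with rf = ln rho - ln rhobar. It is
    proportional to the differential of the phase of Omega on L, whence its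
    closedness. *)
Definition kap k w : R := \tr (dmx (ispace k) A w *m invmx (A w))
  - \tr (dmx (ispace k) B w *m invmx (B w)) + partial (ispace k) rf w.

Lemma Ck_kap k : Ck 1 W (kap k).
Proof.
have T1 := Ck_tr oW (CkMxM oW (CkMx_partial oW (ispace k) (CA 2)) (CkMx_inv oW Au (CA 1))).
have T2 := Ck_tr oW (CkMxM oW (CkMx_partial oW (ispace k) (CB 2)) (CkMx_inv oW Bu (CB 1))).
have H := CkD oW (CkB oW T1 T2) (Ck_partial (ispace k) Crf); exact: H.
Qed.

Lemma kap_closed i k w : W w ->
  partial (ispace i) (kap k) w = partial (ispace k) (kap i) w.
Proof.
move=> Ww.
have T1 k' := Ck_tr oW (CkMxM oW (CkMx_partial oW (ispace k') (CA 2)) (CkMx_inv oW Au (CA 1))).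
have T2 k' := Ck_tr oW (CkMxM oW (CkMx_partial oW (ispace k') (CB 2)) (CkMx_inv oW Bu (CB 1))).
have D i' k' : partial (ispace i') (kap k') w =
   partial (ispace i') (fun y => \tr (dmx (ispace k') A y *m invmx (A y))) w
   - partial (ispace i') (fun y => \tr (dmx (ispace k') B y *m invmx (B y))) w
   + partial (ispace i') (partial (ispace k') rf) w.
  apply: etrans (partialD (ispace i') (CkB oW (T1 k') (T2 k')) (Ck_partial (ispace k') Crf) Ww) _.
  by rewrite (partialB (ispace i') (T1 k') (T2 k') Ww).
apply: etrans (D i k) _; apply: etrans _ (esym (D k i)).
apply: (congr2 +%R); last exact: (schwarz oW _ _ Crf Ww).
apply: (congr2 (fun a b => a - b)).
  exact: (log_derivative_closed oW _ _ Au (CA 2) Ww).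
exact: (log_derivative_closed oW _ _ Bu (CB 2) Ww).
Qed.

Lemma traceE k w : W w ->
  \sum_i \sum_j h w i j * U k w i j =
  2^-1 * (\tr (dmx (ispace k) A w *m invmx (A w)) + \tr (dCl c f k w *m invmx (C w)))
  + 2^-1 * \tr (h w *m U k w *m invmx (E w) *m al w).
Proof.
move=> Ww; have Ewu := Eu Ww.
have hT : (h w)^T = h w by rewrite trmx_inv gmxT.
have hs i j : h w i j = h w j i by move: (h w) hT => X XT; rewrite -{1}XT mxE.
have -> : \sum_i \sum_j h w i j * U k w i j = \tr (U k w *m h w).
  apply: eq_bigr => i _; rewrite mxE; apply: eq_bigr => j _.
  by rewrite hs mulrC.
have [hE _] := inv_sym_part (erefl (g w)) (erefl (al w)) Ewu (gu Ww).
rewrite {1}hE -scalemxAr mxtraceZ mulmxDr mxtraceD mulrDr; congr (_ * _ + _ * _).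
  rewrite /Umx /Emx trace_log_part //.
by rewrite !mulmxA mxtrace_mulC !mulmxA.
Qed.

Lemma traceEb k w : W w ->
  \sum_i \sum_j h w i j * Ub k w i j =
  2^-1 * (\tr (dmx (ispace k) B w *m invmx (B w)) + \tr (dCr c f k w *m invmx (C w)))
  - 2^-1 * \tr (h w *m Ub k w *m invmx (E w)^T *m al w).
Proof.
move=> Ww; have Ewu := Eu Ww.
have hT : (h w)^T = h w by rewrite trmx_inv gmxT.
have hs i j : h w i j = h w j i by move: (h w) hT => X XT; rewrite -{1}XT mxE.
have -> : \sum_i \sum_j h w i j * Ub k w i j = \tr (Ub k w *m h w).
  apply: eq_bigr => i _; rewrite mxE; apply: eq_bigr => j _.
  by rewrite hs mulrC.
have [_ hE] := inv_sym_part (erefl (g w)) (erefl (al w)) Ewu (gu Ww).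
rewrite {1}hE -scalemxAr mxtraceZ mulmxBr raddfB /= mulrBr; congr (_ * _ - _ * _).
  have ET : (E w)^T = B w *m (C w)^T *m (A w)^T by rewrite /Emx !trmx_mul trmxK mulmxA.
  rewrite /Ubmx ET trace_log_part -?ET ?unitmx_tr //; congr (_ + _).
  by rewrite -mxtrace_tr trmx_mul trmxK trmx_inv trmxK mxtrace_mulC.
by rewrite !mulmxA mxtrace_mulC !mulmxA.
Qed.

(** d_i al_jk differs from (U_i - Ub_i)_jk by (U_k - Ub_k)_ij, whose trace is by
    traceE and traceEb a sum of logarithmic derivatives up to terms linear in
    al. Those of det C cancel against the derivative of psi, which is the
    reason for the drift term of the flow. *)
Lemma mu_formula k w : W w -> S w ->
  L w itime (ispace k) = \sum_i \sum_j h w i j * dmx (ispace i) al w j k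
    + 2^-1 * kap k w + \tr (lin_coef k w *m al w).
Proof.
move=> Ww Sw; rewrite (Hflow k Ww Sw).
have dal i j : dmx (ispace i) al w j k = U i w j k - Ub i w j k - (U k w i j - Ub k w i j).
  have CE1 := CkMx_leq (isT : (1 <= 2)%N) CE.
  have -> : dmx (ispace i) al w = dmx (ispace i) E w - (dmx (ispace i) E w)^T.
    by rewrite -dmxT; exact (dmxB (ispace i) CE1 (CkMxT oW CE1) Ww).
  rewrite (dEmx oO oW Cc Cf fWO i Ww).
  have e1 : Ub k w i j = Ub i w k j := Ubmx_sym oO oW Cc Cf fWO k i j Ww.
  have e2 : U k w i j = U i w k j := Umx_sym oO oW Cc Cf fWO k i j Ww.
  have sk (X Y : 'M[R]_n) a b :
      (X + Y^T - (X + Y^T)^T) a b = X a b - Y a b - (X b a - Y b a).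
    by rewrite !mxE; ring.
  apply: etrans (sk _ _ _ _) _.
  by apply: (congr2 (fun a b => _ - (a - b))); [exact: (esym e2)|exact: (esym e1)].
have -> : \sum_i \sum_j h w i j * (U i w j k - Ub i w j k) =
   \sum_i \sum_j h w i j * dmx (ispace i) al w j k
   + (\sum_i \sum_j h w i j * U k w i j - \sum_i \sum_j h w i j * Ub k w i j).
  rewrite -sumrB -big_split /=; apply: eq_bigr => i _.
  rewrite -sumrB -big_split /=; apply: eq_bigr => j _.
  by rewrite dal -mulrBr -mulrDr subrK.
rewrite (traceE k Ww) (traceEb k Ww).
have -> : \tr (lin_coef k w *m al w) = \sum_m tau w 0 m * al w m k
    + 2^-1 * \tr (h w *m U k w *m invmx (E w) *m al w)
    + 2^-1 * \tr (h w *m Ub k w *m invmx (E w)^T *m al w).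
  rewrite /lin_coef !mulmxDl !mxtraceD -!scalemxAl !mxtraceZ; congr (_ + _ + _).
  rewrite -mulmxA mxtrace_mulC -colE /mxtrace big_ord1.
  by rewrite [LHS]mxE [LHS]mxE.
have aux (a1 a2 a3 a4 a5 a6 a7 a8 a9 : R) :
  a1 + (2^-1 * (a2 + a3) + 2^-1 * a4 - (2^-1 * (a5 + a6) - 2^-1 * a7))
  + 2^-1 * (a8 - a3 + a6) + a9 =
  a1 + 2^-1 * (a2 - a5 + a8) + (a9 + 2^-1 * a4 + 2^-1 * a7) by field.
exact: aux.
Qed.

Let Cdal i : CkMx W 1 (dmx (ispace i) al).
Proof. exact (CkMx_partial oW (ispace i) Cal). Qed.

Let Cal1 : CkMx W 1 al. Proof. exact (CkMx_leq (isT : (1 <= 2)%N) Cal). Qed.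

(** d_i of the linear terms of mu_k. *)
Definition dlin i k w : R := \tr (dmx (ispace i) (lin_coef k) w *m al w)
  + \tr (lin_coef k w *m dmx (ispace i) al w).

Lemma partial_mu i l w : W w -> S w ->
  partial (ispace i) (fun y => L y itime (ispace l)) w =
  \sum_p \sum_q h w p q * dmx (ispace i) (dmx (ispace p) al) w q l
  + (\sum_p \sum_q dmx (ispace i) (fun w => h w) w p q * dmx (ispace p) al w q l
     + dlin i l w) + 2^-1 * partial (ispace i) (kap l) w.
Proof.
move=> Ww Sw.
rewrite (@eq_partial_slice i _ (fun y => \sum_p \sum_q h y p q * dmx (ispace p) al y q l
    + 2^-1 * kap l y + \tr (lin_coef l y *m al y)) w Ww Sw); last first.
  by move=> y Wy Sy; exact: mu_formula.
have Cpq p q : Ck 1 W (fun y => h y p q * dmx (ispace p) al y q l).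
  by have H := CkM oW (Ch1 p q) (Cdal p q l); exact: H.
have Cp p : Ck 1 W (fun y => \sum_q h y p q * dmx (ispace p) al y q l).
  by have H := Ck_sum oW (index_enum _) (fun q (_ : xpredT q) => Cpq p q); exact: H.
have Cs : Ck 1 W (fun y => \sum_p \sum_q h y p q * dmx (ispace p) al y q l).
  by have H := Ck_sum oW (index_enum _) (fun p (_ : xpredT p) => Cp p); exact: H.
have C2 : Ck 1 W (fun _ => 2^-1 : R) by exact: Ck_cst.
have Ck' := CkM oW C2 (Ck_kap l).
have Ct := Ck_tr oW (CkMxM oW (CkMx_lin_coef l) Cal1).
apply: etrans (partialD (ispace i) (CkD oW Cs Ck') Ct Ww) _.
rewrite (partialD (ispace i) Cs Ck' Ww).
have -> : partial (ispace i) (fun y => 2^-1 * kap l y) w = 2^-1 * partial (ispace i) (kap l) w.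
  by apply: etrans (partialM (ispace i) C2 (Ck_kap l) Ww) _; rewrite partial_cst mul0r add0r.
have -> : partial (ispace i) (fun y => \tr (lin_coef l y *m al y)) w = dlin i l w.
  apply: etrans (partial_tr (ispace i) (CkMxM oW (CkMx_lin_coef l) Cal1) Ww) _.
  by rewrite (dmxM oW (ispace i) (CkMx_lin_coef l) Cal1 Ww) mxtraceD.
have -> : partial (ispace i) (fun y => \sum_p \sum_q h y p q * dmx (ispace p) al y q l) w =
   \sum_p \sum_q dmx (ispace i) (fun w => h w) w p q * dmx (ispace p) al w q l
   + \sum_p \sum_q h w p q * dmx (ispace i) (dmx (ispace p) al) w q l.
  apply: etrans (partial_sum (ispace i) (index_enum _) (fun p (_ : xpredT p) => Cp p) Ww) _.
  rewrite -big_split /=; apply: eq_bigr => p _.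
  apply: etrans (partial_sum (ispace i) (index_enum _) (fun q (_ : xpredT q) => Cpq p q) Ww) _.
  rewrite -big_split /=; apply: eq_bigr => q _.
  apply: etrans (partialM (ispace i) (Ch1 p q) (Cdal p q l) Ww) _.
  by apply: (congr2 (fun a b => a * _ + _ * b)); rewrite dmxE.
have aux (a b d e : R) : a + b + d + e = b + (a + e) + d by ring.
exact: aux.
Qed.

(** What remains of the exterior derivative of mu once its second order part and
    the closed form kap are taken away. *)
Definition rem i l w : R :=
  \sum_p \sum_q dmx (ispace i) (fun w => h w) w p q * dmx (ispace p) al w q l + dlin i l w
  - (\sum_p \sum_q dmx (ispace l) (fun w => h w) w p q * dmx (ispace p) al w q i + dlin l i w).

(** d al = 0, differentiated once. It turns the exterior derivative of the
    divergence of al into a Laplacian. *)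
Lemma d2al_closed p q i l w : W w ->
  dmx (ispace i) (dmx (ispace p) al) w q l - dmx (ispace l) (dmx (ispace p) al) w q i =
  dmx (ispace p) (dmx (ispace q) al) w i l.
Proof.
move=> Ww.
have e a b k l' : dmx (ispace a) (dmx (ispace b) al) w k l' =
    partial (ispace a) (partial (ispace b) (fun y => L y (ispace k) (ispace l'))) w.
  rewrite [LHS]dmxE; apply: (congr1 (fun F => partial (ispace a) F w)); apply/funext => y.
  rewrite [LHS]dmxE; apply: (congr1 (fun F => partial (ispace b) F y)); apply/funext => z.
  exact: omx_Lam.
have CL := CkMx_Lam oO oW Cc Cf fWO.
have CL1 a k l' : Ck 1 W (partial (ispace a) (fun y => L y (ispace k) (ispace l'))).
  exact (Ck_partial (ispace a) (CL (ispace k) (ispace l'))).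
have Z : partial (ispace p) (fun y => partial (ispace i) (fun y => L y (ispace q) (ispace l)) y
    + partial (ispace q) (fun y => L y (ispace l) (ispace i)) y
    + partial (ispace l) (fun y => L y (ispace i) (ispace q)) y) w = 0.
  apply: etrans _ (partial_cst (ispace p) (0 : R) w); apply: (eq_partial _ oW Ww) => y Wy.
  exact: (Lam_closed oO oW Cc Cf fWO (ispace i) (ispace q) (ispace l) Wy).
have Z1 := partialD (ispace p) (CkD oW (CL1 i q l) (CL1 q l i)) (CL1 l i q) Ww.
have Z2 := partialD (ispace p) (CL1 i q l) (CL1 q l i) Ww.
have N a k l' : partial (ispace p) (partial (ispace a) (fun y => L y (ispace k) (ispace l'))) w =
   - partial (ispace p) (partial (ispace a) (fun y => L y (ispace l') (ispace k))) w.
  have -> : (fun y => L y (ispace k) (ispace l')) = (fun y => - L y (ispace l') (ispace k)).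
    by apply/funext => y; exact: Lam_skew.
  apply: etrans (_ : partial (ispace p) (fun y => - partial (ispace a) (fun y => L y (ispace l') (ispace k)) y) w = _).
    apply: (eq_partial _ oW Ww) => y Wy.
    exact: (partialN (ispace a) (Ck_pred (CL (ispace l') (ispace k))) Wy).
  exact: (partialN (ispace p) (CL1 a l' k) Ww).
have s1 := schwarz oW (ispace i) (ispace p) (CL (ispace q) (ispace l)) Ww.
have s2 := schwarz oW (ispace l) (ispace p) (CL (ispace q) (ispace i)) Ww.
have A1 := cyclic_sum0 Z Z1 Z2.
apply: etrans (congr2 (fun a b => a - b) (etrans (e _ _ _ _) s1)
  (etrans (etrans (e _ _ _ _) s2) (N l q i))) _.
apply: etrans A1 _; apply: etrans (esym (N q i l)) _; exact: (esym (e _ _ _ _)).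
Qed.

(** Cartan's formula d_t al = d mu, read off from Lam_closed. *)
Lemma omx_evolution i l w : W w -> S w ->
  (dmx itime al w - \sum_p \sum_q h w p q *: dmx (ispace p) (dmx (ispace q) al) w) i l
  = rem i l w.
Proof.
move=> Ww Sw.
have subE (X Y : 'M[R]_n) a b : (X - Y) a b = X a b - Y a b by rewrite !mxE.
apply: etrans (subE _ _ _ _) _.
have -> : (\sum_p \sum_q h w p q *: dmx (ispace p) (dmx (ispace q) al) w) i l =
  \sum_p \sum_q h w p q * dmx (ispace i) (dmx (ispace p) al) w q l
  - \sum_p \sum_q h w p q * dmx (ispace l) (dmx (ispace p) al) w q i.
  rewrite summxE -sumrB; apply: eq_bigr => p _; rewrite summxE -sumrB; apply: eq_bigr => q _.
  by rewrite [LHS]mxE -mulrBr (d2al_closed p q i l Ww).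
have -> : dmx itime al w i l = partial (ispace i) (fun y => L y itime (ispace l)) w
   - partial (ispace l) (fun y => L y itime (ispace i)) w.
  have Cl := Lam_closed oO oW Cc Cf fWO (ispace i) (ispace l) itime Ww.
  have -> : dmx itime al w i l = partial itime (fun y => L y (ispace i) (ispace l)) w.
    rewrite [LHS]dmxE; apply: (congr1 (fun F => partial itime F w)); apply/funext => y.
    exact: omx_Lam.
  have -> : partial (ispace i) (fun y => L y itime (ispace l)) w =
      - partial (ispace i) (fun y => L y (ispace l) itime) w.
    have CL := CkMx_leq (isT : (1 <= 2)%N) (CkMx_Lam oO oW Cc Cf fWO).
    apply: etrans _ (partialN (ispace i) (CL (ispace l) itime) Ww).
    apply: (congr1 (fun F => partial (ispace i) F w)); apply/funext => y.
    exact: Lam_skew.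
  have aux (a b d : R) : a + b + d = 0 -> d = - a - b by lra.
  exact: (aux _ _ _ Cl).
rewrite (partial_mu i l Ww Sw) (partial_mu l i Ww Sw) (kap_closed i l Ww) /rem.
have aux (a b d a' b' : R) : a + b + d - (a' + b' + d) - (a - a') = b - b' by ring.
exact: aux.
Qed.

Variables (K D : set 'rV[R]_(n + 1)).
Hypotheses (cK : compact K) (KW : K `<=` W) (DK : D `<=` K) (DS : D `<=` S).
Hypothesis gpos : forall w, D w -> posdef (g w).

Local Notation s01 := (jet_size (@ispace n) al).

Let s01_ge0 w : 0 <= s01 w. Proof. exact: jet_size_ge0. Qed.
Let dom_al : domd D s01 al. Proof. exact: domd_jet0. Qed.
Let dom_dal p : domd D s01 (dmx (ispace p) al). Proof. exact: domd_jet1. Qed.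

Let dom1 (phi : 'rV[R]_(n + 1) -> R) F : domf D (fun w => 1 * phi w) F -> domf D phi F.
Proof. by apply: domf_le => w _; rewrite mul1r. Qed.

Let dom_dlin i k : domf D s01 (dlin i k).
Proof.
apply: domfD; apply: dom1; apply: domf_tr.
  apply: domdM dom_al; apply: (CkMx_bounded oW cK KW DK).
  exact (CkMx_partial oW (ispace i) (CkMx_lin_coef k)).
apply: domdM (dom_dal i); apply: (CkMx_bounded oW cK KW DK).
exact (CkMx_leq (isT : (0 <= 1)%N) (CkMx_lin_coef k)).
Qed.

Let dom_half i l : domf D s01 (fun w =>
  \sum_p \sum_q dmx (ispace i) (fun w => h w) w p q * dmx (ispace p) al w q l + dlin i l w).
Proof.
apply: domfD; last exact: dom_dlin.
apply: domf_sum => // p; apply: domf_sum => // q.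
apply: dom1; apply: domfM; last exact: (domd_entry q l (dom_dal p)).
apply: (domd_entry p q); apply: (CkMx_bounded oW cK KW DK).
exact (CkMx_partial oW (ispace i) Ch1).
Qed.

Lemma local_evolution : exists M : R, forall w, D w ->
  partial itime (norm_sq g al) w <=
  \sum_p \sum_q h w p q * partial (ispace p) (partial (ispace q) (norm_sq g al)) w
  + M * norm_sq g al w.
Proof.
apply: (evolution_inequality oW cK KW DK Cg Cal gu (gmxT c f) (omxT c f) gpos).
have rdom i l : domf D s01 (rem i l) by apply: domfD => //; exact: domfN.
have [B1 B1_ge0 HB1] : exists2 B1 : R, 0 <= B1 &
    forall w, D w -> forall i l, `|rem i l w| <= B1 * s01 w.
  have H i l : {B0 : R | 0 <= B0 /\ forall w, D w -> `|rem i l w| <= B0 * s01 w}.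
    by apply: cid; have [B0 b0 Hb] := rdom i l; exists B0.
  have nn i l : 0 <= sval (H i l) by case: (svalP (H i l)).
  exists (\sum_i \sum_l sval (H i l)).
    by apply: sumr_ge0 => i _; apply: sumr_ge0 => l _.
  move=> w Dw i l; apply: (@le_trans _ _ (sval (H i l) * s01 w)).
    by case: (svalP (H i l)) => _; apply.
  apply: ler_wpM2r; first exact: s01_ge0.
  exact: (le_sum_entry i l nn).
exists B1 => // w Dw i l.
by rewrite (omx_evolution i l (KW (DK Dw)) (DS Dw)); exact: HB1.
Qed.

End LocalEvolution.

(** * The flow equation in product coordinates *)

Section Slices.
Variables (R : realType) (n : nat).
Local Opaque Ck partial dmx.

Definition slice (s : R) (u : 'rV[R]_n) : 'rV[R]_(n + 1) := row_mx u s%:M.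

Lemma slice_shift i (e s : R) (u : 'rV[R]_n) :
  slice s (e *: delta_mx 0 i + u) = e *: delta_mx 0 (ispace i) + slice s u.
Proof.
have addE (X Y : 'rV[R]_(n + 1)) j : (X + Y) 0 j = X 0 j + Y 0 j by rewrite mxE.
apply/rowP => j; rewrite addE; case: (split_ordP j) => k ->.
  rewrite !row_mxEl !mxE /ispace eqxx /=.
  by rewrite (inj_eq (@lshift_inj _ _)).
rewrite !row_mxEr !mxE /ispace eqxx /=.
by rewrite eq_rlshift mulr0 add0r.
Qed.

Lemma partial_slice i (F : 'rV[R]_(n + 1) -> R) s u :
  partial i (fun y => F (slice s y)) u = partial (ispace i) F (slice s u).
Proof.
apply: etrans (derive_line _ _ _) _; apply: etrans _ (esym (derive_line _ _ _)).
apply: (congr1 (fun K : R -> R => 'D_1 K (0 : R))); apply/funext => e.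
exact: (congr1 F (slice_shift _ _ _ _)).
Qed.

End Slices.

(** The arithmetic of npsiK, kept apart from its large terms. *)
Lemma weighted_difference (R : realType) (SA SB S TL TR m q d x1 x2 x3 x4 : R) :
  SA = q * (x1 - x3) -> SB = q * (x2 - x4) -> S = x1 - x2 -> TL = x3 -> TR = x4 ->
  m * q = d -> m * (SA - SB) = d * (S - TL + TR).
Proof. by move=> -> -> -> -> -> <-; ring. Qed.

Section FlowIdentity.
Variables (R : realType) (n : nat).
Variables (O : set 'rV[R]_(n + n)) (W : set 'rV[R]_(n + 1)).
Hypotheses (oO : open O) (oW : open W).
Variables (c : 'rV[R]_(n + n) -> R) (f : 'rV[R]_(n + 1) -> 'rV[R]_(n + n)).
Hypothesis Cc : Ck 4 O c.
Hypothesis Cf : forall k j, Ck k W (fun w => f w 0 j).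
Hypothesis fWO : forall w, W w -> O (f w).
Local Opaque Ck partial dmx.

Local Notation A := (Amx f).
Local Notation B := (Bmx f).
Local Notation C := (Cfm c f).
Local Notation E := (Emx c f).
Local Notation g := (gmx c f).
Local Notation al := (omx c f).
Local Notation U := (Umx c f).
Local Notation Ub := (Ubmx c f).
Local Notation L := (Lam c f).
Local Notation FF := (Ffull c f).
Local Notation h w := (invmx (g w)).

Variable G : 'rV[R]_(n + n) -> 'M[R]_(n + n).
Hypothesis GE : forall z, O z -> G z = block_mx 0 (Cmx c z) (Cmx c z)^T 0.

Let Gul z a b : O z -> G z (lshift n a) (lshift n b) = 0.
Proof. by move=> Oz; rewrite GE // block_mxEul mxE. Qed.
Let Gdr z a b : O z -> G z (rshift n a) (rshift n b) = 0.
Proof. by move=> Oz; rewrite GE // block_mxEdr mxE. Qed.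
Let Gur z a b : O z -> G z (lshift n a) (rshift n b) = Cmx c z a b.
Proof. by move=> Oz; rewrite GE // block_mxEur. Qed.
Let Gdl z a b : O z -> G z (rshift n a) (lshift n b) = Cmx c z b a.
Proof. by move=> Oz; rewrite GE // block_mxEdl mxE. Qed.

Let pGul P z a b : O z -> partial P (fun y => G y (lshift n a) (lshift n b)) z = 0.
Proof.
move=> Oz; apply: etrans _ (partial_cst P (0 : R) z).
by apply: (eq_partial P oO Oz) => y Oy; exact: Gul.
Qed.
Let pGdr P z a b : O z -> partial P (fun y => G y (rshift n a) (rshift n b)) z = 0.
Proof.
move=> Oz; apply: etrans _ (partial_cst P (0 : R) z).
by apply: (eq_partial P oO Oz) => y Oy; exact: Gdr.
Qed.
Let pGur P z a b : O z ->
  partial P (fun y => G y (lshift n a) (rshift n b)) z = dmx P (Cmx c) z a b.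
Proof.
move=> Oz; apply: etrans _ (esym (dmxE _ _ _ _ _)).
by apply: (eq_partial P oO Oz) => y Oy; exact: Gur.
Qed.
Let pGdl P z a b : O z ->
  partial P (fun y => G y (rshift n a) (lshift n b)) z = dmx P (Cmx c) z b a.
Proof.
move=> Oz; apply: etrans _ (esym (dmxE _ _ _ _ _)).
by apply: (eq_partial P oO Oz) => y Oy; exact: Gdl.
Qed.

(** Christoffel symbols with the upper index lowered. *)
Let low z P Q r := 2^-1 * (partial P (fun y => G y Q r) z + partial Q (fun y => G y P r) z
  - partial r (fun y => G y P Q) z).

Let low_eq (x y z a : R) : x = a -> y = a -> z = 0 -> 2^-1 * (x + y - z) = a.
Proof. by move=> -> -> ->; field. Qed.

Let low_eq0l (x y z a : R) : x = 0 -> y = a -> z = a -> 2^-1 * (x + y - z) = 0.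
Proof. by move=> -> -> ->; rewrite add0r subrr mulr0. Qed.

Let low_eq0r (x y z a : R) : x = a -> y = 0 -> z = a -> 2^-1 * (x + y - z) = 0.
Proof. by move=> -> -> ->; rewrite addr0 subrr mulr0. Qed.

(** As h is para-Kaehler, a lowered Christoffel symbol survives only when its
    first two indices belong to one factor and the last one to the other. The
    others vanish by the symmetries of the third derivatives of c. *)
Lemma low_llr z a b s : O z ->
  low z (lshift n a) (lshift n b) (rshift n s) = dmx (lshift n a) (Cmx c) z b s.
Proof.
move=> Oz; apply: low_eq; [exact: pGur|apply: etrans (pGur _ _ _ Oz) _|exact: pGul].
exact: (dCmx_syml oO Cc b a s Oz).
Qed.

Lemma low_rrl z a b s : O z ->
  low z (rshift n a) (rshift n b) (lshift n s) = dmx (rshift n a) (Cmx c) z s b.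
Proof.
move=> Oz; apply: low_eq; [exact: pGdl|apply: etrans (pGdl _ _ _ Oz) _|exact: pGdr].
exact: (dCmx_symr oO Cc b s a Oz).
Qed.

Lemma low_lll z a b s : O z -> low z (lshift n a) (lshift n b) (lshift n s) = 0.
Proof. by move=> Oz; apply: low_eq0l; exact: pGul. Qed.
Lemma low_rrr z a b s : O z -> low z (rshift n a) (rshift n b) (rshift n s) = 0.
Proof. by move=> Oz; apply: low_eq0l; exact: pGdr. Qed.
Lemma low_lrr z a b s : O z -> low z (lshift n a) (rshift n b) (rshift n s) = 0.
Proof.
move=> Oz; apply: low_eq0l; [exact: pGdr|exact: pGur|apply: etrans (pGur _ _ _ Oz) _].
exact: (dCmx_symr oO Cc s a b Oz).
Qed.
Lemma low_rlr z a b s : O z -> low z (rshift n a) (lshift n b) (rshift n s) = 0.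
Proof.
move=> Oz; apply: low_eq0r; [exact: pGur|exact: pGdr|apply: etrans (pGdl _ _ _ Oz) _].
exact: (dCmx_symr oO Cc s b a Oz).
Qed.
Lemma low_lrl z a b s : O z -> low z (lshift n a) (rshift n b) (lshift n s) = 0.
Proof.
move=> Oz; apply: low_eq0r; [exact: pGdl|exact: pGul|apply: etrans (pGur _ _ _ Oz) _].
exact: (dCmx_syml oO Cc s a b Oz).
Qed.
Lemma low_rll z a b s : O z -> low z (rshift n a) (lshift n b) (lshift n s) = 0.
Proof.
move=> Oz; apply: low_eq0l; [exact: pGul|exact: pGdl|apply: etrans (pGdl _ _ _ Oz) _].
exact: (dCmx_syml oO Cc s b a Oz).
Qed.

Variables (ft : 'rV[R]_n -> 'rV[R]_(n + n)) (s : R) (u : 'rV[R]_n).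
Local Notation w := (slice s u).
Hypothesis Ww : W w.
Hypothesis ftE : \forall y \near u, ft y = f (slice s y).
Hypothesis Gu : forall z, O z -> G z \in unitmx.

Let Ow : O (f w). Proof. exact: fWO. Qed.
Let ftu : ft u = f w. Proof. exact: (nbhs_singleton ftE). Qed.

Lemma jac_slice : jac ft u = row_mx (A w) (B w).
Proof.
have E i P : jac ft u i P = partial (ispace i) (fun w => f w 0 P) w.
  rewrite /jac mxE; apply: etrans _ (partial_slice i (fun w => f w 0 P) s u).
  by apply: near_partial; apply: filterS ftE => y ->.
apply/matrixP => i P; apply: etrans (E i P) _.
case: (split_ordP P) => a ->; [rewrite row_mxEl|rewrite row_mxEr].
  by rewrite /Amx mxE /jacl mxE.
by rewrite /Bmx mxE /jacr mxE.
Qed.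

Lemma partial2_slice i j P :
  partial i (partial j (fun y => ft y 0 P)) u =
  partial (ispace i) (partial (ispace j) (fun w => f w 0 P)) w.
Proof.
apply: etrans _ (partial_slice i (partial (ispace j) (fun w => f w 0 P)) s u).
apply: near_partial; apply: filterS (near_join ftE) => y yE.
apply: etrans _ (partial_slice j (fun w => f w 0 P) s y).
by apply: near_partial; apply: filterS yE => y' ->.
Qed.

Lemma cov_deriv_lowered i j :
  cov_deriv G ft u i j *m G (f w) =
  row_mx (row j (dmx (ispace i) B w *m (C w)^T + B w *m (dCr c f i w)^T))
         (row j (dmx (ispace i) A w *m C w + A w *m dCl c f i w)).
Proof.
have step P : (cov_deriv G ft u i j *m G (f w)) 0 P =
   \sum_Q partial (ispace i) (partial (ispace j) (fun w => f w 0 Q)) w * G (f w) Q P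
   + \sum_a \sum_b jac ft u i a * jac ft u j b * low (f w) a b P.
  rewrite mxE.
  have Gs Q : G (f w) Q P = G (f w) P Q.
    by rewrite (GE Ow); case: (split_ordP P) => p ->; case: (split_ordP Q) => q ->;
      rewrite ?block_mxEul ?block_mxEur ?block_mxEdl ?block_mxEdr !mxE.
  transitivity (\sum_Q (partial (ispace i) (partial (ispace j) (fun w => f w 0 Q)) w * G (f w) Q P
     + \sum_a \sum_b (jac ft u i a * jac ft u j b) * (G (f w) P Q * christoffel G (f w) a b Q))).
    apply: eq_bigr => Q _; rewrite /cov_deriv [X in X * _]mxE (partial2_slice i j Q) ftu mulrDl.
    congr (_ + _); rewrite mulr_suml; apply: eq_bigr => a _; rewrite mulr_suml.
    apply: eq_bigr => b _; rewrite -(Gs Q); ring.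
  rewrite big_split /=; congr (_ + _).
  rewrite exchange_big /=; apply: eq_bigr => a _.
  rewrite exchange_big /=; apply: eq_bigr => b _.
  by rewrite -mulr_sumr (christoffel_lower _ _ _ (Gu Ow)).
have dAE a : partial (ispace i) (partial (ispace j) (fun w => f w 0 (lshift n a))) w =
    dmx (ispace i) A w j a.
  rewrite dmxE; apply: (congr1 (fun F => partial (ispace i) F w)); apply/funext => y.
  by rewrite /Amx mxE /jacl mxE.
have dBE a : partial (ispace i) (partial (ispace j) (fun w => f w 0 (rshift n a))) w =
    dmx (ispace i) B w j a.
  rewrite dmxE; apply: (congr1 (fun F => partial (ispace i) F w)); apply/funext => y.
  by rewrite /Bmx mxE /jacr mxE.
have Jl k a : jac ft u k (lshift n a) = A w k a by rewrite jac_slice row_mxEl.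
have Jr k a : jac ft u k (rshift n a) = B w k a by rewrite jac_slice row_mxEr.
apply/rowP => P; apply: etrans (step P) _.
rewrite !big_split_ord /=.
have rowE (X Y : 'M[R]_n) k : row j (X + Y) 0 k = X j k + Y j k by rewrite !mxE.
case: (split_ordP P) => r ->.
  apply: etrans _ (esym (row_mxEl _ _ _ _)); apply: etrans _ (esym (rowE _ _ _)).
  rewrite big1 ?add0r; last by move=> a _; rewrite (Gul _ _ Ow) mulr0.
  congr (_ + _).
    rewrite [RHS]mxE; apply: eq_bigr => a _.
    by rewrite dBE (Gdl _ _ Ow) [(C w)^T _ _]mxE.
  rewrite big1 ?add0r; last first.
    move=> a _; rewrite big_split_ord /= !big1 ?addr0 // => b _.
      by rewrite (low_lrl _ _ _ Ow) mulr0.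
    by rewrite (low_lll _ _ _ Ow) mulr0.
  rewrite [RHS]mxE; transitivity (\sum_a \sum_b B w i a * B w j b * dmx (rshift n a) (Cmx c) (f w) r b).
    apply: eq_bigr => a _; rewrite big_split_ord /= big1 ?add0r.
      by apply: eq_bigr => b _; rewrite !Jr (low_rrl _ _ _ Ow).
    by move=> b _; rewrite (low_rll _ _ _ Ow) mulr0.
  rewrite exchange_big /=; apply: eq_bigr => b _.
  rewrite [(dCr c f i w)^T _ _]mxE /dCr summxE mulr_sumr; apply: eq_bigr => a _.
  by rewrite [X in _ = _ * X]mxE; rewrite mulrA [B w j b * _]mulrC.
apply: etrans _ (esym (row_mxEr _ _ _ _)); apply: etrans _ (esym (rowE _ _ _)).
rewrite [X in _ + X + _]big1 ?addr0; last by move=> a _; rewrite (Gdr _ _ Ow) mulr0.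
congr (_ + _).
  rewrite [RHS]mxE; apply: eq_bigr => a _.
  by rewrite dAE (Gur _ _ Ow).
rewrite [X in _ + X]big1 ?addr0; last first.
  move=> a _; rewrite big_split_ord /= !big1 ?addr0 // => b _.
    by rewrite (low_rrr _ _ _ Ow) mulr0.
  by rewrite (low_rlr _ _ _ Ow) mulr0.
rewrite [RHS]mxE; transitivity (\sum_a \sum_b A w i a * A w j b * dmx (lshift n a) (Cmx c) (f w) b r).
  apply: eq_bigr => a _; rewrite big_split_ord /= [X in _ + X]big1 ?addr0.
    by apply: eq_bigr => b _; rewrite !Jl (low_llr _ _ _ Ow).
  by move=> b _; rewrite (low_lrr _ _ _ Ow) mulr0.
rewrite exchange_big /=; apply: eq_bigr => b _.
rewrite /dCl summxE mulr_sumr; apply: eq_bigr => a _.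
by rewrite [X in _ = _ * X]mxE; rewrite mulrA [A w j b * _]mulrC.
Qed.

Let Jw := row_mx (A w) (B w).
Let Gw := G (f w).

Lemma row_G (x y : 'rV[R]_n) : row_mx x y *m Gw = row_mx (y *m (C w)^T) (x *m C w).
Proof. by rewrite /Gw (GE Ow) mul_row_block !mulmx0 add0r addr0. Qed.

Lemma row_K (x y : 'rV[R]_n) : row_mx x y *m Kmx R n = row_mx x (- y).
Proof. by rewrite /Kmx mul_row_block !mulmx0 addr0 add0r mulmx1 mulmxN mulmx1. Qed.

Lemma row_J (x y : 'rV[R]_n) : row_mx x y *m Jw^T = x *m (A w)^T + y *m (B w)^T.
Proof. by rewrite /Jw tr_row_mx mul_row_col. Qed.

Lemma induced_slice : induced_metric G ft u = g w.
Proof.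
rewrite /induced_metric jac_slice ftu (GE Ow) mul_row_block !mulmx0 add0r addr0 tr_row_mx mul_row_col.
by rewrite /gmx /Emx !trmx_mul trmxK mulmxA addrC.
Qed.

Lemma kahler_slice : Jw *m Kmx R n *m Gw *m Jw^T = al w.
Proof.
rewrite /Jw /Kmx mul_row_block /Gw (GE Ow) !mulmx0 addr0 add0r mulmx1 mulmxN mulmx1.
rewrite mul_row_block !mulmx0 addr0 add0r tr_row_mx mul_row_col.
by rewrite /omx /Emx !trmx_mul trmxK !mulNmx mulmxA addrC.
Qed.

(** This lemma and the next one express h (x, F_k) and omega (x, F_k) by the
    lowered vector x G. *)
Lemma h_contraction (x : 'rV[R]_(n + n)) (a b : 'rV[R]_n) : x *m Gw = row_mx a b ->
  x *m Gw *m Jw^T = a *m (A w)^T + b *m (B w)^T.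
Proof. by move=> ->; exact: row_J. Qed.

Lemma omega_contraction (x : 'rV[R]_(n + n)) (a b : 'rV[R]_n) : x *m Gw = row_mx a b ->
  x *m Kmx R n *m Gw *m Jw^T = b *m (B w)^T - a *m (A w)^T.
Proof.
have KG : Kmx R n *m Gw = - (Gw *m Kmx R n).
  rewrite /Gw (GE Ow) /Kmx !mulmx_block !mulmx0 !mul0mx !addr0 !add0r.
  rewrite !mulmx1 !mulmxN !mul1mx !mulNmx mulmx1 mul1mx opp_block_mx !oppr0 opprK.
  by [].
move=> xG; rewrite -[x *m _ *m Gw]mulmxA KG mulmxN mulmxA xG row_K mulNmx row_J.
by rewrite mulNmx opprB.
Qed.

Variables (r1 r2 pf : 'rV[R]_(n + n) -> R).
Hypothesis n_gt0 : (0 < n)%N.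
Hypotheses (Cr1 : Ck 2 O r1) (Cr2 : Ck 2 O r2) (Cpf : Ck 2 O pf).
Hypothesis r1_left : forall z a, O z -> partial (rshift n a) r1 z = 0.
Hypothesis r2_right : forall z a, O z -> partial (lshift n a) r2 z = 0.
Hypothesis det_pos : forall z, O z -> 0 < \det (2 *: Cmx c z).
Hypothesis pfE : forall z, O z ->
  pf z = (n.*2)%:R^-1 * (r1 z + r2 z - ln (\det (2 *: Cmx c z))).

Definition rho_diff w' := r1 (f w') - r2 (f w').

Lemma partial_pf P : partial P pf (f w) =
  (n.*2)%:R^-1 * (partial P r1 (f w) + partial P r2 (f w)
                  - \tr (dmx P (Cmx c) (f w) *m invmx (C w))).
Proof.
have C1 : Ck 1 O r1 by exact: Ck_pred.
have C2 : Ck 1 O r2 by exact: Ck_pred.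
have CC : CkMx O 1 (Cmx c) by exact: (CkMx_leq (isT : (1 <= 2)%N) (CkMx_Cmx oO Cc)).
have C2C : CkMx O 1 (fun z => 2 *: Cmx c z).
  by have H := CkMxZ oO (Ck_cst oO 1 (2 : R)) CC; exact: H.
have Cl : Ck 1 O (fun z => ln (\det (2 *: Cmx c z))).
  by have H := Ck_ln oO det_pos (Ck_det oO C2C); exact: H.
rewrite (eq_partial P oO Ow (fun y => @pfE y)).
have Cs := CkB oO (CkD oO C1 C2) Cl.
apply: etrans (partialM P (Ck_cst oO 1 _) Cs Ow) _; rewrite partial_cst mul0r add0r.
congr (_ * _); apply: etrans (partialB P (CkD oO C1 C2) Cl Ow) _.
rewrite (partialD P C1 C2 Ow) (partial_ln_det oO P C2C Ow (det_pos Ow)); congr (_ - _).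
have -> : dmx P (fun z => 2 *: Cmx c z) (f w) = 2 *: dmx P (Cmx c) (f w).
  apply/matrixP => a b; rewrite [LHS]dmxE [RHS]mxE dmxE.
  have -> : (fun y => (2 *: Cmx c y) a b) = (fun y => 2 * Cmx c y a b).
    by apply/funext => y; rewrite mxE.
  apply: etrans (partialM P (Ck_cst oO 1 _) (CC a b) Ow) _.
  by rewrite partial_cst mul0r add0r.
have Cu : Cmx c (f w) \in unitmx.
  have := det_pos Ow; rewrite detZ unitmxE unitfE => /lt0r_neq0.
  by rewrite mulf_eq0 negb_or => /andP[].
have -> : invmx (2 *: Cmx c (f w)) = 2^-1 *: invmx (Cmx c (f w)).
  by rewrite invmxZ // unitmxZ ?unitfE.
by rewrite -scalemxAr -scalemxAl scalerA mulVf // scale1r.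
Qed.

(** The left-hand side is n omega (grad psi, F_k) up to sign. As rho depends on x
    only and rhobar on xbar only, the sum of logarithms in psi turns into the
    difference rho_diff. *)
Lemma npsiK k :
  n%:R * (\sum_a A w k a * partial (lshift n a) pf (f w)
          - \sum_a B w k a * partial (rshift n a) pf (f w)) =
  2^-1 * (partial (ispace k) rho_diff w - \tr (dCl c f k w *m invmx (C w))
          + \tr (dCr c f k w *m invmx (C w))).
Proof.
have C1 : Ck 1 O r1 by exact: Ck_pred.
have C2 : Ck 1 O r2 by exact: Ck_pred.
have Jl a : partial (ispace k) (fun y => f y 0 (lshift n a)) w = A w k a.
  by rewrite /Amx mxE /jacl mxE.
have Jr a : partial (ispace k) (fun y => f y 0 (rshift n a)) w = B w k a.
  by rewrite /Bmx mxE /jacr mxE.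
have eR : partial (ispace k) rho_diff w =
   \sum_a A w k a * partial (lshift n a) r1 (f w) - \sum_a B w k a * partial (rshift n a) r2 (f w).
  have C1f := Ck_comp oW oO fWO (Cf 1) C1.
  have C2f := Ck_comp oW oO fWO (Cf 1) C2.
  apply: etrans (partialB (ispace k) C1f C2f Ww) _.
  apply: (congr2 (fun a b => a - b)).
    apply: etrans (partial_comp oO fWO (ispace k) (Cf 1) C1 Ww) _.
    rewrite big_split_ord /= [X in _ + X]big1 ?addr0; last first.
      by move=> a _; rewrite (r1_left _ Ow) mulr0.
    by apply: eq_bigr => a _; rewrite Jl.
  apply: etrans (partial_comp oO fWO (ispace k) (Cf 1) C2 Ww) _.
  rewrite big_split_ord /= [X in X + _]big1 ?add0r; last first.
    by move=> a _; rewrite (r2_right _ Ow) mulr0.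
  by apply: eq_bigr => a _; rewrite Jr.
have eL : \tr (dCl c f k w *m invmx (C w)) =
    \sum_a A w k a * \tr (dmx (lshift n a) (Cmx c) (f w) *m invmx (C w)).
  rewrite /dCl mulmx_suml raddf_sum /=; apply: eq_bigr => a _.
  by rewrite -scalemxAl mxtraceZ.
have eRr : \tr (dCr c f k w *m invmx (C w)) =
    \sum_a B w k a * \tr (dmx (rshift n a) (Cmx c) (f w) *m invmx (C w)).
  rewrite /dCr mulmx_suml raddf_sum /=; apply: eq_bigr => a _.
  by rewrite -scalemxAl mxtraceZ.
have eA : \sum_a A w k a * partial (lshift n a) pf (f w) = (n.*2)%:R^-1 *
    (\sum_a A w k a * partial (lshift n a) r1 (f w)
     - \sum_a A w k a * \tr (dmx (lshift n a) (Cmx c) (f w) *m invmx (C w))).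
  rewrite -sumrB mulr_sumr; apply: eq_bigr => a _.
  by rewrite partial_pf (r2_right _ Ow) addr0 -mulrBr mulrCA.
have eB : \sum_a B w k a * partial (rshift n a) pf (f w) = (n.*2)%:R^-1 *
    (\sum_a B w k a * partial (rshift n a) r2 (f w)
     - \sum_a B w k a * \tr (dmx (rshift n a) (Cmx c) (f w) *m invmx (C w))).
  rewrite -sumrB mulr_sumr; apply: eq_bigr => a _.
  by rewrite partial_pf (r1_left _ Ow) add0r -mulrBr mulrCA.
have nE : n%:R * (n.*2)%:R^-1 = 2^-1 :> R.
  have n0 : n%:R != 0 :> R by rewrite pnatr_eq0 -lt0n.
  by rewrite -mul2n natrM invfM mulrCA mulfV // mulr1.
exact: (weighted_difference eA eB eR eL eRr nE).
Qed.

(** The covector h (X, F_k) of X = d_t F - g^ij D_i F_j + n grad psi. The flow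
    makes X tangent, and then tau_vec consists of its components in the F_m. *)
Definition tau_cov w' : 'rV[R]_n :=
  \row_k (FF w' itime (ispace k) + FF w' (ispace k) itime
    - \sum_i \sum_j h w' i j * (U i w' j k + Ub i w' j k)
    + n%:R * partial (ispace k) (fun y => pf (f y)) w').
Definition tau_vec w' : 'rV[R]_n := tau_cov w' *m h w'.

(** X = d_t F - g^ij D_i F_j + n grad psi is tangent, X = tau^m F_m, and
    omega (X, F_k) = tau^m al_mk is the asserted identity. *)
Lemma flow_identity (v : 'rV[R]_(n + n)) k :
  v = \row_P partial itime (fun y => f y 0 P) w ->
  normal_part G ft u v =
    mean_curvature G ft u - n%:R *: normal_part G ft u (gradient G pf (ft u)) ->
  L w itime (ispace k) = \sum_i \sum_j h w i j * (U i w j k - Ub i w j k)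
    + 2^-1 * (partial (ispace k) rho_diff w - \tr (dCl c f k w *m invmx (C w))
              + \tr (dCr c f k w *m invmx (C w)))
    + \sum_m tau_vec w 0 m * al w m k.
Proof.
move=> vE flow.
pose M := Gw *m Jw^T *m h w *m Jw.
have NE x : normal_part G ft u x = x *m (1%:M - M).
  by rewrite /normal_part induced_slice jac_slice ftu -/Jw -/Gw mulmxBr mulmx1 !mulmxA.
pose dpf := \row_a partial a pf (f w).
pose D i j := cov_deriv G ft u i j.
pose X := v - \sum_i \sum_j h w i j *: D i j + n%:R *: (dpf *m invmx Gw).
have XM : X = X *m M.
  have : X *m (1%:M - M) = 0.
    have E1 : v *m (1%:M - M) = (\sum_i \sum_j h w i j *: D i j) *m (1%:M - M)
       - n%:R *: (dpf *m invmx Gw *m (1%:M - M)).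
      rewrite -!NE flow; congr (_ - _).
        rewrite /mean_curvature NE mulmx_suml; apply: eq_bigr => i _.
        rewrite mulmx_suml; apply: eq_bigr => j _.
        by rewrite induced_slice /second_fundamental NE scalemxAl.
      by rewrite /gradient ftu.
    have aux (a b : 'rV[R]_(n + n)) : a - b - a + b = 0 by rewrite addrAC subrK subrr.
    by rewrite /X mulmxDl mulmxBl E1 -scalemxAl; exact: aux.
  by rewrite mulmxBr mulmx1 => /eqP; rewrite subr_eq0 => /eqP.
have GwU : Gw \in unitmx by exact: (Gu Ow).
have DG i j := cov_deriv_lowered i j.
have vG : v *m Gw = row_mx (row itime (jacr f w) *m (C w)^T) (row itime (jacl f w) *m C w).
  rewrite -row_G; congr (_ *m _); rewrite vE; apply/rowP => P; rewrite mxE.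
  by case: (split_ordP P) => a ->; rewrite ?row_mxEl ?row_mxEr !mxE.
have pG : dpf *m invmx Gw *m Gw = row_mx (lsubmx dpf) (rsubmx dpf).
  by rewrite mulmxKV // hsubmxK.
have rowmul (x : 'rV[R]_n) (N : 'M[R]_n) k' : (x *m N^T) 0 k' = \sum_a N k' a * x 0 a.
  by rewrite mxE; apply: eq_bigr => a _; rewrite mxE mulrC.
have rowU (Y N : 'M[R]_n) j k' : (row j Y *m N) 0 k' = (Y *m N) j k'.
  by rewrite !rowE -mulmxA -rowE mxE.
have UE i j k' : (row j (dmx (ispace i) A w *m C w + A w *m dCl c f i w) *m (B w)^T) 0 k' = U i w j k'.
  by apply: etrans (rowU _ _ _ _) _; rewrite mulmxDl.
have UbE i j k' : (row j (dmx (ispace i) B w *m (C w)^T + B w *m (dCr c f i w)^T) *m (A w)^T) 0 k'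
    = Ub i w j k'.
  by apply: etrans (rowU _ _ _ _) _; rewrite mulmxDl.
have F1 k' : (row itime (jacl f w) *m C w *m (B w)^T) 0 k' = FF w itime (ispace k').
  rewrite /Ffull [RHS]mxE mxE; apply: eq_bigr => a _.
  rewrite -row_mul [X in X * _]mxE; congr (_ * _).
  by rewrite [LHS]mxE [RHS]mxE mxE.
have F2 k' : (row itime (jacr f w) *m (C w)^T *m (A w)^T) 0 k' = FF w (ispace k') itime.
  have -> : row itime (jacr f w) *m (C w)^T *m (A w)^T =
     (A w *m (C w *m (row itime (jacr f w))^T))^T by rewrite !trmx_mul trmxK.
  rewrite /Ffull -mulmxA [LHS]mxE mxE [RHS]mxE; apply: eq_bigr => a _.
  congr (_ * _); first by rewrite mxE.
  by rewrite [LHS]mxE [RHS]mxE; apply: eq_bigr => b _; rewrite !mxE.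
have omX : (X *m Kmx R n *m Gw *m Jw^T) 0 k =
   L w itime (ispace k) - \sum_i \sum_j h w i j * (U i w j k - Ub i w j k)
   - n%:R * (\sum_a A w k a * partial (lshift n a) pf (f w)
          - \sum_a B w k a * partial (rshift n a) pf (f w)).
  have lin (x y z : 'rV[R]_(n + n)) (N : 'M[R]_(n + n, n)) (a : R) :
     (x - y + a *: z) *m N = x *m N - y *m N + a *: (z *m N).
    by rewrite mulmxDl mulmxBl scalemxAl.
  rewrite /X -!mulmxA (lin v) !mulmxA (omega_contraction vG) (omega_contraction pG).
  have ent (x y z : 'rV[R]_n) (a : R) : (x - y + a *: z) 0 k = x 0 k - y 0 k + a * z 0 k.
    by rewrite !mxE.
  have ent2 (x y : 'rV[R]_n) k' : (x - y) 0 k' = x 0 k' - y 0 k' by rewrite !mxE.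
  apply: etrans (ent _ _ _ _) _; rewrite !ent2 F1 F2 !rowmul.
  have -> : L w itime (ispace k) = FF w itime (ispace k) - FF w (ispace k) itime.
    by rewrite /Lam; move: (FF w) => F0; rewrite !mxE.
  have -> : \sum_a B w k a * rsubmx dpf 0 a = \sum_a B w k a * partial (rshift n a) pf (f w).
    by apply: eq_bigr => a _; rewrite !mxE.
  have -> : \sum_a A w k a * lsubmx dpf 0 a = \sum_a A w k a * partial (lshift n a) pf (f w).
    by apply: eq_bigr => a _; rewrite !mxE.
  rewrite -[in X in _ = _ - X](opprB (\sum_a B w k a * _)) mulrN opprK; congr (_ - _ + _).
  rewrite !mulmx_suml summxE; apply: eq_bigr => i _.
  rewrite !mulmx_suml summxE; apply: eq_bigr => j _.
  rewrite -!scalemxAl [LHS]mxE; congr (_ * _).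
  by rewrite (omega_contraction (DG i j)) ent2 UE UbE.
have hX k' : (X *m Gw *m Jw^T) 0 k' = tau_cov w 0 k'.
  have lin (x y z : 'rV[R]_(n + n)) (N : 'M[R]_(n + n)) (a : R) :
     (x - y + a *: z) *m N = x *m N - y *m N + a *: (z *m N).
    by rewrite mulmxDl mulmxBl scalemxAl.
  have lin' (x y z : 'rV[R]_(n + n)) (N : 'M[R]_(n + n, n)) (a : R) :
     (x - y + a *: z) *m N = x *m N - y *m N + a *: (z *m N).
    by rewrite mulmxDl mulmxBl scalemxAl.
  rewrite /X lin lin' (h_contraction vG) (h_contraction pG).
  have ent (x y z : 'rV[R]_n) (a : R) : (x - y + a *: z) 0 k' = x 0 k' - y 0 k' + a * z 0 k'.
    by rewrite !mxE.
  have ent2 (x y : 'rV[R]_n) : (x + y) 0 k' = x 0 k' + y 0 k' by rewrite !mxE.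
  apply: etrans (ent _ _ _ _) _; rewrite !ent2 F1 F2 !rowmul [RHS]mxE.
  congr (_ - _ + _ * _); first exact: addrC.
    rewrite !mulmx_suml summxE; apply: eq_bigr => i _.
    rewrite !mulmx_suml summxE; apply: eq_bigr => j _.
    rewrite -!scalemxAl [LHS]mxE; congr (_ * _).
    apply: etrans (congr1 (fun x : 'rV[R]_n => x 0 k') (h_contraction (DG i j))) _.
    apply: etrans (ent2 _ _) _; apply: etrans (addrC _ _) _.
    exact: (congr2 +%R (UE i j k') (UbE i j k')).
  rewrite (partial_comp oO fWO (ispace k') (Cf 1) (Ck_pred Cpf) Ww) big_split_ord /=.
  apply: (congr2 +%R); apply: eq_bigr => a _.
    by apply: (congr2 *%R); [rewrite /Amx mxE /jacl mxE|rewrite mxE mxE].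
  by apply: (congr2 *%R); [rewrite /Bmx mxE /jacr mxE|rewrite mxE mxE].
have key : X *m Kmx R n *m Gw *m Jw^T = tau_vec w *m al w.
  rewrite {1}XM /tau_vec -kahler_slice.
  have -> : tau_cov w = X *m Gw *m Jw^T by apply/rowP => k'; rewrite hX.
  by rewrite /M !mulmxA.
have := congr1 (fun x : 'rV[R]_n => x 0 k) key; rewrite omX npsiK [X in _ = X]mxE => <-.
have aux (a b d : R) : a = b + d + (a - b - d) by ring.
exact: aux.
Qed.

End FlowIdentity.

Section FlowRegularity.
Variables (R : realType) (n : nat).
Variables (O : set 'rV[R]_(n + n)) (W : set 'rV[R]_(n + 1)).
Hypotheses (oO : open O) (oW : open W).
Variables (c : 'rV[R]_(n + n) -> R) (f : 'rV[R]_(n + 1) -> 'rV[R]_(n + n)).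
Hypothesis Cc : Ck 4 O c.
Hypothesis Cf : forall k j, Ck k W (fun w => f w 0 j).
Hypothesis fWO : forall w, W w -> O (f w).
Hypothesis gu : forall w, W w -> gmx c f w \in unitmx.
Variables (r1 r2 pf : 'rV[R]_(n + n) -> R).
Hypotheses (Cr1 : Ck 2 O r1) (Cr2 : Ck 2 O r2) (Cpf : Ck 2 O pf).
Local Opaque Ck partial dmx.

Lemma Ck_rho_diff : Ck 2 W (rho_diff f r1 r2).
Proof.
have H := CkB oW (Ck_comp oW oO fWO (Cf 2) Cr1) (Ck_comp oW oO fWO (Cf 2) Cr2).
exact: H.
Qed.

Lemma CkMx_tau_vec : CkMx W 1 (tau_vec c f pf).
Proof.
have CF := CkMxM oW (CkMxM oW (CkMx_jacl oW Cf 1)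
  (CkMx_leq (isT : (1 <= 2)%N) (CkMx_Cfm oO oW Cc Cf fWO))) (CkMxT oW (CkMx_jacr oW Cf 1)).
have Ch := CkMx_inv oW gu (CkMx_leq (isT : (1 <= 2)%N) (CkMx_gmx oO oW Cc Cf fWO)).
have Ct : CkMx W 1 (tau_cov c f pf).
  move=> a k; pose T w := Ffull c f w itime (ispace k) + Ffull c f w (ispace k) itime
    - \sum_i \sum_j invmx (gmx c f w) i j * (Umx c f i w j k + Ubmx c f i w j k)
    + n%:R * partial (ispace k) (fun y => pf (f y)) w.
  have Cs i j : Ck 1 W (fun w => invmx (gmx c f w) i j * (Umx c f i w j k + Ubmx c f i w j k)).
    have H := CkM oW (Ch i j) (CkD oW (CkMx_Umx oO oW Cc Cf fWO i j k) (CkMx_Ubmx oO oW Cc Cf fWO i j k)).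
    exact: H.
  have Css := Ck_sum oW (index_enum _) (fun i (_ : xpredT i) =>
     Ck_sum oW (index_enum _) (fun j (_ : xpredT j) => Cs i j)).
  have Cp := CkM oW (Ck_cst oW 1 (n%:R : R)) (Ck_partial (ispace k) (Ck_comp oW oO fWO (Cf 2) Cpf)).
  have CT : Ck 1 W T.
    have H := CkD oW (CkB oW (CkD oW (CF itime (ispace k)) (CF (ispace k) itime)) Css) Cp.
    exact: H.
  by apply: (Ck_ext oW _ CT) => w _; rewrite /tau_cov mxE.
have H := CkMxM oW Ct Ch; exact: H.
Qed.

End FlowRegularity.

(** * Charts and local extensions in space-time *)

Section Locality.
Variables (R : realType).

Lemma Ck_local m k (U : set 'rV[R]_m) f : (forall x, U x -> exists V, [/\ open V, V x & Ck k (V `&` U) f]) ->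
  Ck k U f.
Proof.
elim: k f => [|k IH] f H; split=> //; try by [].
- move=> x Ux; have [V [_ Vx CV]] := H x Ux; exact: Ck_continuous CV (conj Vx Ux).
- move=> x Ux; have [V [_ Vx CV]] := H x Ux; exact: Ck_continuous CV (conj Vx Ux).
- move=> i; split=> [x Ux|].
    have [V [_ Vx CV]] := H x Ux; exact: Ck_derivable CV (conj Vx Ux).
  apply: IH => x Ux; have [V [oV Vx CV]] := H x Ux; exists V; split=> //.
  exact: Ck_partial.
Qed.

Lemma smooth_on_open m (U : set 'rV[R]_m) f k : open U -> smooth_on U f -> Ck k U f.
Proof.
move=> oU sf; apply: Ck_local => x Ux; have [V [g [oV Vx Cg fg]]] := sf x Ux.
exists V; split=> //; apply: (@Ck_ext _ _ _ _ g); first exact: openI.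
  by move=> y [Vy Uy]; rewrite fg.
by apply: Ck_sub (Cg k) => y [].
Qed.

Local Opaque Ck partial dmx.

Lemma near_jac n m (f g : 'rV[R]_n -> 'rV[R]_m) u :
  (\forall y \near u, f y = g y) -> jac f u = jac g u.
Proof.
move=> fg; apply/matrixP => i j; rewrite [LHS]mxE [RHS]mxE.
by apply: near_partial; apply: filterS fg => y ->.
Qed.

Lemma jac_comp n m p (O : set 'rV[R]_m) (f : 'rV[R]_n -> 'rV[R]_m) (g : 'rV[R]_m -> 'rV[R]_p) u :
  open O -> O (f u) -> (forall k, Ck 1 O (fun y => g y 0 k)) ->
  (forall i j, derivable (fun y => f y 0 j) u (delta_mx 0 i)) ->
  jac (fun y => g (f y)) u = jac f u *m jac g (f u).
Proof.
move=> oO Ou Cg df; apply/matrixP => i k; rewrite [LHS]mxE [RHS]mxE.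
have [_ H] := chain_rule oO Ou (Cg k) (df i).
apply: etrans H _; apply: eq_bigr => j _.
by apply: (congr2 *%R); rewrite [RHS]mxE.
Qed.

Lemma continuous_lsubmx n m : continuous (fun w : 'rV[R]_(n + m) => lsubmx w).
Proof.
move=> w; apply: continuous_coords => j.
have -> : (fun y : 'rV[R]_(n + m) => lsubmx y 0 j) = (fun y => y 0 (lshift m j)).
  by apply/funext => y; rewrite mxE.
exact: coord_continuous.
Qed.

Lemma continuous_rsubmx n m : continuous (fun w : 'rV[R]_(n + m) => rsubmx w).
Proof.
move=> w; apply: continuous_coords => j.
have -> : (fun y : 'rV[R]_(n + m) => rsubmx y 0 j) = (fun y => y 0 (rshift n j)).
  by apply/funext => y; rewrite mxE.
exact: coord_continuous.
Qed.

Lemma continuous_row_mx (T : topologicalType) n m (f : T -> 'rV[R]_n) (g : T -> 'rV[R]_m) x :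
  {for x, continuous f} -> {for x, continuous g} ->
  {for x, continuous (fun y => row_mx (f y) (g y))}.
Proof.
move=> cf cg; apply: continuous_coords => j; case: (split_ordP j) => k ->.
  have -> : (fun y => row_mx (f y) (g y) 0 (lshift m k)) = (fun y => f y 0 k).
    by apply/funext => y; rewrite row_mxEl.
  apply: (@continuous_comp _ _ _ f (fun v : 'rV[R]_n => v 0 k)) => //.
  exact: coord_continuous.
have -> : (fun y => row_mx (f y) (g y) 0 (rshift n k)) = (fun y => g y 0 k).
  by apply/funext => y; rewrite row_mxEr.
apply: (@continuous_comp _ _ _ g (fun v : 'rV[R]_m => v 0 k)) => //.
exact: coord_continuous.
Qed.

Lemma Ck_lsubmx n m (V : set 'rV[R]_(n + m)) k i : open V ->
  Ck k V (fun z : 'rV[R]_(n + m) => lsubmx z 0 i).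
Proof. by move=> oV; apply: (Ck_ext oV _ (Ck_coord oV k (lshift m i))) => z _; rewrite mxE. Qed.

Lemma Ck_rsubmx n m (V : set 'rV[R]_(n + m)) k i : open V ->
  Ck k V (fun z : 'rV[R]_(n + m) => rsubmx z 0 i).
Proof. by move=> oV; apply: (Ck_ext oV _ (Ck_coord oV k (rshift n i))) => z _; rewrite mxE. Qed.

Lemma partial_lsubmx n m (K : 'rV[R]_n -> R) z i :
  partial (rshift n i) (fun z : 'rV[R]_(n + m) => K (lsubmx z)) z = 0.
Proof.
apply: etrans (derive_line _ _ _) _.
have -> : (fun e : R => K (lsubmx (e *: delta_mx 0 (rshift n i) + z))) = (fun=> K (lsubmx z)).
  apply/funext => e; congr (K _); apply/rowP => j.
  by rewrite !mxE eqxx /= eq_lrshift mulr0 add0r.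
exact: derive_cst.
Qed.

Lemma partial_rsubmx n m (K : 'rV[R]_m -> R) z i :
  partial (lshift m i) (fun z : 'rV[R]_(n + m) => K (rsubmx z)) z = 0.
Proof.
apply: etrans (derive_line _ _ _) _.
have -> : (fun e : R => K (rsubmx (e *: delta_mx 0 (lshift m i) + z))) = (fun=> K (rsubmx z)).
  apply/funext => e; congr (K _); apply/rowP => j.
  by rewrite !mxE eqxx /= eq_rlshift mulr0 add0r.
exact: derive_cst.
Qed.

Definition timeof n (w : 'rV[R]_(n + 1)) : R := rsubmx w 0 0.

Lemma lsubmx_slice n t (u : 'rV[R]_n) : lsubmx (slice t u) = u.
Proof. by rewrite /slice row_mxKl. Qed.

Lemma timeof_slice n t (u : 'rV[R]_n) : timeof (slice t u) = t.
Proof. by rewrite /timeof /slice row_mxKr mxE eqxx. Qed.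

Lemma slice_timeof n (w : 'rV[R]_(n + 1)) : slice (timeof w) (lsubmx w) = w.
Proof.
rewrite /slice /timeof -[RHS]hsubmxK; congr (row_mx _ _).
by apply/rowP => j; rewrite !ord1 !mxE eqxx.
Qed.

Lemma continuous_timeof n : continuous (@timeof n).
Proof.
move=> w; have -> : @timeof n = (fun y : 'rV[R]_(n + 1) => y 0 (rshift n 0)).
  by apply/funext => y; rewrite /timeof mxE.
exact: coord_continuous.
Qed.

Lemma continuous_slice (T : topologicalType) n (f : T -> R) (g : T -> 'rV[R]_n) x :
  {for x, continuous f} -> {for x, continuous g} ->
  {for x, continuous (fun y => slice (f y) (g y))}.
Proof.
move=> cf cg; apply: continuous_row_mx => //; apply: continuous_coords => j.
have -> : (fun y => (f y)%:M 0 j) = f :> (T -> R).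
  by apply/funext => y; rewrite ord1 mxE eqxx.
exact: cf.
Qed.

End Locality.

Section Charts.
Variable R : realType.

Lemma cmapK (T : topologicalType) n (c : chart R T n) p :
  is_chart c -> dom c p -> cinv c (c p) = p.
Proof. by move=> [_ _ _ _]; apply. Qed.

Lemma img_cmap (T : Type) n (c : chart R T n) p : dom c p -> img c (c p).
Proof. by move=> dp; exists p. Qed.

Lemma img_cinv (T : topologicalType) n (c : chart R T n) x : is_chart c -> img c x ->
  dom c (cinv c x) /\ c (cinv c x) = x.
Proof. by move=> cc [p dp <-]; rewrite cmapK. Qed.

Lemma prod_chartK (S T : topologicalType) n m (a : chart R S n) (b : chart R T m) q :
  is_chart a -> is_chart b -> dom (prod_chart a b) q ->
  cinv (prod_chart a b) (prod_chart a b q) = q.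
Proof.
move=> ca cb [da db]; rewrite /= row_mxKl row_mxKr !cmapK //.
by case: q da db.
Qed.

Lemma prod_chart_open_dom (S T : topologicalType) n m (a : chart R S n) (b : chart R T m) :
  is_chart a -> is_chart b -> open (dom (prod_chart a b)).
Proof.
move=> [oa _ _ _ _] [ob _ _ _ _]; rewrite openE => -[q1 q2] [/= d1 d2].
by exists (dom a, dom b) => //; split; exact: open_nbhs_nbhs.
Qed.

Lemma prod_chart_img (S T : topologicalType) n m (a : chart R S n) (b : chart R T m)
    (U : set (S * T)) z : is_chart a -> is_chart b ->
  (cmap (prod_chart a b) @` (dom (prod_chart a b) `&` U)) z <->
  [/\ img a (lsubmx z), img b (rsubmx z) & U (cinv (prod_chart a b) z)].
Proof.
move=> ca cb; split.
  move=> [q [dq Uq] <-]; rewrite prod_chartK //; case: dq => d1 d2.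
  by split=> //=; rewrite ?row_mxKl ?row_mxKr; exact: img_cmap.
move=> [i1 i2 Uz]; exists (cinv (prod_chart a b) z).
  by split=> //; split; [case: (img_cinv ca i1)|case: (img_cinv cb i2)].
have [_ e1] := img_cinv ca i1; have [_ e2] := img_cinv cb i2.
by rewrite /= e1 e2 hsubmxK.
Qed.

Lemma prod_chart_open_img (S T : topologicalType) n m (a : chart R S n) (b : chart R T m)
    (U : set (S * T)) : is_chart a -> is_chart b -> open U ->
  open (cmap (prod_chart a b) @` (dom (prod_chart a b) `&` U)).
Proof.
move=> ca cb oU; rewrite openE => z zI.
have [i1 i2 Uz] := (prod_chart_img U z ca cb).1 zI.
have [_ oia _ cia _] := ca; have [_ oib _ cib _] := cb.
have n1 : \forall y \near z, img a (lsubmx y).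
  by apply: (@continuous_lsubmx R n m z); exact: open_nbhs_nbhs.
have n2 : \forall y \near z, img b (rsubmx y).
  by apply: (@continuous_rsubmx R n m z); exact: open_nbhs_nbhs.
have n3 : \forall y \near z, U (cinv (prod_chart a b) y).
  have c3 : {for z, continuous (cinv (prod_chart a b))}.
    have e1 : {for z, continuous (fun z : 'rV[R]_(n + m) => cinv a (lsubmx z))}.
      apply: (@continuous_comp _ _ _ (fun z : 'rV[R]_(n + m) => lsubmx z) (cinv a)).
        exact: continuous_lsubmx.
      exact: cia.
    have e2 : {for z, continuous (fun z : 'rV[R]_(n + m) => cinv b (rsubmx z))}.
      apply: (@continuous_comp _ _ _ (fun z : 'rV[R]_(n + m) => rsubmx z) (cinv b)).
        exact: continuous_rsubmx.
      exact: cib.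
    exact: (cvg_pair e1 e2).
  by apply: c3; exact: open_nbhs_nbhs.
apply: filterS (filterI n1 (filterI n2 n3)) => y [y1 [y2 y3]].
exact: ((prod_chart_img U y ca cb).2 (And3 y1 y2 y3)).
Qed.

End Charts.

Section LocalModel.
Variables (R : realType) (n : nat) (M Mb L : manifold R n).
Variables (X : KimMcCann M Mb) (Omega : para_nform M Mb).
Variables (t0 : R) (F : R -> L -> M * Mb).
Hypothesis F_smooth : smooth_family t0 F.
Hypothesis F_avoids_cut : forall t p, 0 <= t <= t0 -> ~ cut_locus X (F t p).
Local Opaque Ck partial dmx.
Local Notation pc a b := (prod_chart a b).

Let mchart (N : manifold R n) (a : chart R N n) : atlas a -> is_chart a.
Proof. exact: atlas_chart. Qed.

Lemma charts_at_ex t p : exists l a b, charts_at F t p l a b.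
Proof.
have [l al dl] := atlas_cover p.
have [a aa da] := atlas_cover (F t p).1.
have [b ab db] := atlas_cover (F t p).2.
by exists l, a, b; split.
Qed.

Lemma F_continuous_within (t : R) (p : L) : 0 <= t <= t0 ->
  (fun q : R * L => F q.1 q.2) @ within [set q : R * L | 0 <= q.1 <= t0] (nbhs (t, p)) --> F t p.
Proof.
move=> tI; have [cF _] := F_smooth.
by have := (@subspace_continuousP _ _ _ (fun q : R * L => F q.1 q.2)).1 cF (t, p) tI.
Qed.

(** smooth_on yields an extension of each component separately; here they get a
    common domain. The extension f lives past the ends of [0, t0], where F does
    not count. *)
Lemma local_extension t p l a b : 0 <= t <= t0 -> charts_at F t p l a b ->
  exists (W : set 'rV[R]_(n + 1)) (f : 'rV[R]_(n + 1) -> 'rV[R]_(n + n)),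
  [/\ open W, W (slice t (l p)), (forall k j, Ck k W (fun w => f w 0 j)) &
   forall w, W w -> 0 <= timeof w <= t0 ->
    [/\ img l (lsubmx w), dom (pc a b) (F (timeof w) (cinv l (lsubmx w)))
     & local_map F l a b (timeof w) (lsubmx w) = f w]].
Proof.
move=> tI [al aa ab dl dF].
have cl := mchart al; have ca := mchart aa; have cb := mchart ab.
have [_ sF] := F_smooth.
pose w0 := slice t (l p).
have w0D : [set w : 'rV[R]_(n + 1) | [/\ img l (lsubmx w), 0 <= rsubmx w 0 0 <= t0
    & dom (pc a b) (F (rsubmx w 0 0) (cinv l (lsubmx w)))]] w0.
  rewrite /= -/(timeof w0) timeof_slice lsubmx_slice cmapK //; split=> //; exact: img_cmap.
have H (j : 'I_(n + n)) : {Ug : set 'rV[R]_(n + 1) * ('rV[R]_(n + 1) -> R) |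
    [/\ open Ug.1, Ug.1 w0, (forall k, Ck k Ug.1 Ug.2) &
     forall y, [/\ img l (lsubmx y), 0 <= rsubmx y 0 0 <= t0
    & dom (pc a b) (F (rsubmx y 0 0) (cinv l (lsubmx y)))] -> Ug.1 y ->
    local_map F l a b (rsubmx y 0 0) (lsubmx y) 0 j = Ug.2 y]}.
  apply: cid; have [U [g [oU Uw Cg fg]]] := sF l a b al aa ab j w0 w0D.
  by exists (U, g).
pose Us j := (sval (H j)).1; pose gs j := (sval (H j)).2.
have oimg : open (img l) by have [] := cl.
have n1 : \forall w \near w0, img l (lsubmx w).
  apply: (@continuous_lsubmx R n 1 w0); apply: open_nbhs_nbhs; split=> //.
  by rewrite lsubmx_slice; exact: img_cmap.
have n2 : \forall w \near w0, 0 <= timeof w <= t0 -> dom (pc a b) (F (timeof w) (cinv l (lsubmx w))).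
  have odom := prod_chart_open_dom ca cb.
  have Fc := @F_continuous_within t p tI _ (open_nbhs_nbhs (conj odom dF)).
  have ct : {for w0, continuous (fun w : 'rV[R]_(n + 1) => cinv l (lsubmx w))}.
    apply: (@continuous_comp _ _ _ (fun z : 'rV[R]_(n + 1) => lsubmx z) (cinv l)).
      exact: continuous_lsubmx.
    have [_ _ _ cc _] := cl; apply: cc; rewrite lsubmx_slice; exact: img_cmap.
  have cpair : {for w0, continuous (fun w : 'rV[R]_(n + 1) => (timeof w, cinv l (lsubmx w)))}.
    exact: (cvg_pair (@continuous_timeof R n w0) ct).
  have : \forall q \near (timeof w0, cinv l (lsubmx w0)), 0 <= q.1 <= t0 -> dom (pc a b) (F q.1 q.2).
    by rewrite timeof_slice lsubmx_slice cmapK.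
  by move=> /cpair.
have n3 : \forall w \near w0, forall j, Us j w.
  apply: (@filter_forall _ _ _ (nbhs w0)) => j.
  by have [oU Uw _ _] := svalP (H j); exact: open_nbhs_nbhs.
have NW := nbhs_singleton (nbhs_interior (filterI n1 (filterI n2 n3))).
exists (interior [set w | img l (lsubmx w) /\ (0 <= timeof w <= t0 ->
   dom (pc a b) (F (timeof w) (cinv l (lsubmx w)))) /\ forall j, Us j w]),
  (fun w => \row_j gs j w); split.
- exact: open_interior.
- exact: NW.
- move=> k j; have [oU Uw Cg _] := svalP (H j).
  apply: (@Ck_ext _ _ _ _ (gs j)); first exact: open_interior.
    by move=> y _; rewrite mxE.
  by apply: Ck_sub (Cg k) => y /interior_subset[_ [_]]; exact.
move=> w /interior_subset[i1 [i2 i3]] wI; have d := i2 wI; split=> //.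
apply/rowP => j; have [_ _ _ fg] := svalP (H j).
by rewrite mxE; apply: fg => //; exact: i3.
Qed.

End LocalModel.

(** * The invariant norm of the restricted Kaehler form *)

(** The reason why the norm of a bilinear form does not depend on the chart. *)
Lemma form2_congr (R : realType) n (P g T S : 'M[R]_n) : P *m g *m P^T \in unitmx ->
  form2 (invmx (P *m g *m P^T)) (P *m T *m P^T) (P *m S *m P^T) = form2 (invmx g) T S.
Proof.
move=> u; have := u; rewrite !unitmx_mul unitmx_tr => /andP[/andP[Pu gu] _].
have Ptu : P^T \in unitmx by rewrite unitmx_tr.
have -> : invmx (P *m g *m P^T) = invmx P^T *m invmx g *m invmx P.
  rewrite -[LHS]mulmx1; apply: (canLR (mulKmx u)).
  rewrite !mulmxA mulmxK // mulmxK // mulmxV //.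
rewrite /form2 !trmx_mul trmxK -!mulmxA (mulmxA (invmx P) P) mulVmx // mul1mx.
rewrite (mulmxA P^T (invmx P^T)) mulmxV // mul1mx (mulmxA (invmx P) P) mulVmx // mul1mx.
by rewrite mxtrace_mulC -!mulmxA mulmxV // mulmx1.
Qed.

Lemma kahler_form_mx (R : realType) n (G : 'M[R]_(n + n)) (J : 'M[R]_(n, n + n)) i j :
  kahler_form G (row i J) (row j J) = (J *m Kmx R n *m G *m J^T) i j.
Proof.
rewrite /kahler_form /bilin !rowE trmx_mul trmx_delta.
have -> : (J *m Kmx R n *m G *m J^T) i j =
    ((delta_mx 0 i : 'rV_n) *m (J *m Kmx R n *m G *m J^T) *m (delta_mx j 0 : 'cV_n)) 0 0.
  by rewrite -rowE -colE [RHS]mxE [RHS]mxE.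
by rewrite !mulmxA.
Qed.

Lemma chart_open_img (R : realType) (T : topologicalType) n (a : chart R T n) (U : set T) :
  is_chart a -> open U -> open (cmap a @` (dom a `&` U)).
Proof.
move=> ca oU; rewrite openE => z [p [dp Up] zE].
have [oa oia _ cia _] := ca.
have zi : img a z by exists p.
have n1 : \forall y \near z, img a y by exact: open_nbhs_nbhs.
have n2 : \forall y \near z, U (cinv a y).
  by apply: (cia z zi); apply: open_nbhs_nbhs; split=> //; rewrite -zE cmapK.
apply: filterS (filterI n1 n2) => y [y1 y2].
by have [d e] := img_cinv ca y1; exists (cinv a y).
Qed.

Section Invariant.
Variables (R : realType) (n : nat) (M Mb L : manifold R n).
Variables (X : KimMcCann M Mb) (Omega : para_nform M Mb).
Variables (t0 : R) (F : R -> L -> M * Mb).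
Hypothesis F_smooth : smooth_family t0 F.
Hypothesis F_avoids_cut : forall t p, 0 <= t <= t0 -> ~ cut_locus X (F t p).
Hypothesis F_spacelike : forall t, 0 <= t <= t0 -> spacelike_at_time X F t.
Local Opaque Ck partial dmx.
Local Notation pc a b := (prod_chart a b).

Let mchart (N : manifold R n) (a : chart R N n) : atlas a -> is_chart a.
Proof. exact: atlas_chart. Qed.

Lemma local_map_Ck t p l a b : 0 <= t <= t0 -> charts_at F t p l a b ->
  exists V : set 'rV[R]_n, [/\ open V, V (l p),
    (forall k j, Ck k V (fun y => local_map F l a b t y 0 j)) &
    forall y, V y -> img l y /\ dom (pc a b) (F t (cinv l y))].
Proof.
move=> tI ch; have [W [f [oW Ww0 Cf H]]] := local_extension F_smooth tI ch.
have cs (y : 'rV[R]_n) : {for y, continuous (slice t)}.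
  apply: (@continuous_slice _ _ _ (fun=> t) id); [exact: cst_continuous|exact: id].
have oV : open (slice t @^-1` W).
  by rewrite openE => y Wy; apply: cs; exact: open_nbhs_nbhs.
have Cs k j : Ck k (slice t @^-1` W) (fun y => slice t y 0 j).
  case: (split_ordP j) => i ->.
    apply: (Ck_ext oV _ (Ck_coord oV k i)) => y _; by rewrite /slice row_mxEl.
  by apply: (Ck_ext oV _ (Ck_cst oV k t)) => y _; rewrite /slice row_mxEr ord1 mxE eqxx.
exists (slice t @^-1` W); split=> //.
  move=> k j; apply: (Ck_ext oV _ (Ck_comp oV oW (fun y (Wy : (slice t @^-1` W) y) => Wy) (Cs k) (Cf k j))).
  move=> y Wy; have := H _ Wy; rewrite timeof_slice lsubmx_slice => /(_ tI)[_ _ e].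
  by rewrite e.
by move=> y Wy; have := H _ Wy; rewrite timeof_slice lsubmx_slice => /(_ tI)[i1 i2 _].
Qed.

Definition gram a b t p := hmet X (pc a b) (F t p).
Definition jacF (l : chart R L n) a b t p := jac (local_map F l a b t) (l p).
Definition metric_mx l a b t p : 'M[R]_n :=
  jacF l a b t p *m gram a b t p *m (jacF l a b t p)^T.
Definition omega_mx l a b t p : 'M[R]_n :=
  jacF l a b t p *m Kmx R n *m gram a b t p *m (jacF l a b t p)^T.
Definition chart_norm l a b t p : R :=
  form2 (invmx (metric_mx l a b t p)) (omega_mx l a b t p) (omega_mx l a b t p).

Lemma local_metric_F t p l a b : charts_at F t p l a b ->
  local_metric X a b (local_map F l a b t (l p)) = gram a b t p.
Proof.
move=> [al aa ab dl dF]; rewrite /local_metric /local_map.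
rewrite (cmapK (mchart al) dl) prod_chartK //; exact: mchart.
Qed.

Lemma metric_mxE t p l a b : charts_at F t p l a b ->
  induced_metric (local_metric X a b) (local_map F l a b t) (l p) = metric_mx l a b t p.
Proof. by move=> ch; rewrite /induced_metric (local_metric_F ch). Qed.

Lemma metric_mx_pos t p l a b : 0 <= t <= t0 -> charts_at F t p l a b ->
  posdef (metric_mx l a b t p).
Proof. by move=> tI ch v v0; rewrite -(metric_mxE ch); exact: (F_spacelike tI ch). Qed.

Lemma transition_Ck (N : manifold R n) (a a' : chart R N n) k j : atlas a -> atlas a' ->
  Ck k (cmap a @` (dom a `&` dom a')) (fun x => transition a a' x 0 j).
Proof.
move=> aa aa'; apply: smooth_on_open; last exact: atlas_smooth.
by apply: chart_open_img; [exact: mchart|case: (mchart aa')].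
Qed.

Lemma prod_transition_Ck (a : chart R M n) (b : chart R Mb n) (a' : chart R M n)
    (b' : chart R Mb n) q : atlas a -> atlas b -> atlas a' -> atlas b' ->
  dom (pc a b) q -> dom (pc a' b') q -> exists O : set 'rV[R]_(n + n),
    [/\ open O, O (pc a b q) &
        forall k j, Ck k O (fun z => transition (pc a b) (pc a' b') z 0 j)].
Proof.
move=> aa ab aa' ab' [d1 d2] [d1' d2'].
pose Oa := cmap a @` (dom a `&` dom a'); pose Ob := cmap b @` (dom b `&` dom b').
have oOa : open Oa by apply: chart_open_img; [exact: mchart|case: (mchart aa')].
have oOb : open Ob by apply: chart_open_img; [exact: mchart|case: (mchart ab')].
pose O : set 'rV[R]_(n + n) := [set z | Oa (lsubmx z) /\ Ob (rsubmx z)].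
have oO : open O.
  rewrite openE => z [z1 z2]; apply: filterI.
    by apply: (@continuous_lsubmx R n n z); exact: open_nbhs_nbhs.
  by apply: (@continuous_rsubmx R n n z); exact: open_nbhs_nbhs.
exists O; split=> //.
  by split; [rewrite /= row_mxKl; exists q.1|rewrite /= row_mxKr; exists q.2].
move=> k j; case: (split_ordP j) => i ->.
  have H := Ck_comp oO oOa (fun z (Oz : O z) => Oz.1) (fun i => Ck_lsubmx k i oO) (transition_Ck k i aa aa').
  by apply: (Ck_ext oO _ H) => z _; rewrite /transition /= row_mxEl.
have H := Ck_comp oO oOb (fun z (Oz : O z) => Oz.2) (fun i => Ck_rsubmx k i oO) (transition_Ck k i ab ab').
by apply: (Ck_ext oO _ H) => z _; rewrite /transition /= row_mxEr.
Qed.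

(** Product charts change by products of maps, so the Jacobian is block
    diagonal. *)
Lemma prod_transition_K (a : chart R M n) (b : chart R Mb n) a' b' z :
  jac (transition (pc a b) (pc a' b')) z *m Kmx R n =
  Kmx R n *m jac (transition (pc a b) (pc a' b')) z.
Proof.
set T := jac _ _.
have T12 : ursubmx T = 0.
  apply/matrixP => i j; rewrite [LHS]mxE [LHS]mxE [LHS]mxE [RHS]mxE.
  apply: etrans _ (partial_rsubmx (fun u => b' (cinv b u) 0 j) z i).
  by congr (partial _ _ z); apply/funext => y; rewrite /transition /= row_mxEr.
have T21 : dlsubmx T = 0.
  apply/matrixP => i j; rewrite [LHS]mxE [LHS]mxE [LHS]mxE [RHS]mxE.
  apply: etrans _ (partial_lsubmx (fun u => a' (cinv a u) 0 j) z i).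
  by congr (partial _ _ z); apply/funext => y; rewrite /transition /= row_mxEl.
rewrite -(submxK T) T12 T21 /Kmx !mulmx_block !mulmx0 !mul0mx !addr0 !add0r.
by rewrite !mulmx1 !mul1mx mulmxN mulNmx mulmx1 mul1mx.
Qed.

Lemma chart_norm_invariant t p l a b l' a' b' : 0 <= t <= t0 ->
  charts_at F t p l a b -> charts_at F t p l' a' b' ->
  chart_norm l a b t p = chart_norm l' a' b' t p.
Proof.
move=> tI ch ch'; have [al aa ab dl dF] := ch; have [al' aa' ab' dl' dF'] := ch'.
have cl := mchart al; have cl' := mchart al'.
have [V [oV Vp CV HV]] := local_map_Ck tI ch.
have [V' [oV' Vp' CV' HV']] := local_map_Ck tI ch'.
have [Ot [oO Oz CT]] := prod_transition_Ck aa ab aa' ab' dF dF'.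
pose mixed y := pc a' b' (F t (cinv l y)).
pose T := jac (transition (pc a b) (pc a' b')) (pc a b (F t p)).
pose P := jac (transition l l') (l p).
have zE : local_map F l a b t (l p) = pc a b (F t p) by rewrite /local_map (cmapK cl dl).
have E1 : jac mixed (l p) = jacF l a b t p *m T.
  have N : \forall y \near l p, mixed y = transition (pc a b) (pc a' b') (local_map F l a b t y).
    apply: filterS (open_nbhs_nbhs (conj oV Vp)) => y /HV[_ dy].
    by rewrite /mixed /transition /local_map prod_chartK //; exact: mchart.
  rewrite (near_jac N) /T -zE; apply: (jac_comp oO); first by rewrite zE.
    by move=> k; exact: CT.
  by move=> i j; exact: (Ck_derivable (CV 1 j) Vp).
have E2 : jac mixed (l p) = P *m jacF l' a' b' t p.
  have oI : open (cmap l @` (dom l `&` dom l')).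
    by apply: chart_open_img => //; case: cl'.
  have Ip : (cmap l @` (dom l `&` dom l')) (l p) by exists p.
  have tE : transition l l' (l p) = l' p by rewrite /transition cmapK.
  have N : \forall y \near l p, mixed y = local_map F l' a' b' t (transition l l' y).
    apply: filterS (open_nbhs_nbhs (conj oI Ip)) => y [q [dq dq'] <-].
    by rewrite /mixed /transition /local_map (cmapK cl dq) (cmapK cl' dq').
  rewrite (near_jac N) /jacF -tE; apply: (jac_comp oV'); first by rewrite tE.
    by move=> k; exact: CV'.
  by move=> i j; exact: (Ck_derivable (transition_Ck 1 j al al') Ip).
have E : jacF l a b t p *m T = P *m jacF l' a' b' t p by rewrite -E1 E2.
have Gt : gram a b t p = T *m gram a' b' t p *m T^T.
  have Gt0 := hmet_tensor aa ab aa' ab' dF dF' (@F_avoids_cut t p tI); cbv zeta in Gt0.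
  exact: Gt0.
have TK : T *m Kmx R n = Kmx R n *m T by exact: prod_transition_K.
have Et : T^T *m (jacF l a b t p)^T = (jacF l' a' b' t p)^T *m P^T by rewrite -!trmx_mul E.
have gE : metric_mx l a b t p = P *m metric_mx l' a' b' t p *m P^T.
  by rewrite /metric_mx Gt !mulmxA E -!mulmxA Et.
have oE : omega_mx l a b t p = P *m omega_mx l' a' b' t p *m P^T.
  rewrite /omega_mx Gt !mulmxA -(mulmxA (jacF l a b t p) (Kmx R n)) -TK !mulmxA E.
  by rewrite -!mulmxA Et.
have gu := posdef_unit (metric_mx_pos tI ch).
by rewrite /chart_norm gE oE form2_congr // -gE.
Qed.

(** |omega|_L|^2 as a global function: by chart_norm_invariant the choice of
    charts is immaterial. *)
Definition omega_norm t p : R :=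
  get [set q | exists l a b, charts_at F t p l a b /\ q = chart_norm l a b t p].

Lemma omega_normE t p l a b : 0 <= t <= t0 -> charts_at F t p l a b ->
  omega_norm t p = chart_norm l a b t p.
Proof.
move=> tI ch; have ex : [set q | exists l a b, charts_at F t p l a b /\ q = chart_norm l a b t p] !=set0.
  by exists (chart_norm l a b t p), l, a, b.
have [l' [a' [b' [ch' e]]]] := getPex ex; apply: etrans e _.
exact: (chart_norm_invariant tI ch' ch).
Qed.

Lemma metric_mxT t p l a b : 0 <= t <= t0 -> charts_at F t p l a b ->
  (metric_mx l a b t p)^T = metric_mx l a b t p.
Proof.
move=> tI [al aa ab dl dF]; rewrite /metric_mx !trmx_mul trmxK mulmxA; congr (_ *m _ *m _).
exact: (hmet_sym aa ab dF (@F_avoids_cut t p tI)).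
Qed.

Lemma omega_norm_ge0 t p : 0 <= t <= t0 -> 0 <= omega_norm t p.
Proof.
move=> tI; have [l [a [b ch]]] := charts_at_ex F t p.
rewrite (omega_normE tI ch); apply: form2_ge0; first exact: metric_mxT.
exact: metric_mx_pos.
Qed.

Lemma omega_norm_lagrangian t : 0 <= t <= t0 ->
  (forall p, omega_norm t p = 0) <-> lagrangian_at_time X F t.
Proof.
move=> tI; split.
  move=> Q0 p l a b ch J i j; rewrite kahler_form_mx -/(gram a b t p) -/(omega_mx l a b t p).
  have := form2_coercive (omega_mx l a b t p) (metric_mxT tI ch) (metric_mx_pos tI ch).
  rewrite -/(chart_norm l a b t p) -(omega_normE tI ch) Q0 mulr0 => fr.
  have := le_sum_entry i j (fun k l0 => sqr_ge0 (omega_mx l a b t p k l0)).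
  move=> /le_trans/(_ fr) sq; apply/eqP; rewrite -sqrf_eq0 eq_le sq sqr_ge0 //.
move=> Lt p; have [l [a [b ch]]] := charts_at_ex F t p.
rewrite (omega_normE tI ch) /chart_norm.
have -> : omega_mx l a b t p = 0.
  apply/matrixP => i j; rewrite -[LHS]kahler_form_mx [RHS]mxE.
  exact: (Lt p l a b ch i j).
by rewrite /form2 mulmx0 !mul0mx mxtrace0.
Qed.

End Invariant.

(** * One-sided velocities *)

Section TimeDerivative.
Variables (R : realType) (n : nat).
Local Opaque Ck partial dmx.

(** Every admissible time, the ends included, is a limit of other admissible
    times. This gives uniqueness of velocities. *)
Lemma within_itv_proper (t t0 : R) : 0 < t0 -> 0 <= t <= t0 ->
  ProperFilter (within [set s : R | 0 <= s <= t0] t^').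
Proof.
move=> t00 /andP[t_ge t_le]; split; last exact: within_filter.
move=> /nbhs_ballP[e /= e0 He].
have [tl|tg] := ltP t t0.
  pose d := Num.min (t0 - t) (e / 2).
  have d0 : 0 < d by rewrite lt_min subr_gt0 tl divr_gt0.
  have de : d <= e / 2 by rewrite ge_min lexx orbT.
  have dt : d <= t0 - t by rewrite ge_min lexx.
  apply: (He (t + d)).
  - rewrite -ball_normE /= opprD addrA subrr sub0r normrN gtr0_norm //; lra.
  - by rewrite /= -subr_eq0 addrAC subrr add0r gt_eqF.
  - by apply/andP; split; lra.
pose d := Num.min t (e / 2).
have tp : 0 < t by lra.
have d0 : 0 < d by rewrite lt_min tp divr_gt0.
have de : d <= e / 2 by rewrite ge_min lexx orbT.
have dt : d <= t by rewrite ge_min lexx.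
apply: (He (t - d)).
- by rewrite -ball_normE /= opprB addrC subrK gtr0_norm //; lra.
- by rewrite /= -subr_eq0 addrAC subrr add0r oppr_eq0 gt_eqF.
- by apply/andP; split; lra.
Qed.

Lemma slice_time (s t : R) (u : 'rV[R]_n) :
  (s - t) *: delta_mx 0 itime + slice t u = slice s u.
Proof.
have addE (X Y : 'rV[R]_(n + 1)) j : (X + Y) 0 j = X 0 j + Y 0 j by rewrite mxE.
apply/rowP => j; rewrite addE; case: (split_ordP j) => k ->.
  by rewrite !row_mxEl !mxE /itime eq_lrshift andbF mulr0 add0r.
rewrite !row_mxEr !mxE /itime !ord1 !eqxx /= mulr1.
by rewrite !mulr1n subrK.
Qed.

(** The velocity may be one-sided, but it agrees with the time derivative of the
    extension f. *)
Lemma velocity_slice (W : set 'rV[R]_(n + 1)) (N : nat) (f : 'rV[R]_(n + 1) -> 'rV[R]_N)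
    (t0 t : R) (u : 'rV[R]_n) (y : R -> 'rV[R]_N) v :
  0 < t0 -> 0 <= t <= t0 -> open W -> (forall j, Ck 1 W (fun w => f w 0 j)) ->
  W (slice t u) ->
  (forall s, 0 <= s <= t0 -> W (slice s u) -> y s = f (slice s u)) ->
  velocity_within [set s : R | 0 <= s <= t0] y t v ->
  v = \row_P partial itime (fun w => f w 0 P) (slice t u).
Proof.
move=> t00 tI oW Cf Ww yf vel; apply/rowP => P; rewrite [RHS]mxE.
have PF := within_itv_proper t00 tI.
pose I := [set s : R | 0 <= s <= t0].
have c1 : (fun s : R => (s - t)^-1 * (y s 0 P - y t 0 P)) @ within I t^' --> v 0 P.
  have cP : {for v, continuous (fun x : 'rV[R]_N => x 0 P)} by exact: coord_continuous.
  have := cvg_comp _ _ vel cP.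
  apply: cvg_trans; apply: near_eq_cvg; apply: (@filterE _ _ _ _) => s.
  by rewrite /= !mxE.
have D : derivable (fun w => f w 0 P) (slice t u) (delta_mx 0 itime) by exact: (Ck_derivable (Cf P) Ww).
have c2 : (fun s : R => (s - t)^-1 * (y s 0 P - y t 0 P)) @ within I t^' -->
    partial itime (fun w => f w 0 P) (slice t u).
  have sh : (fun s : R => s - t) @ t^' --> 0^'.
    move=> A /nbhs_ballP[e /= e0 He]; apply/nbhs_ballP; exists e => //= s sb st.
    apply: He; last by rewrite subr_eq0.
    by move: sb; rewrite -!ball_normE /= sub0r normrN distrC.
  have cw : (fun s : R => s - t) @ within I t^' --> 0^' by apply: cvg_trans sh; exact: cvg_within_filter.
  have := cvg_comp _ _ cw D.
  apply: cvg_trans; apply: near_eq_cvg.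
  have nW : \forall s \near t, W (slice s u).
    have cs : {for t, continuous (fun s : R => slice s u)}.
      by apply: continuous_slice; [exact: cvg_id|exact: cst_continuous].
    by apply: cs; exact: open_nbhs_nbhs.
  have nW' : \forall s \near t^', W (slice s u) by exact: cvg_within.
  apply: filterS (nW') => s Ws Is.
  rewrite /= slice_time; congr (_ * (_ - _)).
    by rewrite (yf s Is Ws).
  by rewrite (yf t tI Ww).
exact: (cvg_unique _ c1 c2).
Qed.

End TimeDerivative.

(** * Local models of the flow *)

Section Model.
Variables (R : realType) (n : nat) (M Mb L : manifold R n).
Variables (X : KimMcCann M Mb) (Omega : para_nform M Mb).
Hypothesis oriented : compatible_orientation X.
Local Opaque Ck partial dmx.
Local Notation pc a b := (prod_chart a b).

Let mchart (N : manifold R n) (a : chart R N n) : atlas a -> is_chart a.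
Proof. exact: atlas_chart. Qed.

Lemma cost_model (a : chart R M n) (b : chart R Mb n) q : atlas a -> atlas b ->
  dom (pc a b) q -> ~ cut_locus X q ->
  exists (Ot : set 'rV[R]_(n + n)) (c : 'rV[R]_(n + n) -> R),
  [/\ open Ot, Ot (pc a b q), Ck 4 Ot c &
   forall z, Ot z ->
    [/\ img a (lsubmx z), img b (rsubmx z),
        local_metric X a b z = block_mx 0 (Cmx c z) (Cmx c z)^T 0
      & 0 < \det (2 *: Cmx c z)]].
Proof.
move=> aa ab dq cq; have ca := mchart aa; have cb := mchart ab.
have [U [c0 [oU Uq Ucut H]]] := hmet_cost cq.
have [Cc Hh] := H a b aa ab.
exists (cmap (pc a b) @` (dom (pc a b) `&` U)), (c0 \o cinv (pc a b)).
split; [exact: prod_chart_open_img|by exists q|exact: Cc|].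
move=> z zO; have [i1 i2 _] := (prod_chart_img U z ca cb).1 zO.
have [q' [dq' Uq'] zE] := zO.
have ncut : ~ cut_locus X q' by exact: Ucut.
have lE : local_metric X a b z = hmet X (pc a b) q'.
  by rewrite -zE /local_metric prod_chartK.
have [ul dr] := hmet_isotropic aa ab dq' ncut.
have urE : ursubmx (hmet X (pc a b) q') = Cmx (c0 \o cinv (pc a b)) z.
  apply/matrixP => i s; rewrite [LHS]mxE [LHS]mxE (Hh q' dq' Uq' i s) [RHS]mxE.
  by rewrite zE.
have dlE : dlsubmx (hmet X (pc a b) q') = (Cmx (c0 \o cinv (pc a b)) z)^T.
  by rewrite -urE trmx_ursub (hmet_sym aa ab dq' ncut).
split=> //; first by rewrite lE -[LHS]submxK ul dr urE dlE.
by rewrite -urE; exact: (oriented aa ab dq' ncut).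
Qed.

Lemma metric_unit (C : 'M[R]_n) : C \in unitmx ->
  (block_mx 0 C C^T 0 : 'M[R]_(n + n)) \in unitmx.
Proof.
move=> Cu; have Cut : C^T \in unitmx by rewrite unitmx_tr.
suff : (block_mx 0 C C^T 0 : 'M[R]_(n + n)) *m
    (block_mx 0 (invmx C^T) (invmx C) 0 : 'M[R]_(n + n)) = 1%:M.
  by move=> /mulmx1_unit[].
rewrite mulmx_block !mulmx0 !mul0mx !addr0 !add0r !mulmxV //.
by rewrite -scalar_mx_block.
Qed.

Lemma log_density_Ck (N : manifold R n) (r : positive_nform N) (a : chart R N n)
    (Ot : set 'rV[R]_(n + n)) (sel : 'rV[R]_(n + n) -> 'rV[R]_n) :
  atlas a -> open Ot -> (forall z, Ot z -> img a (sel z)) ->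
  (forall k j, Ck k Ot (fun z => sel z 0 j)) ->
  Ck 2 Ot (fun z => ln (r a (cinv a (sel z)))).
Proof.
move=> aa oO Osel Csel; have ca := mchart aa.
have oimg : open (img a) by have [] := ca.
have Cr : Ck 2 (img a) (r a \o cinv a).
  by apply: smooth_on_open => //; exact: rho_smooth.
have H : Ck 2 Ot (fun z => r a (cinv a (sel z))).
  by have H := Ck_comp oO oimg Osel (Csel 2) Cr; exact: H.
apply: (Ck_ln oO _ H) => z Oz; apply: rho_gt0 => //.
by have [] := img_cinv ca (Osel z Oz).
Qed.

(** bilin E v v is half of bilin (E + E^T) v v. *)
Lemma sym_part_unit (E : 'M[R]_n) : posdef (E + E^T) -> E \in unitmx.
Proof.
move=> gp; apply: posdef_unit => v v0; have := gp v v0.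
have tr : bilin E^T v v = bilin E v v.
  rewrite /bilin -[in RHS](trmxK (v *m E *m v^T)) [RHS]mxE.
  by rewrite !trmx_mul trmxK mulmxA.
have -> : bilin (E + E^T) v v = bilin E v v + bilin E v v.
  by rewrite -[X in _ = _ + X]tr /bilin mulmxDr mulmxDl mxE.
by move: (bilin E v v) => x; lra.
Qed.

End Model.

Section ChartModel.
Variables (R : realType) (n : nat) (M Mb L : manifold R n).
Variables (X : KimMcCann M Mb) (Omega : para_nform M Mb).
Variables (t0 : R) (F : R -> L -> M * Mb).
Local Opaque Ck partial dmx.
Local Notation pc a b := (prod_chart a b).

Variables (l : chart R L n) (a : chart R M n) (b : chart R Mb n).
Hypotheses (al : atlas l) (aa : atlas a) (ab : atlas b).
Variables (W : set 'rV[R]_(n + 1)) (f : 'rV[R]_(n + 1) -> 'rV[R]_(n + n)).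
Variables (Ot : set 'rV[R]_(n + n)) (c : 'rV[R]_(n + n) -> R).
Hypotheses (oW : open W) (oO : open Ot).
Hypothesis Cc : Ck 4 Ot c.
Hypothesis Cf : forall k j, Ck k W (fun w => f w 0 j).
Hypothesis fWO : forall w, W w -> Ot (f w).
(* f extends F past the ends of [0, t0]. *)
Hypothesis fE : forall w, W w -> 0 <= timeof w <= t0 ->
    [/\ img l (lsubmx w), dom (pc a b) (F (timeof w) (cinv l (lsubmx w)))
     & local_map F l a b (timeof w) (lsubmx w) = f w].
(* c is a cost function for h near the image of f. *)
Hypothesis HO : forall z, Ot z ->
    [/\ img a (lsubmx z), img b (rsubmx z),
        local_metric X a b z = block_mx 0 (Cmx c z) (Cmx c z)^T 0
      & 0 < \det (2 *: Cmx c z)].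

Let GE z : Ot z -> local_metric X a b z = block_mx 0 (Cmx c z) (Cmx c z)^T 0.
Proof. by move=> /HO[]. Qed.

Lemma model_charts w : W w -> 0 <= timeof w <= t0 ->
  charts_at F (timeof w) (cinv l (lsubmx w)) l a b /\ l (cinv l (lsubmx w)) = lsubmx w.
Proof.
move=> Ww wI; have [i1 i2 _] := fE Ww wI.
by have [d e] := img_cinv (atlas_chart al) i1.
Qed.

Lemma model_near w : W w -> 0 <= timeof w <= t0 ->
  \forall y \near lsubmx w, local_map F l a b (timeof w) y = f (slice (timeof w) y).
Proof.
move=> Ww wI.
have cs : {for lsubmx w, continuous (fun y : 'rV[R]_n => slice (timeof w) y)}.
  by apply: continuous_slice; [exact: cst_continuous|exact: cvg_id].
have : \forall y \near lsubmx w, W (slice (timeof w) y).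
  by apply: cs; rewrite slice_timeof; exact: open_nbhs_nbhs.
apply: filterS => y Wy.
by have := fE Wy; rewrite timeof_slice lsubmx_slice => /(_ wI)[_ _].
Qed.

Let Wslice w : W w -> W (slice (timeof w) (lsubmx w)).
Proof. by rewrite slice_timeof. Qed.

Lemma model_metric w : W w -> 0 <= timeof w <= t0 ->
  metric_mx X F l a b (timeof w) (cinv l (lsubmx w)) = gmx c f w.
Proof.
move=> Ww wI; have [ch e] := model_charts Ww wI.
rewrite -(metric_mxE X ch) e.
by rewrite (induced_slice fWO GE (Wslice Ww) (model_near Ww wI)) slice_timeof.
Qed.

Lemma model_omega w : W w -> 0 <= timeof w <= t0 ->
  omega_mx X F l a b (timeof w) (cinv l (lsubmx w)) = omx c f w.
Proof.
move=> Ww wI; have [ch e] := model_charts Ww wI; have [_ _ fw] := fE Ww wI.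
rewrite -[RHS](congr1 (omx c f) (slice_timeof w)) -(kahler_slice fWO GE (Wslice Ww)).
rewrite /omega_mx /jacF -(local_metric_F X ch) e fw.
by rewrite (jac_slice (model_near Ww wI)) slice_timeof.
Qed.

Hypotheses (n_gt0 : (0 < n)%N) (t0_gt0 : 0 < t0).
Hypothesis F_flow : generalized_mcf X Omega t0 F.

Definition log_rho (z : 'rV[R]_(n + n)) : R := ln (form_l Omega a (cinv a (lsubmx z))).
Definition log_rhob (z : 'rV[R]_(n + n)) : R := ln (form_r Omega b (cinv b (rsubmx z))).

Lemma log_rho_Ck : Ck 2 Ot log_rho.
Proof.
apply: (log_density_Ck (form_l Omega) aa oO); first by move=> z /HO[].
by move=> k j; exact: Ck_lsubmx.
Qed.

Lemma log_rhob_Ck : Ck 2 Ot log_rhob.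
Proof.
apply: (log_density_Ck (form_r Omega) ab oO); first by move=> z /HO[].
by move=> k j; exact: Ck_rsubmx.
Qed.

Lemma local_psiE z : Ot z -> local_psi X Omega a b z =
  (n.*2)%:R^-1 * (log_rho z + log_rhob z - ln (\det (2 *: Cmx c z))).
Proof.
move=> Oz; have := GE Oz; rewrite /local_metric => e.
by rewrite /local_psi /psi /neg_mixed_hessian e block_mxKur.
Qed.

Lemma local_psi_Ck : Ck 2 Ot (local_psi X Omega a b).
Proof.
have C2C : CkMx Ot 2 (fun z => 2 *: Cmx c z).
  by have H := CkMxZ oO (Ck_cst oO 2 (2 : R)) (CkMx_Cmx oO Cc); exact: H.
have dp z : Ot z -> 0 < \det (2 *: Cmx c z) by move=> /HO[].
have H := CkM oO (Ck_cst oO 2 ((n.*2)%:R^-1 : R))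
  (CkB oO (CkD oO log_rho_Ck log_rhob_Ck) (Ck_ln oO dp (Ck_det oO C2C))).
by apply: (Ck_ext oO _ H) => z Oz; rewrite local_psiE.
Qed.

Lemma model_flow w k : W w -> 0 <= timeof w <= t0 ->
  Lam c f w itime (ispace k) =
    \sum_i \sum_j invmx (gmx c f w) i j * (Umx c f i w j k - Ubmx c f i w j k)
    + 2^-1 * (partial (ispace k) (rho_diff f log_rho log_rhob) w
              - \tr (dCl c f k w *m invmx (Cfm c f w))
              + \tr (dCr c f k w *m invmx (Cfm c f w)))
    + \sum_m tau_vec c f (local_psi X Omega a b) w 0 m * omx c f w m k.
Proof.
move=> Ww wI; have [ch e] := model_charts Ww wI.
have [v vel nf] := F_flow wI ch.
have Gu z : Ot z -> local_metric X a b z \in unitmx.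
  move=> Oz; rewrite (GE Oz); apply: metric_unit.
  have [_ _ _] := HO Oz; rewrite detZ unitmxE unitfE => /lt0r_neq0.
  by rewrite mulf_eq0 negb_or => /andP[].
have dp z : Ot z -> 0 < \det (2 *: Cmx c z) by move=> /HO[].
have p1 z i : Ot z -> partial (rshift n i) log_rho z = 0.
  by move=> _; exact: (partial_lsubmx (fun u => ln (form_l Omega a (cinv a u))) z i).
have p2 z i : Ot z -> partial (lshift n i) log_rhob z = 0.
  by move=> _; exact: (partial_rsubmx (fun u => ln (form_r Omega b (cinv b u))) z i).
have vE : v = \row_P partial itime (fun y => f y 0 P) (slice (timeof w) (lsubmx w)).
  apply: (velocity_slice t0_gt0 wI oW (Cf 1) (Wslice Ww) _ vel) => s sI Ws.
  have := fE Ws; rewrite timeof_slice lsubmx_slice => /(_ sI)[_ _ <-].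
  by [].
have nf' := nf; rewrite e in nf'.
have H := flow_identity oO oW Cc Cf fWO GE (Wslice Ww) (model_near Ww wI) Gu n_gt0
  log_rho_Ck log_rhob_Ck local_psi_Ck p1 p2 dp local_psiE k vE nf'.
rewrite slice_timeof in H; exact: H.
Qed.

End ChartModel.

Section Shrinking.
Variables (R : realType) (m : nat).
Local Opaque Ck partial dmx.

Lemma open_preimage (T : topologicalType) (W : set 'rV[R]_m) (f : 'rV[R]_m -> T) (V : set T) :
  open W -> open V -> (forall x, W x -> {for x, continuous f}) ->
  open [set w | W w /\ V (f w)].
Proof.
move=> oW oV cf; rewrite openE => w [Ww Vw]; apply: filterI.
  exact: open_nbhs_nbhs.
by apply: (cf w Ww); exact: open_nbhs_nbhs.
Qed.

Lemma closed_ball_in_open (W : set 'rV[R]_m) w0 : open W -> W w0 ->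
  exists r : R, [/\ 0 < r, compact (closed_ball_ Num.Def.normr w0 r)
    & closed_ball_ Num.Def.normr w0 r `<=` W].
Proof.
move=> oW Ww; have /nbhs_ballP[e /= e0 He] := open_nbhs_nbhs (conj oW Ww).
have e2 : 0 < e / 2 by rewrite divr_gt0.
exists (e / 2); split=> //.
- apply: bounded_closed_compact.
    exists (`|w0| + e / 2); split; first exact: num_real.
    move=> x xl y /= yb; apply: le_trans (ltW xl).
    rewrite -[y](subKr w0); apply: le_trans (ler_normB _ _) _.
    by rewrite lerD2l.
  exact: closed_closed_ball_.
- move=> x /= xb; apply: He; rewrite -ball_normE /=; apply: le_lt_trans xb _.
  by move: e0; lra.
Qed.

End Shrinking.

Section FlowEvolution.
Variables (R : realType) (n : nat) (M Mb L : manifold R n).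
Variables (X : KimMcCann M Mb) (Omega : para_nform M Mb).
Hypothesis oriented : compatible_orientation X.
Variables (t0 : R) (F : R -> L -> M * Mb).
Hypotheses (n_gt0 : (0 < n)%N) (t0_gt0 : 0 < t0).
Hypothesis F_smooth : smooth_family t0 F.
Hypothesis F_avoids_cut : forall t p, 0 <= t <= t0 -> ~ cut_locus X (F t p).
Hypothesis F_spacelike : forall t, 0 <= t <= t0 -> spacelike_at_time X F t.
Hypothesis F_flow : generalized_mcf X Omega t0 F.
Local Opaque Ck partial dmx.
Local Notation pc a b := (prod_chart a b).
Local Notation cball w r := (closed_ball_ Num.Def.normr w r).

(** W is shrunk until E and g are invertible on it. At an admissible time g is
    positive definite because the slice is spacelike, and E is then invertible
    by sym_part_unit; nearby, the determinants stay nonzero by continuity. The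
    constant Mc comes from compactness of a ball. *)
Lemma local_omega_evolution ts ps : 0 <= ts <= t0 ->
  exists (l : chart R L n) (W : set 'rV[R]_(n + 1)) (g al : 'rV[R]_(n + 1) -> 'M[R]_n) (Mc r : R),
  [/\ [/\ atlas l, dom l ps & open W], 0 < r, cball (slice ts (l ps)) r `<=` W,
      Ck 2 W (norm_sq g al) &
   forall w, W w -> 0 <= timeof w <= t0 ->
     [/\ img l (lsubmx w),
         omega_norm X F (timeof w) (cinv l (lsubmx w)) = norm_sq g al w,
         (g w)^T = g w, posdef (g w) &
         cball (slice ts (l ps)) r w ->
         partial itime (norm_sq g al) w <=
          \sum_p \sum_q invmx (g w) p q * partial (ispace p) (partial (ispace q) (norm_sq g al)) w
          + Mc * norm_sq g al w]].
Proof.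
move=> tI; have [l [a [b ch]]] := charts_at_ex F ts ps.
have [al aa ab dl dF] := ch.
have [W1 [f [oW1 W1w Cf1 fE1]]] := local_extension F_smooth tI ch.
have [Ot [c [oO Oq Cc HO]]] := cost_model oriented aa ab dF (@F_avoids_cut ts ps tI).
pose w0 := slice ts (l ps).
pose W2 : set 'rV[R]_(n + 1) := [set w | W1 w /\ Ot (f w)].
have oW2 : open W2.
  apply: open_preimage => // w Ww; apply: continuous_coords => j.
  exact: Ck_continuous (Cf1 0%N j) Ww.
have Cf2 k j : Ck k W2 (fun w => f w 0 j) by apply: Ck_sub (Cf1 k j) => w [].
have fE2 w : W2 w -> 0 <= timeof w <= t0 ->
    [/\ img l (lsubmx w), dom (pc a b) (F (timeof w) (cinv l (lsubmx w)))
     & local_map F l a b (timeof w) (lsubmx w) = f w] by move=> [W1' _]; exact: fE1.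
have fO2 w : W2 w -> Ot (f w) by case.
have gpos w : W2 w -> 0 <= timeof w <= t0 -> posdef (gmx c f w).
  move=> Ww wI; have [chw _] := model_charts al aa ab fE2 Ww wI.
  rewrite -(model_metric al aa ab oW2 fO2 fE2 HO Ww wI).
  exact: (metric_mx_pos F_spacelike wI chw).
have w0I : 0 <= timeof w0 <= t0 by rewrite timeof_slice.
have W2w : W2 w0.
  split=> //; have [_ _ <-] := fE1 w0 W1w w0I.
  by rewrite /local_map timeof_slice lsubmx_slice (cmapK (atlas_chart al) dl).
have CE := Ck_continuous (Ck_pred (Ck_pred (Ck_det oW2 (CkMx_Emx oO oW2 Cc Cf2 fO2)))).
have Cg := Ck_continuous (Ck_pred (Ck_pred (Ck_det oW2 (CkMx_gmx oO oW2 Cc Cf2 fO2)))).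
pose W : set 'rV[R]_(n + 1) := [set w | W2 w /\ (\det (Emx c f w) != 0 /\ \det (gmx c f w) != 0)].
have oW : open W.
  have o1 := open_preimage oW2 (@open_neq R 0) CE.
  have o2 := open_preimage oW2 (@open_neq R 0) Cg.
  suff -> : W = [set w | W2 w /\ [set x | x != 0] (\det (Emx c f w))] `&`
                [set w | W2 w /\ [set x | x != 0] (\det (gmx c f w))] by exact: openI.
  by apply/seteqP; split=> [w [h1 [h2 h3]]|w [[h1 h2] [_ h3]]].
have Ww0 : W w0.
  have gp := gpos w0 W2w w0I; split=> //; split; last by rewrite -unitfE -unitmxE posdef_unit.
  by rewrite -unitfE -unitmxE; apply: sym_part_unit.
have Cf k j : Ck k W (fun w => f w 0 j) by apply: Ck_sub (Cf2 k j) => w [].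
have fE w : W w -> 0 <= timeof w <= t0 ->
    [/\ img l (lsubmx w), dom (pc a b) (F (timeof w) (cinv l (lsubmx w)))
     & local_map F l a b (timeof w) (lsubmx w) = f w] by move=> [W2' _]; exact: fE2.
have fO w : W w -> Ot (f w) by case=> /fO2.
have Eu w : W w -> Emx c f w \in unitmx by move=> [_ [h _]]; rewrite unitmxE unitfE.
have gu w : W w -> gmx c f w \in unitmx by move=> [_ [_ h]]; rewrite unitmxE unitfE.
have [r [r0 cK KW]] := closed_ball_in_open oW Ww0.
pose S : set 'rV[R]_(n + 1) := [set w | 0 <= timeof w <= t0].
have S_shift (i : 'I_n) (s : R) w : S w -> S (s *: delta_mx 0 (ispace i) + w).
  suff e : timeof (s *: delta_mx 0 (ispace i) + w) = timeof w by rewrite /S /= e.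
  by rewrite /timeof !mxE eqxx /= eq_rlshift mulr0 add0r.
have Crf := Ck_rho_diff oO oW Cf fO (log_rho_Ck Omega aa oO HO) (log_rhob_Ck Omega ab oO HO).
have Ctau := CkMx_tau_vec oO oW Cc Cf fO gu (local_psi_Ck Omega aa ab oO Cc HO).
have Hflow w k (Ww : W w) (Sw : S w) :=
  model_flow al aa ab oW oO Cc Cf fO fE HO n_gt0 t0_gt0 F_flow k Ww Sw.
have DK : cball w0 r `&` S `<=` cball w0 r by exact: subIsetl.
have DS : cball w0 r `&` S `<=` S by exact: subIsetr.
have gposD w : (cball w0 r `&` S) w -> posdef (gmx c f w).
  by move=> [/KW[W2' _] Sw]; exact: gpos.
have [Mc HM] := local_evolution oO oW Cc Cf fO Eu gu S_shift Crf Ctau Hflow cK KW DK DS gposD.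
exists l, W, (gmx c f), (omx c f), Mc, r; split; [split; [exact: al|exact: dl|exact: oW]|exact: r0|exact: KW| |].
  have Cgm := CkMx_gmx oO oW Cc Cf fO; have Com := CkMx_omx oO oW Cc Cf fO.
  have Ch := CkMx_inv oW gu Cgm.
  have H := Ck_tr oW (CkMxM oW (CkMxM oW (CkMxM oW Ch Com) Ch) (CkMxT oW Com)).
  exact: H.
move=> w Ww wI; have [chw _] := model_charts al aa ab fE Ww wI; split.
- by have [] := fE w Ww wI.
- rewrite (omega_normE F_smooth F_avoids_cut F_spacelike wI chw) /chart_norm.
  by rewrite (model_metric al aa ab oW fO fE HO Ww wI) (model_omega al aa ab oW fO fE HO Ww wI).
- exact: gmxT.
- by case: Ww => Ww _; exact: gpos.
- by move=> wb; exact: (HM w (conj wb wI)).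
Qed.

End FlowEvolution.

(** * The maximum principle *)

Section MaximumPrinciple.
Variables (R : realType) (n : nat).

Lemma row_direction (H : 'I_(n + 1) -> 'I_(n + 1) -> R) (v : 'rV[R]_n) :
  let v' : 'rV[R]_(n + 1) := row_mx v 0 in
  \sum_i \sum_j v' 0 i * v' 0 j * H i j =
  bilin (\matrix_(p, q) H (ispace p) (ispace q)) v v.
Proof.
move=> v'; have vl i : v' 0 (lshift 1 i) = v 0 i by rewrite /v' row_mxEl.
have vr i : v' 0 (rshift n i) = 0 by rewrite /v' row_mxEr mxE.
rewrite big_split_ord /= [X in _ + X]big1 ?addr0; last first.
  by move=> i _; rewrite big1 // => j _; rewrite vr !mul0r.
apply: etrans (_ : \sum_i \sum_j v 0 i * v 0 j * H (ispace i) (ispace j) = _).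
  apply: eq_bigr => i _; rewrite big_split_ord /= [X in _ + X]big1 ?addr0; last first.
    by move=> j _; rewrite vr mulr0 mul0r.
  by apply: eq_bigr => j _; rewrite !vl.
rewrite exchange_big /bilin mxE; apply: eq_bigr => j _.
rewrite [X in _ = _ * X]mxE mxE mulr_suml; apply: eq_bigr => i _.
by rewrite mxE mulrAC.
Qed.

Variable W : set 'rV[R]_(n + 1).
Hypothesis oW : open W.
Local Opaque Ck.

Lemma line_in_open w v : W w -> exists2 r : R, 0 < r &
  forall s : R, `|s| <= r -> W (s *: v + w).
Proof.
move=> Ww.
have cl : {for (0 : R), continuous (fun s : R => s *: v + w)}.
  apply: (@continuousD _ _ _ (fun s : R => s *: v) (fun=> w)); last exact: cst_continuous.
  exact: scalel_continuous.
have : \forall s \near (0 : R), W (s *: v + w).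
  by apply: cl; rewrite scale0r add0r; exact: open_nbhs_nbhs.
move=> /nbhs_ballP[e /= e0 He]; exists (e / 2); first by rewrite divr_gt0.
move=> s se; apply: He; rewrite -ball_normE /= sub0r normrN; apply: le_lt_trans se _.
by move: e0; lra.
Qed.

(** At a positive maximum of e^(- lam t) Q the Hessian in space is nonpositive and
    d_t Q >= lam Q, so that the evolution inequality forces lam <= Mc. *)
Lemma no_interior_max (Q : 'rV[R]_(n + 1) -> R) (g : 'M[R]_n) (lam Mc t : R) (u : 'rV[R]_n) :
  Ck 2 W Q -> W (slice t u) -> 0 < t -> g^T = g -> posdef g ->
  partial itime Q (slice t u) <=
    \sum_p \sum_q invmx g p q * partial (ispace p) (partial (ispace q) Q) (slice t u)
    + Mc * Q (slice t u) ->
  (forall s u', 0 <= s <= t -> W (slice s u') ->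
     expR (- (lam * s)) * Q (slice s u') <= expR (- (lam * t)) * Q (slice t u)) ->
  0 < Q (slice t u) -> lam <= Mc.
Proof.
move=> CQ Ww tp gT gp evo mx Qp; set w := slice t u.
have space u' : W (slice t u') -> Q (slice t u') <= Q w.
  move=> Wu; have tt : 0 <= t <= t by rewrite ltW //=.
  by have := mx t u' tt Wu; rewrite ler_pM2l // expR_gt0.
have hess : \sum_p \sum_q invmx g p q * partial (ispace p) (partial (ispace q) Q) w <= 0.
  pose H : 'M[R]_n := \matrix_(p, q) partial (ispace p) (partial (ispace q) Q) w.
  have -> : \sum_p \sum_q invmx g p q * partial (ispace p) (partial (ispace q) Q) w =
      \sum_p \sum_q invmx g p q * H p q.
    by apply: eq_bigr => p _; apply: eq_bigr => q _; rewrite [H p q]mxE.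
  apply: (trace_hessian_le0 gT gp) => v.
  rewrite -(row_direction (fun i j => partial i (partial j Q) w)).
  have [r r0 Hr] := line_in_open (row_mx v 0) Ww.
  apply: (second_derivative_max oW r0 CQ) => s sr; have Ws := Hr s sr.
  split; first exact: Ws.
  have e : s *: row_mx v 0 + w = slice t (s *: v + u).
    by rewrite /w /slice scale_row_mx scaler0 add_row_mx add0r.
  by rewrite e in Ws *; exact: space.
have time : lam * Q w <= partial itime Q w.
  have [r r0 Hr] := line_in_open (delta_mx 0 itime) Ww.
  have r'0 : 0 < Num.min r t by rewrite lt_min r0.
  apply: (time_derivative_max oW r'0 (Ck_pred CQ) Ww) => s.
  rewrite oppr_min gt_max => /andP[s1 s2] s0.
  have e : s *: delta_mx 0 itime + w = slice (t + s) u.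
    by rewrite -(slice_time (t + s) t) addrAC subrr add0r.
  have Ws : W (slice (t + s) u).
    by rewrite -e; apply: Hr; rewrite ltr0_norm //; lra.
  have ts : 0 <= t + s <= t by apply/andP; split; lra.
  rewrite e; have := mx (t + s) u ts Ws.
  by rewrite mulrDr opprD expRD -mulrA ler_pM2l // expR_gt0.
rewrite -(ler_pM2r Qp); apply: le_trans time _; apply: le_trans evo _.
by rewrite gerDr.
Qed.

End MaximumPrinciple.

Section Conclusion.
Variables (R : realType) (n : nat) (M Mb L : manifold R n).
Variables (X : KimMcCann M Mb) (Omega : para_nform M Mb).
Hypothesis oriented : compatible_orientation X.
Variables (t0 : R) (F : R -> L -> M * Mb).
Hypotheses (n_gt0 : (0 < n)%N) (t0_gt0 : 0 < t0).
Hypothesis F_smooth : smooth_family t0 F.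
Hypothesis F_avoids_cut : forall t p, 0 <= t <= t0 -> ~ cut_locus X (F t p).
Hypothesis F_spacelike : forall t, 0 <= t <= t0 -> spacelike_at_time X F t.
Hypothesis F_flow : generalized_mcf X Omega t0 F.
Local Opaque Ck partial dmx.

Local Notation omega := (omega_norm X F).

Definition space_time : set (R * L) := [set q | 0 <= q.1 <= t0].

Definition weighted_omega (lam : R) (q : R * L) : R :=
  expR (- (lam * q.1)) * omega q.1 q.2.

Lemma omega_locally ts ps : 0 <= ts <= t0 ->
  exists (l : chart R L n) (W : set 'rV[R]_(n + 1)) (Q : 'rV[R]_(n + 1) -> R) (Mc : R),
  [/\ [/\ atlas l, dom l ps, open W & W (slice ts (l ps))], Ck 2 W Q,
    (forall w, W w -> 0 <= timeof w <= t0 ->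
      img l (lsubmx w) /\ omega (timeof w) (cinv l (lsubmx w)) = Q w) &
    (forall w, W w -> 0 <= timeof w <= t0 -> exists g : 'M[R]_n,
     [/\ g^T = g, posdef g &
         partial itime Q w <=
          \sum_p \sum_q invmx g p q * partial (ispace p) (partial (ispace q) Q) w
          + Mc * Q w])].
Proof.
move=> tI; have [l [W [g [al [Mc [r [[lat dl oW] r0 KW CQ H]]]]]]] :=
  local_omega_evolution oriented n_gt0 t0_gt0 F_smooth F_avoids_cut F_spacelike F_flow ps tI.
pose w0 := slice ts (l ps).
exists l, (ball w0 r), (norm_sq g al), Mc.
have bK w : ball w0 r w -> closed_ball_ Num.Def.normr w0 r w.
  by rewrite -ball_normE /=; exact: ltW.
split.
- split; [exact: lat|exact: dl|exact: ball_open|exact: ballxx].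
- by apply: Ck_sub CQ => w /bK /KW.
- by move=> w /bK /KW Ww wI; have [h1 h2 _ _ _] := H w Ww wI.
- move=> w wb wI; have [_ _ gT gp ev] := H w (KW _ (bK _ wb)) wI.
  by exists (g w); split=> //; exact: ev (bK _ wb).
Qed.

Lemma slice_chart_continuous (l : chart R L n) (q0 : R * L) : atlas l -> dom l q0.2 ->
  {for q0, continuous (fun q : R * L => slice q.1 (l q.2))}.
Proof.
move=> lat dl; have [_ _ cl _ _] := atlas_chart lat.
apply: continuous_slice; first exact: cvg_fst.
apply: (@continuous_comp _ _ _ (@snd R L) (cmap l)); last exact: cl.
exact: cvg_snd.
Qed.

Lemma near_model (l : chart R L n) (W : set 'rV[R]_(n + 1)) (q0 : R * L) :
  atlas l -> dom l q0.2 -> open W -> W (slice q0.1 (l q0.2)) ->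
  \forall q \near q0, dom l q.2 /\ W (slice q.1 (l q.2)).
Proof.
move=> lat dl oW Ww; have [od _ _ _ _] := atlas_chart lat.
apply: filterI.
  have c2 : {for q0, continuous (@snd R L)} by exact: cvg_snd.
  by apply: c2; exact: open_nbhs_nbhs.
by apply: (slice_chart_continuous lat dl); exact: open_nbhs_nbhs.
Qed.

Lemma weighted_omega_continuous lam : {within space_time, continuous (weighted_omega lam)}.
Proof.
apply/subspace_continuousP => q0 q0I.
have [l [W [Q [Mc [[lat dl oW Ww] CQ H _]]]]] := omega_locally q0.2 q0I.
have cl := atlas_chart lat.
have e (q : R * L) : dom l q.2 -> W (slice q.1 (l q.2)) -> space_time q ->
    omega q.1 q.2 = Q (slice q.1 (l q.2)).
  move=> dq Wq qI; have := H _ Wq; rewrite timeof_slice lsubmx_slice (cmapK cl dq).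
  by move=> /(_ qI)[].
have cc : {for q0, continuous (fun q : R * L => expR (- (lam * q.1)) * Q (slice q.1 (l q.2)))}.
  apply: (@continuousM _ _ (fun q : R * L => expR (- (lam * q.1)))).
    apply: (@continuous_comp _ _ _ (fun q : R * L => - (lam * q.1)) (@expR R)); last exact: continuous_expR.
    apply: (@continuousN _ _ _ (fun q : R * L => lam * q.1)).
    apply: (@continuousM _ _ (fun=> lam) (@fst R L)); first exact: cst_continuous.
    exact: cvg_fst.
  apply: (@continuous_comp _ _ _ (fun q : R * L => slice q.1 (l q.2)) Q).
    exact: slice_chart_continuous.
  exact: Ck_continuous CQ Ww.
have G : weighted_omega lam @ within space_time (nbhs q0) --> expR (- (lam * q0.1)) * Q (slice q0.1 (l q0.2)).
  apply: cvg_trans (cvg_trans (cvg_app _ (@cvg_within _ _ _ _)) cc).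
  apply: near_eq_cvg; apply: filterS (near_model lat dl oW Ww) => q [dq Wq] qI.
  by rewrite /weighted_omega (e q dq Wq qI).
by rewrite -(e q0 dl Ww q0I) in G; exact: G.
Qed.

(** Stated for all lam beyond a local constant, so that finitely many constants
    can be replaced by their maximum in omega_vanishes. *)
Lemma no_weighted_max_near (q0 : R * L) : space_time q0 ->
  exists Mc : R, \forall q \near q0, forall lam : R, Mc < lam -> 0 < q.1 <= t0 ->
    0 < omega q.1 q.2 ->
    ~ (forall q', space_time q' -> weighted_omega lam q' <= weighted_omega lam q).
Proof.
move=> q0I; have [l [W [Q [Mc [[lat dl oW Ww] CQ H ev]]]]] := omega_locally q0.2 q0I.
have cl := atlas_chart lat; exists Mc.
apply: filterS (near_model lat dl oW Ww) => -[t p] /= [dp Wp] lam lamM /andP[tp tt0] op mx.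
have tI : 0 <= t <= t0 by rewrite ltW.
have e : omega t p = Q (slice t (l p)).
  have := H _ Wp; rewrite timeof_slice lsubmx_slice (cmapK cl dp).
  by move=> /(_ tI)[].
have [g [gT gp evo]] : exists g : 'M[R]_n,
     [/\ g^T = g, posdef g &
         partial itime Q (slice t (l p)) <=
          \sum_i \sum_j invmx g i j * partial (ispace i) (partial (ispace j) Q) (slice t (l p))
          + Mc * Q (slice t (l p))].
  by apply: ev => //; rewrite timeof_slice.
suff : lam <= Mc by rewrite leNgt lamM.
apply: (no_interior_max oW CQ Wp tp gT gp evo); last by rewrite -e.
move=> s u' /andP[s0 st] Ws.
have sI : 0 <= s <= t0 by rewrite s0 (le_trans st).
have := H _ Ws; rewrite timeof_slice lsubmx_slice => /(_ sI)[_ <-].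
by rewrite -e; exact: (mx (s, cinv l u') sI).
Qed.

(** Compactness provides a lam beyond all the local constants. A positive maximum
    of weighted_omega is then excluded at positive times by
    no_weighted_max_near, and at time 0 by the initial condition. *)
Lemma omega_vanishes (L_compact : compact [set: L]) :
  (forall p, omega 0 p = 0) -> forall t p, 0 <= t <= t0 -> omega t p = 0.
Proof.
move=> init t p tI.
have cD : compact space_time.
  have -> : space_time = `[0, t0]%classic `*` [set: L].
    by apply/seteqP; split=> q /=; rewrite in_itv /=; [move=> ?; split|case].
  by apply: compact_setX => //; exact: segment_compact.
have [lam Hlam] : exists lam : R, forall q, space_time q -> 0 < q.1 <= t0 ->
    0 < omega q.1 q.2 ->
    ~ (forall q', space_time q' -> weighted_omega lam q' <= weighted_omega lam q).
  have /compact_near_coveringP cov := cD.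
  have covL := cov R (pinfty_nbhs R) (fun lam q => 0 < q.1 <= t0 ->
    0 < omega q.1 q.2 ->
    ~ (forall q', space_time q' -> weighted_omega lam q' <= weighted_omega lam q)) _.
  apply: (@filter_ex _ (pinfty_nbhs R)); apply: covL.
  move=> q0 /no_weighted_max_near[Mc HMc].
  exists ([set q | forall lam : R, Mc < lam -> 0 < q.1 <= t0 ->
    0 < omega q.1 q.2 ->
    ~ (forall q', space_time q' -> weighted_omega lam q' <= weighted_omega lam q)],
    [set lam | Mc < lam]); first (split; [exact: HMc|apply: nbhs_pinfty_gt; exact: num_real]).
  by move=> [q lam] [/= h1 h2]; exact: h1.
have [q0 /set_mem q0D mx] := compact_EVT_max (ex_intro _ (t, p) tI) cD (@weighted_omega_continuous lam).
have mx' q' : space_time q' -> weighted_omega lam q' <= weighted_omega lam q0.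
  by move=> q'D; apply: mx; exact/mem_set.
have op0 s q : 0 <= s <= t0 -> 0 <= omega s q.
  exact: (omega_norm_ge0 F_smooth F_avoids_cut F_spacelike).
have [le0|] := leP (omega q0.1 q0.2) 0.
  apply/eqP; rewrite eq_le op0 // andbT.
  have := mx' (t, p) tI; rewrite /weighted_omega /= => le1.
  have le2 : expR (- (lam * t)) * omega t p <= 0.
    by apply: le_trans le1 _; rewrite pmulr_rle0 // expR_gt0.
  by move: le2; rewrite pmulr_rle0 // expR_gt0.
move=> opos; exfalso; have [z0|n0] := eqVneq q0.1 0.
  by move: opos; rewrite z0 init ltxx.
apply: (Hlam q0 q0D _ opos mx').
by case/andP: q0D => h1 h2; rewrite h2 andbT lt_neqAle eq_sym n0.
Qed.

End Conclusion.

Theorem theorem1p1 (R : realType) (n : nat) (n_ge2 : (2 <= n)%N)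
    (M Mb : manifold R n)
    (MMb_compact : compact [set: (M * Mb)%type])
    (X : KimMcCann M Mb) (Omega : para_nform M Mb)
    (oriented : compatible_orientation X)
    (L0 : manifold R n) (L0_closed : compact [set: L0])
    (t0 : R) (t0_gt0 : 0 < t0)
    (F : R -> L0 -> M * Mb)
    (F_smooth : smooth_family t0 F)
    (F_avoids_cut : forall t p, 0 <= t <= t0 -> ~ cut_locus X (F t p))
    (F_immersion : forall t, 0 <= t <= t0 -> immersion_at_time F t)
    (F_spacelike : forall t, 0 <= t <= t0 -> spacelike_at_time X F t)
    (F_flow : generalized_mcf X Omega t0 F) :
  lagrangian_at_time X F 0 ->
  forall t : R, 0 < t <= t0 -> lagrangian_at_time X F t.
Proof.
move=> lag0 t /andP[tp tt0].
have n_gt0 : (0 < n)%N by exact: leq_trans n_ge2.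
have z0 : 0 <= (0 : R) <= t0 by rewrite lexx ltW.
have tI : 0 <= t <= t0 by rewrite ltW.
have lagE s (sI : 0 <= s <= t0) := omega_norm_lagrangian F_smooth F_avoids_cut F_spacelike sI.
apply/(lagE t tI) => p.
apply: (omega_vanishes oriented n_gt0 t0_gt0 F_smooth F_avoids_cut F_spacelike F_flow L0_closed);
  last exact: tI.
exact/(lagE 0 z0).
Qed.
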